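(* Let $k$ be a field of characteristic $0$ containing a primitive $n$th root of unity $\omega$, and let $A$ be a quantum elementary abelian group over $k$, i.e. an iterated tensor product of copies of the Taft algebra $T_n$. Then the Lie structure on the Hopf algebra cohomology $\operatorname{H}^*(A,k)=\operatorname{Ext}^*_A(k,k)$ given by the Gerstenhaber bracket is abelian in positive degrees; that is, $[\alpha,\beta]=0$ for all homogeneous $\alpha,\beta\in\operatorname{H}^*(A,k)$ of positive degree.
   Context: The Taft algebra $T_n$ ($n\ge 2$) is the Hopf algebra over $k$ generated as an algebra by $x$ and $g$ with relations $gx=\omega xg$, $x^n=0$, $g^n=1$, and with $\Delta(x)=x\otimes 1+g\otimes x$, $\Delta(g)=g\otimes g$, $\varepsilon(x)=0$, $\varepsilon(g)=1$, $S(x)=-g^{-1}x$, $S(g)=g^{-1}$. A quantum elementary abelian group is a finite iterated tensor product $T_n\otimes\cdots\otimes T_n$ over $k$, with the tensor product Hopf algebra structure. For a Hopf algebra $A$ with bijective antipode $S$ and counit $\varepsilon$, $k$ is the trivial $A$-module via $\varepsilon$. Let $A^e=A\otimes A^{op}$ and let $\operatorname{HH}^*(A)=\operatorname{Ext}^*_{A^e}(A,A)$ be Hochschild cohomology, with its usual Gerstenhaber bracket. Identify $A$ with the subalgebra $\delta(A)$ of $A^e$, where $\delta(a)=\sum a_1\otimes S(a_2)$; then $A^e$ is projective as a right $A$-module and $A^e\otimes_A k\cong A$ as $A^e$-modules. The exact functor $A^e\otimes_A-$, applied to $n$-extensions of $k$ by $k$, induces an embedding of $\operatorname{H}^*(A,k)$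 into $\operatorname{HH}^*(A)$. The Gerstenhaber bracket of two elements of $\operatorname{H}^*(A,k)$ is defined via this embedding followed by the Gerstenhaber bracket on $\operatorname{HH}^*(A)$. *)

(* Defs.v *)
From HB Require Import structures.
From mathcomp Require Import all_boot all_order all_algebra all_field.

Set Implicit Arguments.
Unset Strict Implicit.
Unset Printing Implicit Defensive.

Import GRing.Theory.
Local Open Scope ring_scope.

(* Tensor products of finite-dimensional spaces are in coordinates: a tensor is *)
(* the matrix of its coefficients on the canonical bases of the two factors. *)

Section TensorSpace.
Variable k : fieldType.

Definition tensor (U V : vectType k) : Type := 'M[k]_(\dim {:U}, \dim {:V}).
HB.instance Definition _ (U V : vectType k) :=
  Vector.copy (tensor U V) 'M[k]_(\dim {:U}, \dim {:V}).

Definition bilin (U V W : lmodType k) (b : U -> V -> W) : Prop :=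
  (forall v, linear (b^~ v)) /\ (forall u, linear (b u)).

Definition basvec (U : vectType k) (i : 'I_(\dim {:U})) : U := (vbasis {:U})`_i.

Definition pure (U V : vectType k) (u : U) (v : V) : tensor U V :=
  \matrix_(i, j) (coord (vbasis {:U}) i u * coord (vbasis {:V}) j v).

(* The linear map on U (x) V determined by a bilinear map b; see [tliftE].   *)
Definition tlift (U V : vectType k) (W : lmodType k) (b : U -> V -> W)
    (M : tensor U V) : W :=
  \sum_i \sum_j (M : 'M[k]_(\dim {:U}, \dim {:V})) i j *: b (basvec i) (basvec j).

Lemma tlift_is_linear (U V : vectType k) (W : lmodType k) (b : U -> V -> W) :
  linear (tlift b).
Proof.
move=> c M N; rewrite /tlift scaler_sumr -big_split /=; apply: eq_bigr => i _.
rewrite scaler_sumr -big_split /=; apply: eq_bigr => j _.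
by rewrite !mxE scalerDl scalerA.
Qed.
HB.instance Definition _ (U V : vectType k) (W : lmodType k) (b : U -> V -> W) :=
  GRing.isLinear.Build k (tensor U V) W _ (tlift b) (@tlift_is_linear U V W b).

Lemma bilin_suml (U V W : lmodType k) (b : U -> V -> W) (I : Type) (r : seq I)
    (F : I -> U) v :
  bilin b -> b (\sum_(i <- r) F i) v = \sum_(i <- r) b (F i) v.
Proof.
case=> bl _; have b0 : b 0 v = 0.
  by have /eqP := bl v 1 0 0; rewrite scaler0 addr0 scale1r -subr_eq subrr eq_sym => /eqP.
elim: r => [|i r IH]; first by rewrite !big_nil.
by rewrite !big_cons -IH -{1}[F i]scale1r bl scale1r.
Qed.

Lemma bilin_sumr (U V W : lmodType k) (b : U -> V -> W) (I : Type) (r : seq I)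
    (F : I -> V) u :
  bilin b -> b u (\sum_(i <- r) F i) = \sum_(i <- r) b u (F i).
Proof.
case=> bl br; rewrite (@bilin_suml V U W (fun v u => b u v)) //; by split.
Qed.

Lemma bilinZl (U V W : lmodType k) (b : U -> V -> W) c u v :
  bilin b -> b (c *: u) v = c *: b u v.
Proof.
move=> Hb; have b0 := @bilin_suml _ _ _ b unit [::] (fun=> 0) v Hb.
rewrite !big_nil in b0; by rewrite -[c *: u]addr0 (proj1 Hb) b0 addr0.
Qed.

Lemma bilinZr (U V W : lmodType k) (b : U -> V -> W) c u v :
  bilin b -> b u (c *: v) = c *: b u v.
Proof. case=> bl br; apply: (@bilinZl V U W (fun v u => b u v)); by split. Qed.

Lemma pure_bilin (U V : vectType k) : bilin (@pure U V).
Proof.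
split=> [v c u u' | u c v v']; apply/matrixP=> i j; rewrite !mxE linearP /=.
  by rewrite mulrDl mulrA.
by rewrite mulrDr mulrCA.
Qed.

Lemma basvecE (U : vectType k) (u : U) :
  u = \sum_i coord (vbasis {:U}) i u *: basvec i.
Proof. exact: coord_vbasis (memvf u). Qed.

Lemma tliftE (U V : vectType k) (W : lmodType k) (b : U -> V -> W) u v :
  bilin b -> tlift b (pure u v) = b u v.
Proof.
move=> Hb; rewrite {2}[u]basvecE (bilin_suml _ _ _ Hb) /tlift.
apply: eq_bigr => i _; rewrite {2}[v]basvecE (bilin_sumr _ _ _ Hb).
apply: eq_bigr => j _.
by rewrite bilinZl // bilinZr // scalerA /pure mxE.
Qed.

Definition terms (U V : vectType k) (M : tensor U V) : seq (U * V) :=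
  [seq ((M : 'M[k]_(\dim {:U}, \dim {:V})) i j *: basvec i, basvec j)
     | i <- enum 'I_(\dim {:U}), j <- enum 'I_(\dim {:V})].

Lemma tlift_terms (U V : vectType k) (W : lmodType k) (b : U -> V -> W) M :
  bilin b -> tlift b M = \sum_(p <- terms M) b p.1 p.2.
Proof.
move=> Hb; rewrite big_allpairs_dep /= big_enum /=; apply: eq_bigr => i _.
by rewrite big_enum /=; apply: eq_bigr => j _; rewrite bilinZl.
Qed.

Lemma pure_basvec (U V : vectType k) (M : tensor U V) : M = tlift (@pure U V) M.
Proof.
rewrite {1}[M]matrix_sum_delta /tlift; apply: eq_bigr => i _.
apply: eq_bigr => j _; congr (_ *: _); apply/matrixP=> i' j'.
have bU := basis_free (vbasisP {:U}); have bV := basis_free (vbasisP {:V}).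
by rewrite !mxE !coord_free // -natrM mulnb [i == i']eq_sym [j == j']eq_sym.
Qed.

Lemma termsE (U V : vectType k) (M : tensor U V) :
  M = \sum_(p <- terms M) pure p.1 p.2.
Proof. by rewrite {1}[M]pure_basvec (tlift_terms _ (@pure_bilin U V)). Qed.

Lemma tensor_ext (U V : vectType k) (W : lmodType k) (f g : tensor U V -> W) :
  linear f -> linear g -> (forall u v, f (pure u v) = g (pure u v)) -> f =1 g.
Proof.
move=> lf lg fg M.
pose hf := GRing.isLinear.Build k _ _ _ f lf.
pose hg := GRing.isLinear.Build k _ _ _ g lg.
pose F : {linear _ -> _} := HB.pack f hf.
pose G : {linear _ -> _} := HB.pack g hg.
rewrite -[f]/(F : _ -> _) -[g]/(G : _ -> _) [M]termsE !linear_sum /=.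
by apply: eq_bigr => p _; apply: fg.
Qed.

Lemma pureLl (U V : vectType k) c (u u' : U) (v : V) :
  pure (c *: u + u') v = c *: pure u v + pure u' v.
Proof. exact: (@pure_bilin U V).1. Qed.

Lemma pureLr (U V : vectType k) c (u : U) (v v' : V) :
  pure u (c *: v + v') = c *: pure u v + pure u v'.
Proof. exact: (@pure_bilin U V).2. Qed.

Lemma eq_tlift (U V : vectType k) (W : lmodType k) (b b' : U -> V -> W) M :
  b =2 b' -> tlift b M = tlift b' M.
Proof.
by move=> e; apply: eq_bigr => i _; apply: eq_bigr => j _; rewrite e.
Qed.

Lemma tlift_lin (U V : vectType k) (W : lmodType k) (b b1 b2 : U -> V -> W) c M :
  (forall u v, b u v = c *: b1 u v + b2 u v) ->
  tlift b M = c *: tlift b1 M + tlift b2 M.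
Proof.
move=> e; rewrite /tlift scaler_sumr -big_split /=; apply: eq_bigr => i _.
rewrite scaler_sumr -big_split /=; apply: eq_bigr => j _.
by rewrite e scalerDr !scalerA mulrC.
Qed.

End TensorSpace.

Section TensorAlgebra.
Variables (k : fieldType) (A B : falgType k).

Definition tmul (M N : tensor A B) : tensor A B :=
  tlift (fun a b => tlift (fun a' b' => pure (a * a') (b * b')) N) M.

Lemma tmul_pure (a a' : A) (b b' : B) :
  tmul (pure a b) (pure a' b') = pure (a * a') (b * b').
Proof.
rewrite /tmul tliftE; last first.
  split=> [? c u v|? c u v]; apply: tlift_lin => x y;
  by rewrite mulrDl -scalerAl (pureLl, pureLr).
rewrite tliftE //.
by split=> [? c u v|? c u v]; rewrite mulrDr -scalerAr (pureLl, pureLr).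
Qed.

Lemma tmulLl c M M' N : tmul (c *: M + M') N = c *: tmul M N + tmul M' N.
Proof. exact: linearP. Qed.

Lemma tmulLr c M N N' : tmul M (c *: N + N') = c *: tmul M N + tmul M N'.
Proof. by apply: tlift_lin => a b; rewrite linearP. Qed.

Fact tmulA : associative tmul.
Proof.
move=> M N P; move: M; apply: tensor_ext => [c x y|c x y|a b]; rewrite ?tmulLl //.
move: N; apply: tensor_ext => [c x y|c x y|a' b']; rewrite ?(tmulLl, tmulLr) //.
move: P; apply: tensor_ext => [c x y|c x y|a2 b2]; rewrite ?(tmulLl, tmulLr) //.
by rewrite !tmul_pure !mulrA.
Qed.

Fact tmul1r : left_id (pure 1 1) tmul.
Proof.
apply: tensor_ext => [c x y|c x y|a b]; rewrite ?(tmulLl, tmulLr) //.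
by rewrite tmul_pure !mul1r.
Qed.

Fact tmulr1 : right_id (pure 1 1) tmul.
Proof.
apply: tensor_ext => [c x y|c x y|a b]; rewrite ?(tmulLl, tmulLr) //.
by rewrite tmul_pure !mulr1.
Qed.

Fact tmulDl : left_distributive tmul +%R.
Proof. by move=> M N P; have := tmulLl 1 M N P; rewrite !scale1r. Qed.

Fact tmulDr : right_distributive tmul +%R.
Proof. by move=> P M N; have := tmulLr 1 P M N; rewrite !scale1r. Qed.

Fact pure11_neq0 : pure (1 : A) (1 : B) != 0.
Proof.
have nz (C : falgType k) : exists i, coord (vbasis {:C}) i 1 != 0.
  apply/existsP; apply: contraT => /existsPn e.
  have /eqP := basvecE (1 : C); rewrite big1 ?oner_eq0 // => i _.
  by have := e i; rewrite negbK => /eqP ->; rewrite scale0r.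
have [i hi] := nz A; have [j hj] := nz B.
apply/eqP => /matrixP/(_ i j); rewrite !mxE => /eqP.
by rewrite mulf_eq0 (negPf hi) (negPf hj).
Qed.

HB.instance Definition _ := GRing.Zmodule_isNzRing.Build (tensor A B)
  tmulA tmul1r tmulr1 tmulDl tmulDr pure11_neq0.

Fact tmul_scaleAl c (M N : tensor A B) : c *: (M * N) = (c *: M) * N.
Proof. by rewrite -[c *: M]addr0 [RHS]tmulLl [tmul 0 N]linear0 addr0. Qed.

HB.instance Definition _ :=
  GRing.Lmodule_isLalgebra.Build k (tensor A B) tmul_scaleAl.

Fact tmul_scaleAr c (M N : tensor A B) : c *: (M * N) = M * (c *: N).
Proof. by rewrite -[c *: N]addr0 [RHS]tmulLr (mulr0 M : tmul M 0 = 0) addr0. Qed.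

HB.instance Definition _ :=
  GRing.Lalgebra_isAlgebra.Build k (tensor A B) tmul_scaleAr.
HB.instance Definition _ := Algebra_isFalgebra.Build k (tensor A B).

End TensorAlgebra.

Section Opposite.
Variables (k : fieldType) (A : falgType k).

Definition opp_alg : Type := A.
HB.instance Definition _ := Vector.copy opp_alg A.

Let omul (a b : opp_alg) : opp_alg := (b : A) * (a : A).

Fact omulA : associative omul. Proof. by move=> a b c; rewrite /omul mulrA. Qed.
Fact omul1 : left_id (1 : A) omul. Proof. by move=> a; apply: mulr1. Qed.
Fact o1mul : right_id (1 : A) omul. Proof. by move=> a; apply: mul1r. Qed.
Fact omulDl : left_distributive omul +%R.
Proof. by move=> a b c; apply: mulrDr. Qed.
Fact omulDr : right_distributive omul +%R.
Proof. by move=> a b c; apply: mulrDl. Qed.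
Fact o1_neq0 : (1 : A) != 0 :> opp_alg. Proof. exact: oner_neq0. Qed.

HB.instance Definition _ := GRing.Zmodule_isNzRing.Build opp_alg
  omulA omul1 o1mul omulDl omulDr o1_neq0.

Fact omul_scaleAl c (a b : opp_alg) : c *: omul a b = omul (c *: a) b.
Proof. exact: (scalerAr c (b : A) (a : A)). Qed.
HB.instance Definition _ :=
  GRing.Lmodule_isLalgebra.Build k opp_alg omul_scaleAl.

Fact omul_scaleAr c (a b : opp_alg) : c *: omul a b = omul a (c *: b).
Proof. exact: (scalerAl c (b : A) (a : A)). Qed.
HB.instance Definition _ :=
  GRing.Lalgebra_isAlgebra.Build k opp_alg omul_scaleAr.
HB.instance Definition _ := Algebra_isFalgebra.Build k opp_alg.

End Opposite.

(* In Sweedler notation,                                                     *)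
(*   tlift (fun a1 a2 => F a1 a2) (hdelta a) = \sum F(a_1, a_2).             *)

Record hopfAlg (k : fieldType) := HopfAlg {
  hopf_alg :> falgType k;
  hdelta : {lrmorphism hopf_alg -> tensor hopf_alg hopf_alg};
  heps : {lrmorphism hopf_alg -> k^o};
  hantipode : {linear hopf_alg -> hopf_alg};
  hcoassoc : forall a,
    tlift (fun a1 a2 => tlift (fun a11 a12 => pure a11 (pure a12 a2)) (hdelta a1))
      (hdelta a) = tlift (fun a1 a2 => pure a1 (hdelta a2)) (hdelta a);
  hcounitl : forall a, tlift (fun a1 a2 => (heps a1 : k) *: a2) (hdelta a) = a;
  hcounitr : forall a, tlift (fun a1 a2 => (heps a2 : k) *: a1) (hdelta a) = a;
  hantipodel : forall a,
    tlift (fun a1 a2 => hantipode a1 * a2) (hdelta a) = (heps a : k)%:A;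
  hantipoder : forall a,
    tlift (fun a1 a2 => a1 * hantipode a2) (hdelta a) = (heps a : k)%:A
}.
Arguments hdelta {k h}.
Arguments heps {k h}.
Arguments hantipode {k h}.

Section TliftTheory.
Variable k : fieldType.

Lemma tlift_comp (U V : vectType k) (W W' : lmodType k) (f : W -> W')
    (b : U -> V -> W) M :
  linear f -> f (tlift b M) = tlift (fun u v => f (b u v)) M.
Proof.
move=> lf; pose hf := GRing.isLinear.Build k _ _ _ f lf.
pose F : {linear _ -> _} := HB.pack f hf.
rewrite -[f]/(F : _ -> _) /tlift linear_sum; apply: eq_bigr => i _.
by rewrite linear_sum; apply: eq_bigr => j _; rewrite linearZ.
Qed.

Lemma tlift_swap (U V U' V' : vectType k) (W : lmodType k)
    (b : U -> V -> U' -> V' -> W) M N :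
  tlift (fun u v => tlift (b u v) N) M =
  tlift (fun u' v' => tlift (fun u v => b u v u' v') M) N.
Proof.
transitivity (\sum_i \sum_j \sum_i' \sum_j'
  ((M : 'M[k]_(_, _)) i j * (N : 'M[k]_(_, _)) i' j')
    *: b (basvec i) (basvec j) (basvec i') (basvec j')).
  rewrite /tlift; apply: eq_bigr => i _; apply: eq_bigr => j _.
  rewrite scaler_sumr; apply: eq_bigr => i' _.
  by rewrite scaler_sumr; apply: eq_bigr => j' _; rewrite scalerA.
transitivity (\sum_i' \sum_j' \sum_i \sum_j
  ((M : 'M[k]_(_, _)) i j * (N : 'M[k]_(_, _)) i' j')
    *: b (basvec i) (basvec j) (basvec i') (basvec j')); last first.
  rewrite /tlift; apply: eq_bigr => i _; apply: eq_bigr => j _.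
  rewrite scaler_sumr; apply: eq_bigr => i' _.
  by rewrite scaler_sumr; apply: eq_bigr => j' _; rewrite scalerA mulrC.
under eq_bigr => i _ do rewrite exchange_big.
rewrite exchange_big; apply: eq_bigr => i' _.
under eq_bigr => i _ do rewrite exchange_big.
by rewrite exchange_big.
Qed.

Definition shuf (U V : vectType k) (X : tensor U U) (Y : tensor V V) :
    tensor (tensor U V) (tensor U V) :=
  tlift (fun a1 a2 => tlift (fun b1 b2 => pure (pure a1 b1) (pure a2 b2)) Y) X.

Lemma shufLl (U V : vectType k) c (X X' : tensor U U) (Y : tensor V V) :
  shuf (c *: X + X') Y = c *: shuf X Y + shuf X' Y.
Proof. exact: linearP. Qed.

Lemma shufLr (U V : vectType k) c (X : tensor U U) (Y Y' : tensor V V) :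
  shuf X (c *: Y + Y') = c *: shuf X Y + shuf X Y'.
Proof. by apply: tlift_lin => a b; rewrite linearP. Qed.

Lemma shuf_pure (U V : vectType k) (a a' : U) (b b' : V) :
  shuf (pure a a') (pure b b') = pure (pure a b) (pure a' b').
Proof.
rewrite /shuf tliftE; first rewrite tliftE //.
  by split=> [? ? ? ?|? ? ? ?]; rewrite /= !(pureLl, pureLr).
by split=> [? ? ? ?|? ? ? ?]; apply: tlift_lin => *; rewrite /= !(pureLl, pureLr).
Qed.

Lemma tlift_shuf (U V : vectType k) (W : lmodType k)
    (F : tensor U V -> tensor U V -> W) X Y :
  bilin F -> tlift F (shuf X Y) =
  tlift (fun a1 a2 => tlift (fun b1 b2 => F (pure a1 b1) (pure a2 b2)) Y) X.
Proof.
move=> bF; rewrite /shuf (@tlift_comp _ _ _ _ (tlift F)); last exact: linearP.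
apply: eq_tlift => a1 a2; rewrite (@tlift_comp _ _ _ _ (tlift F)); last exact: linearP.
by apply: eq_tlift => b1 b2; rewrite tliftE.
Qed.

Lemma shufM (A B : falgType k) (X X' : tensor A A) (Y Y' : tensor B B) :
  shuf (X * X') (Y * Y') = shuf X Y * shuf X' Y'.
Proof.
have ml (C : falgType k) c (x y z : C) : (c *: x + y) * z = c *: (x * z) + y * z.
  by rewrite mulrDl scalerAl.
have mr (C : falgType k) c (x y z : C) : z * (c *: x + y) = c *: (z * x) + z * y.
  by rewrite mulrDr scalerAr.
move: X; apply: tensor_ext => [c x y|c x y|a1 a2];
  rewrite ?(shufLl, shufLr, ml, mr) //.
move: X'; apply: tensor_ext => [c x y|c x y|a1' a2'];
  rewrite ?(shufLl, shufLr, ml, mr) //.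
move: Y; apply: tensor_ext => [c x y|c x y|b1 b2];
  rewrite ?(shufLl, shufLr, ml, mr) //.
move: Y'; apply: tensor_ext => [c x y|c x y|b1' b2'];
  rewrite ?(shufLl, shufLr, ml, mr) //.
have pM (C D : falgType k) (c c' : C) (d d' : D) :
  pure c d * pure c' d' = pure (c * c') (d * d') by exact: tmul_pure.
by rewrite !pM !shuf_pure !pM.
Qed.

Lemma hcoassocT (A : hopfAlg k) (W : lmodType k) (t : A -> A -> A -> W) (a : A) :
  (forall y z, linear (fun x => t x y z)) -> (forall x z, linear (fun y => t x y z)) ->
  (forall x y, linear (t x y)) ->
  tlift (fun a1 a2 => tlift (fun a11 a12 => t a11 a12 a2) (hdelta a1)) (hdelta a) =
  tlift (fun a1 a2 => tlift (fun a21 a22 => t a1 a21 a22) (hdelta a2)) (hdelta a).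
Proof.
move=> t1 t2 t3; pose g := tlift (fun x (Y : tensor A A) => tlift (t x) Y).
have gb : bilin (fun x (Y : tensor A A) => tlift (t x) Y).
  split=> [Y c x x'|x]; last exact: linearP.
  by apply: tlift_lin => u v; rewrite t1.
have := congr1 g (hcoassoc a); rewrite /g.
rewrite (@tlift_comp _ _ _ _ (tlift _)); last exact: linearP.
rewrite [RHS](@tlift_comp _ _ _ _ (tlift _)); last exact: linearP.
move=> e; transitivity (tlift (fun u v : A => tlift (fun x Y => tlift (t x) Y)
    (tlift (fun a11 a12 => pure a11 (pure a12 v)) (hdelta u))) (hdelta a)).
  apply: eq_tlift => a1 a2.
  rewrite (@tlift_comp _ _ _ _ (tlift _)); last exact: linearP.
  by apply: eq_tlift => x y; rewrite tliftE // tliftE //; split.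
by rewrite e; apply: eq_tlift => a1 a2; rewrite tliftE.
Qed.

End TliftTheory.

Section TensorHopf.
Variables (k : fieldType) (A B : hopfAlg k).
Local Notation AB := (tensor A B).

Definition tens_delta : AB -> tensor AB AB :=
  tlift (fun a b => shuf (hdelta a) (hdelta b)).
Definition tens_eps : AB -> k^o := tlift (fun a b => heps a * heps b : k^o).
Definition tens_antipode : AB -> AB :=
  tlift (fun a b => pure (hantipode a) (hantipode b)).

Lemma tens_delta_pure a b :
  tens_delta (pure a b) = shuf (hdelta a) (hdelta b).
Proof.
by rewrite /tens_delta tliftE //; split=> [? ? ? ?|? ? ? ?]; rewrite linearP (shufLl, shufLr).
Qed.

Lemma tens_eps_pure a b : tens_eps (pure a b) = heps a * heps b.
Proof.
rewrite /tens_eps tliftE //; split=> [? ? ? ?|? ? ? ?]; rewrite linearP /=.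
  by rewrite mulrDl -scalerAl.
by rewrite mulrDr -scalerAr.
Qed.

Lemma tens_antipode_pure a b :
  tens_antipode (pure a b) = pure (hantipode a) (hantipode b).
Proof.
by rewrite /tens_antipode tliftE //; split=> [? ? ? ?|? ? ? ?]; rewrite linearP (pureLl, pureLr).
Qed.

HB.instance Definition _ := GRing.Linear.on tens_antipode.

Fact tens_delta_linear : linear tens_delta. Proof. exact: linearP. Qed.
Fact tens_eps_linear : linear tens_eps. Proof. exact: linearP. Qed.
Fact tens_antipode_linear : linear tens_antipode. Proof. exact: linearP. Qed.

Let ml (C : falgType k) c (x y z : C) : (c *: x + y) * z = c *: (x * z) + y * z.
Proof. by rewrite mulrDl scalerAl. Qed.
Let mr (C : falgType k) c (x y z : C) : z * (c *: x + y) = c *: (z * x) + z * y.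
Proof. by rewrite mulrDr scalerAr. Qed.
Let pM (C D : falgType k) (c c' : C) (d d' : D) :
  pure c d * pure c' d' = pure (c * c') (d * d').
Proof. exact: tmul_pure. Qed.

Fact tens_delta_mul : monoid_morphism tens_delta.
Proof.
split.
  by rewrite -[1]/(pure 1 1) tens_delta_pure !rmorph1 -[1]/(pure 1 1) shuf_pure.
move=> M N; move: M; apply: tensor_ext => [c x y|c x y|a b];
  rewrite ?(tens_delta_linear, ml, mr) //.
move: N; apply: tensor_ext => [c x y|c x y|a' b'];
  rewrite ?(tens_delta_linear, ml, mr) //.
by rewrite pM !tens_delta_pure !rmorphM shufM.
Qed.

Fact tens_eps_mul : monoid_morphism tens_eps.
Proof.
split.
  by rewrite -[1]/(pure 1 1) tens_eps_pure !rmorph1 mulr1.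
move=> M N; move: M; apply: tensor_ext => [c x y|c x y|a b];
  rewrite ?(tens_eps_linear, ml, mr) //.
move: N; apply: tensor_ext => [c x y|c x y|a' b'];
  rewrite ?(tens_eps_linear, ml, mr) //.
by rewrite pM !tens_eps_pure !rmorphM mulrACA.
Qed.

HB.instance Definition _ := GRing.isLinear.Build k AB (tensor AB AB) _
  tens_delta tens_delta_linear.
HB.instance Definition _ := GRing.isMonoidMorphism.Build AB (tensor AB AB)
  tens_delta tens_delta_mul.
HB.instance Definition _ := GRing.isLinear.Build k AB k^o _
  tens_eps tens_eps_linear.
HB.instance Definition _ := GRing.isMonoidMorphism.Build AB k^o
  tens_eps tens_eps_mul.

Fact tens_coassoc (X : AB) :
  tlift (fun x1 x2 => tlift (fun x11 x12 => pure x11 (pure x12 x2))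
    (tens_delta x1)) (tens_delta X) =
  tlift (fun x1 x2 => pure x1 (tens_delta x2)) (tens_delta X).
Proof.
move: X; apply: tensor_ext => [c x y|c x y|a b].
- by rewrite !linearP.
- by rewrite !linearP.
rewrite tens_delta_pure !tlift_shuf; first last.
- split=> [z c x y|z c x y]; last by apply: tlift_lin => u v; rewrite !pureLr.
  by rewrite !linearP.
- by split=> [z c x y|z c x y]; rewrite ?linearP !(pureLl, pureLr).
transitivity (tlift (fun a1 a2 => tlift (fun a11 a12 => tlift (fun b1 b2 =>
   tlift (fun b11 b12 => pure (pure a11 b11) (pure (pure a12 b12) (pure a2 b2)))
   (hdelta b1)) (hdelta b)) (hdelta a1)) (hdelta a)).
  apply: eq_tlift => a1 a2; rewrite [RHS]tlift_swap; apply: eq_tlift => b1 b2.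
  rewrite tens_delta_pure tlift_shuf //.
  by split=> [? ? ? ?|? ? ? ?]; rewrite !(pureLl, pureLr).
rewrite (@hcoassocT _ _ _ (fun a11 a12 a2 => tlift (fun b1 b2 =>
   tlift (fun b11 b12 => pure (pure a11 b11) (pure (pure a12 b12) (pure a2 b2)))
   (hdelta b1)) (hdelta b))); first last.
- by move=> ? ? ? ? ?; do 2!apply: tlift_lin => ? ?; rewrite !(pureLl, pureLr).
- by move=> ? ? ? ? ?; do 2!apply: tlift_lin => ? ?; rewrite !(pureLl, pureLr).
- by move=> ? ? ? ? ?; do 2!apply: tlift_lin => ? ?; rewrite !(pureLl, pureLr).
apply: eq_tlift => a1 a2.
transitivity (tlift (fun a21 a22 => tlift (fun b1 b2 => tlift (fun b21 b22 =>
   pure (pure a1 b1) (pure (pure a21 b21) (pure a22 b22))) (hdelta b2))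
   (hdelta b)) (hdelta a2)).
  apply: eq_tlift => a21 a22; apply: (@hcoassocT _ B _ (fun b11 b12 b2 =>
    pure (pure a1 b11) (pure (pure a21 b12) (pure a22 b2)))).
  - by move=> ? ? ? ? ?; rewrite !(pureLl, pureLr).
  - by move=> ? ? ? ? ?; rewrite !(pureLl, pureLr).
  - by move=> ? ? ? ? ?; rewrite !(pureLl, pureLr).
rewrite tlift_swap; apply: eq_tlift => b1 b2.
rewrite tens_delta_pure (@tlift_comp _ _ _ _ _ (pure (pure a1 b1))); last first.
  by move=> ? ? ?; rewrite pureLr.
apply: eq_tlift => a21 a22; rewrite (@tlift_comp _ _ _ _ _ (pure (pure a1 b1))) //.
by move=> ? ? ?; rewrite pureLr.
Qed.

Fact tens_counitl (X : AB) :
  tlift (fun x1 x2 => (tens_eps x1 : k) *: x2) (tens_delta X) = X.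
Proof.
move: X; apply: (@tensor_ext _ _ _ _ _ id) => [c x y|c x y|a b] //.
  by rewrite !linearP.
rewrite tens_delta_pure tlift_shuf; last first.
  split=> [z c x y|z c x y]; last by rewrite scalerDr !scalerA mulrC.
  by rewrite linearP scalerDl -scalerA.
rewrite -[in RHS](hcounitl a) -[in RHS](hcounitl b).
rewrite (@tlift_comp _ _ _ _ _ (fun z => pure z _)); last by move=> ? ? ?; rewrite pureLl.
apply: eq_tlift => a1 a2.
rewrite (@tlift_comp _ _ _ _ _ (pure _)); last by move=> ? ? ?; rewrite pureLr.
apply: eq_tlift => b1 b2; rewrite tens_eps_pure.
by rewrite (bilinZl _ _ _ (pure_bilin _ _)) (bilinZr _ _ _ (pure_bilin _ _)) scalerA.
Qed.

Fact tens_counitr (X : AB) :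
  tlift (fun x1 x2 => (tens_eps x2 : k) *: x1) (tens_delta X) = X.
Proof.
move: X; apply: (@tensor_ext _ _ _ _ _ id) => [c x y|c x y|a b] //.
  by rewrite !linearP.
rewrite tens_delta_pure tlift_shuf; last first.
  split=> [z c x y|z c x y]; first by rewrite scalerDr !scalerA mulrC.
  by rewrite linearP scalerDl -scalerA.
rewrite -[in RHS](hcounitr a) -[in RHS](hcounitr b).
rewrite (@tlift_comp _ _ _ _ _ (fun z => pure z _)); last by move=> ? ? ?; rewrite pureLl.
apply: eq_tlift => a1 a2.
rewrite (@tlift_comp _ _ _ _ _ (pure _)); last by move=> ? ? ?; rewrite pureLr.
apply: eq_tlift => b1 b2; rewrite tens_eps_pure.
by rewrite (bilinZl _ _ _ (pure_bilin _ _)) (bilinZr _ _ _ (pure_bilin _ _)) scalerA.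
Qed.

Fact tens_antipodel (X : AB) :
  tlift (fun x1 x2 => tens_antipode x1 * x2) (tens_delta X) = (tens_eps X : k)%:A :> AB.
Proof.
move: X; apply: tensor_ext => [c x y|c x y|a b].
- by rewrite !linearP.
- by rewrite linearP scalerDl -scalerA.
rewrite tens_delta_pure tlift_shuf; last first.
  split=> [z c x y|z c x y]; last by rewrite mr.
  by rewrite linearP ml.
rewrite tens_eps_pure -scalerA -[1 in RHS]/(pure 1 1).
rewrite -(bilinZr _ _ _ (pure_bilin _ _)) -(bilinZl _ _ _ (pure_bilin _ _)).
rewrite -!hantipodel.
rewrite (@tlift_comp _ _ _ _ _ (fun z => pure z _)); last by move=> ? ? ?; rewrite pureLl.
apply: eq_tlift => a1 a2.
rewrite (@tlift_comp _ _ _ _ _ (pure _)); last by move=> ? ? ?; rewrite pureLr.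
by apply: eq_tlift => b1 b2; rewrite tens_antipode_pure pM.
Qed.

Fact tens_antipoder (X : AB) :
  tlift (fun x1 x2 => x1 * tens_antipode x2) (tens_delta X) = (tens_eps X : k)%:A :> AB.
Proof.
move: X; apply: tensor_ext => [c x y|c x y|a b].
- by rewrite !linearP.
- by rewrite linearP scalerDl -scalerA.
rewrite tens_delta_pure tlift_shuf; last first.
  split=> [z c x y|z c x y]; first by rewrite ml.
  by rewrite linearP mr.
rewrite tens_eps_pure -scalerA -[1 in RHS]/(pure 1 1).
rewrite -(bilinZr _ _ _ (pure_bilin _ _)) -(bilinZl _ _ _ (pure_bilin _ _)).
rewrite -!hantipoder.
rewrite (@tlift_comp _ _ _ _ _ (fun z => pure z _)); last by move=> ? ? ?; rewrite pureLl.
apply: eq_tlift => a1 a2.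
rewrite (@tlift_comp _ _ _ _ _ (pure _)); last by move=> ? ? ?; rewrite pureLr.
by apply: eq_tlift => b1 b2; rewrite tens_antipode_pure pM.
Qed.

Definition tensor_hopf : hopfAlg k :=
  @HopfAlg k AB tens_delta tens_eps tens_antipode
    tens_coassoc tens_counitl tens_counitr tens_antipodel tens_antipoder.

End TensorHopf.

(* H (x) H (x) ... (x) H, with r.+1 factors.                                 *)
Fixpoint hopf_power (k : fieldType) (H : hopfAlg k) (r : nat) : hopfAlg k :=
  if r is r'.+1 then tensor_hopf H (hopf_power H r') else H.

Definition taft_relations (k : fieldType) (n : nat) (omega : k) (B : algType k)
    (x g : B) : Prop :=
  [/\ g * x = omega *: (x * g), x ^+ n = 0 & g ^+ n = 1].

(* T is the Taft algebra T_n, with standard generators x and g: as an algebra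
   it is presented by x, g and the relations above. *)
Definition is_taft (k : fieldType) (n : nat) (omega : k) (T : hopfAlg k)
    (x g : T) : Prop :=
  [/\ taft_relations n omega x g,
      forall (B : algType k) (x' g' : B), taft_relations n omega x' g' ->
        exists phi : {lrmorphism T -> B},
          [/\ phi x = x', phi g = g' &
              forall psi : {lrmorphism T -> B},
                psi x = x' -> psi g = g' -> psi =1 phi],
      hdelta x = pure x 1 + pure g x /\ hdelta g = pure g g,
      heps x = 0 /\ heps g = 1
    & hantipode x = - (g^-1 * x) /\ hantipode g = g^-1].

Definition env_alg (k : fieldType) (A : falgType k) := tensor A (opp_alg A).

Section RegularBimodule.
Variables (k : fieldType) (A : falgType k).

Definition bimod : Type := A.
HB.instance Definition _ := GRing.Zmodule.copy bimod A.

(* (a (x) b) acts on c by a c b. *)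
Definition bimod_scale (w : env_alg A) (c : bimod) : bimod :=
  tlift (fun (a : A) (b : opp_alg A) => a * (c : A) * (b : A)) w.

Let bimod_bilin (c : A) :
  bilin (fun (a : A) (b : opp_alg A) => a * c * (b : A)).
Proof.
split=> [b e a a' | a e b b'].
  by rewrite mulrDl mulrDl !scalerAl.
by rewrite [LHS]mulrDr scalerAr.
Qed.

Lemma bimod_scale_pure (a : A) (b : opp_alg A) (c : bimod) :
  bimod_scale (pure a b) c = (a * (c : A) * (b : A) : A).
Proof. exact: tliftE (bimod_bilin c). Qed.

Let bimod_scaleLr (w : env_alg A) e (c c' : A) :
  bimod_scale w (e *: c + c' : A) =
  (e *: (bimod_scale w c : A) + bimod_scale w c' : A).
Proof.
apply: tlift_lin => a b /=.
by rewrite mulrDr mulrDl -scalerAr -scalerAl.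
Qed.

Let bimod_scaleLl e (w w' : env_alg A) (c : A) :
  bimod_scale (e *: w + w') c =
  (e *: (bimod_scale w c : A) + bimod_scale w' c : A).
Proof. exact: linearP. Qed.

Fact bimod_scaleA (w w' : env_alg A) (c : bimod) :
  bimod_scale w (bimod_scale w' c) = bimod_scale (w * w') c.
Proof.
have ml (C : falgType k) e (x y z : C) : (e *: x + y) * z = e *: (x * z) + y * z.
  by rewrite mulrDl scalerAl.
have mr (C : falgType k) e (x y z : C) : z * (e *: x + y) = e *: (z * x) + z * y.
  by rewrite mulrDr scalerAr.
move: w; apply: (@tensor_ext _ _ _ A) => [e x y|e x y|a b].
- exact: bimod_scaleLl.
- by rewrite ml bimod_scaleLl.
move: w'; apply: (@tensor_ext _ _ _ A) => [e x y|e x y|a' b'].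
- by rewrite bimod_scaleLl bimod_scaleLr.
- by rewrite mr bimod_scaleLl.
by rewrite [pure a b * _]tmul_pure !bimod_scale_pure !mulrA.
Qed.

Fact bimod_scale1 : left_id 1 bimod_scale.
Proof. by move=> c; rewrite [LHS]bimod_scale_pure mul1r mulr1. Qed.

Fact bimod_scaleDr : right_distributive bimod_scale +%R.
Proof. by move=> w c c'; have := bimod_scaleLr w 1 c c'; rewrite !scale1r. Qed.

Fact bimod_scaleDl (c : bimod) :
  {morph bimod_scale^~ c : w w' / w + w'}.
Proof. by move=> w w'; have := bimod_scaleLl 1 w w' c; rewrite !scale1r. Qed.

HB.instance Definition _ := GRing.Zmodule_isLmodule.Build (env_alg A) bimod
  bimod_scaleA bimod_scale1 bimod_scaleDr bimod_scaleDl.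

End RegularBimodule.

(* The A-module k, with a acting on c by heps a * c. *)
Definition triv (k : fieldType) (A : hopfAlg k) : Type := k.

Section TrivialModule.
Variables (k : fieldType) (A : hopfAlg k).
Local Notation triv := (triv A).

HB.instance Definition _ := GRing.Zmodule.copy triv k.

Definition triv_scale (a : A) (c : triv) : triv := (heps a : k) * (c : k).

Fact triv_scaleA (a b : A) (c : triv) :
  triv_scale a (triv_scale b c) = triv_scale (a * b) c.
Proof. by rewrite /triv_scale rmorphM mulrA. Qed.

Fact triv_scale1 : left_id 1 triv_scale.
Proof. by move=> c; rewrite /triv_scale rmorph1 mul1r. Qed.

Fact triv_scaleDr : right_distributive triv_scale +%R.
Proof. by move=> a c c'; rewrite /triv_scale mulrDr. Qed.

Fact triv_scaleDl (c : triv) : {morph triv_scale^~ c : a b / a + b}.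
Proof. by move=> a b; rewrite /triv_scale raddfD mulrDl. Qed.

HB.instance Definition _ := GRing.Zmodule_isLmodule.Build A triv
  triv_scaleA triv_scale1 triv_scaleDr triv_scaleDl.

End TrivialModule.

(* Yoneda extensions: [yext M N p] is the type of exact sequences            *)
(*   0 -> N -> E_p -> ... -> E_0 -> M -> 0                                   *)
(* that is, of (p.+1)-extensions of M by N, whose classes are the elements   *)
(* of Ext^(p.+1)(M, N). The values of [yE] and [yd] beyond p are irrelevant. *)

Definition yterm (R : nzRingType) (M : lmodType R) (E : nat -> lmodType R)
    (i : nat) : lmodType R :=
  if i is j.+1 then E j else M.

Record yext (R : nzRingType) (M N : lmodType R) (p : nat) := Yext {
  yE : nat -> lmodType R;
  yd : forall i, {linear yE i -> yterm M yE i};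
  yincl : {linear N -> yE p};
  yd_surj : forall y : M, exists x, yd 0 x = y;
  yd_exact : forall i, (i < p)%N -> forall x : yE i,
    yd i x = 0 <-> exists y, yd i.+1 y = x;
  yincl_exact : forall x : yE p, yd p x = 0 <-> exists z, yincl z = x;
  yincl_inj : injective yincl
}.

Section Induction.
Variables (k : fieldType) (A : hopfAlg k).

(* a |-> \sum a_1 (x) S(a_2) *)
Definition env_delta (a : A) : env_alg A :=
  tlift (fun (a1 a2 : A) => pure a1 (hantipode a2 : opp_alg A)) (hdelta a).

Definition balanced (M : lmodType A) (Z : zmodType) (h : env_alg A -> M -> Z) :=
  [/\ forall w w' m, h (w + w') m = h w m + h w' m,
      forall w m m', h w (m + m') = h w m + h w m'
    & forall w a m, h (w * env_delta a) m = h w (a *: m)].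

(* V, with w (x) m := t w m, is the left A^e-module A^e (x)_A M. *)
Definition is_induced (M : lmodType A) (V : lmodType (env_alg A))
    (t : env_alg A -> M -> V) : Prop :=
  [/\ balanced t,
      forall w w' m, w *: t w' m = t (w * w') m
    & forall (Z : zmodType) (h : env_alg A -> M -> Z), balanced h ->
        exists phi : {additive V -> Z},
          (forall w m, phi (t w m) = h w m) /\
          (forall psi : {additive V -> Z},
             (forall w m, psi (t w m) = h w m) -> psi =1 phi)].

(* The identification of A^e (x)_A k with A: w (x) c |-> w . c *)
Definition triv_tensor (w : env_alg A) (c : triv A) : bimod A :=
  w *: ((c : k)%:A : bimod A).

Definition yterm_tensor (E : nat -> lmodType A) (V : nat -> lmodType (env_alg A))
    (t : forall i, env_alg A -> E i -> V i) (i : nat) :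
    env_alg A -> yterm (triv A : lmodType A) E i ->
    yterm (bimod A : lmodType (env_alg A)) V i :=
  if i is j.+1 then t j else triv_tensor.

(* eta is obtained by applying A^e (x)_A - to xi. *)
Definition induced_yext (p : nat) (xi : yext (triv A) (triv A) p)
    (eta : yext (bimod A : lmodType (env_alg A)) (bimod A) p) : Prop :=
  exists t : forall i, env_alg A -> yE xi i -> yE eta i,
    [/\ forall i, (i <= p)%N -> is_induced (t i),
        forall i, (i <= p)%N -> forall w x,
          yd eta i (t i w x) = yterm_tensor t w (yd xi i x)
      & forall w c, yincl eta (triv_tensor w c) = t p w (yincl xi c)].

End Induction.

(* Hochschild cohomology, on the bar resolution. An element of A^(x)m is     *)
(* presented by lists of length m, so that a linear map out of A^(x)m is a   *)
(* function on lists that is multilinear on those of length m; its values on *)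
(* lists of other lengths are irrelevant.                                    *)

Section Hochschild.
Variables (k : fieldType) (A : falgType k).

Definition multilinear_on (m : nat) (W : zmodType) (scale : k -> W -> W)
    (f : seq A -> W) : Prop :=
  forall (s1 s2 : seq A) (c : k) (a b : A), (size s1 + size s2).+1 = m ->
    f (s1 ++ (c *: a + b) :: s2) = scale c (f (s1 ++ a :: s2)) + f (s1 ++ b :: s2).

Definition merge_at (j : nat) (s : seq A) : seq A :=
  take j s ++ s`_j * s`_j.+1 :: drop j.+2 s.

Definition cochain (m : nat) (f : seq A -> A) : Prop :=
  multilinear_on m (fun c a => c *: a) f.

Definition hoch_d (m : nat) (f : seq A -> A) (s : seq A) : A :=
  s`_0 * f (behead s)
  + \sum_(j < m) (-1) ^+ j.+1 *: f (merge_at j s)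
  + (-1) ^+ m.+1 *: (f (take m s) * s`_m).

(* f is a coboundary of degree m.+1 *)
Definition coboundary (m : nat) (f : seq A -> A) : Prop :=
  exists2 h, cochain m h & forall s, size s = m.+1 -> f s = hoch_d m h s.

Definition circle_at (n i : nat) (f g : seq A -> A) (s : seq A) : A :=
  f (take i s ++ g (take n (drop i s)) :: drop (i + n) s).

Definition circle (m n : nat) (f g : seq A -> A) (s : seq A) : A :=
  \sum_(i < m) (-1) ^+ (i * n.-1) *: circle_at n i f g s.

(* The bracket of cochains f, g of degrees m, n; it has degree m + n - 1. *)
Definition gerstenhaber (m n : nat) (f g : seq A -> A) (s : seq A) : A :=
  circle m n f g s - (-1) ^+ (m.-1 * n.-1) *: circle n m g f s.

(* Phi is a morphism of A^e-modules from A (x) A^(x)i (x) A to V. *)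
Definition bar_hom (i : nat) (V : lmodType (env_alg A)) (Phi : seq A -> V) : Prop :=
  multilinear_on i.+2 (fun c v => c%:A *: v) Phi /\
  forall (a : A) (b : opp_alg A) (b0 b1 : A) (s : seq A), size s = i ->
    pure a b *: Phi (b0 :: rcons s b1) = Phi (a * b0 :: rcons s (b1 * (b : A))).

(* The composite of Phi with the differential of the bar resolution, from
   A (x) A^(x)i.+1 (x) A to A (x) A^(x)i (x) A. *)
Definition bar_d (i : nat) (V : lmodType (env_alg A)) (Phi : seq A -> V)
    (s : seq A) : V :=
  \sum_(j < i.+2) (-1) ^+ j *: Phi (merge_at j s).

(* The class of eta in HH^(p.+1)(A) = Ext^(p.+1)(A, A) is that of the cocycle f:
   f is the end of a chain map Phi from the bar resolution to eta that lifts the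
   identity of A. *)
Definition represents (p : nat)
    (eta : yext (bimod A : lmodType (env_alg A)) (bimod A) p)
    (f : seq A -> A) : Prop :=
  cochain p.+1 f /\
  exists Phi : forall i, seq A -> yE eta i,
    [/\ forall i, (i <= p)%N -> bar_hom i (Phi i),
        forall b0 b1 : A, yd eta 0 (Phi 0 [:: b0; b1]) = (b0 * b1 : A),
        forall i, (i < p)%N -> forall s, size s = i.+3 ->
          yd eta i.+1 (Phi i.+1 s) = bar_d i (Phi i) s
      & forall (b0 b1 : A) s, size s = p.+1 ->
          bar_d p (Phi p) (b0 :: rcons s b1) = yincl eta (b0 * f s * b1 : A)].

End Hochschild.

(* The Hochschild cocycle f represents the image, under the embedding of
   H^(p.+1)(A, k) into HH^(p.+1)(A), of the class of xi. *)
Definition embeds_as (k : fieldType) (A : hopfAlg k) (p : nat)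
    (xi : yext (triv A) (triv A) p) (f : seq A -> A) : Prop :=
  exists2 eta, induced_yext xi eta & represents eta f.

(* Main.v *)
(* The bracket has degree -1 and the cohomology of A lives in even degrees, so it
   vanishes for parity reasons.

   A k-valued cocycle phi is embedded as the Hochschild cocycle
     til phi (a_1, ..., a_m) = sum phi(a_1', ..., a_m') a_1'' ... a_m'',
   because A^e (x)_A - sends the bar resolution of k to the bar resolution of A. The
   bracket of two embedded cocycles is again embedded, by coassociativity. Hence, if
   both degrees have the same parity, the bracket is the image of a class of odd
   degree of H^*(A, k); otherwise one of the two classes has odd degree. It remains
   to see that H^odd(A, k) = 0, and that the bracket of a coboundary with a cocycle is
   a coboundary: the differential is the bracket with the multiplication, and the
   graded Jacobi identity follows from the pre-Lie identity for insertions.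

   For the vanishing, coefficients are taken in the submodules of the dual of A cut
   out by f(g_i b) = f(b) or omega^-1 f(b), and by f(x_i b) = 0 for i >= j. The maps
   induced by x_j and x_j^(n-1) give exact sequences 0 -> M -> I -> I' -> M -> 0, and
   one shifts dimension twice along these. When no condition on the x_i is left,
   the module is injective (contract the bar complex, then average over the g_i), and
   it has no invariants as soon as some g_i acts by omega^-1. *)

(* The data presenting an embedded class are arbitrary: the induced extension is given only by its
   universal property, and the chain map into it from the bar resolution need not come from [A]. So
   the cocycle equals [til phi] only up to a coboundary, obtained from a homotopy built degree by
   degree; this is why the bracket must be shown to respect coboundaries.

   The dimension shift preserves parity for the following reason. As [g_j x_j = omega x_j g_j],
   precomposing with [x_j] multiplies the character of [g_j] by [omega^-1], and precomposing with
   [x_j^(n-1)] multiplies it by [omega], restoring the character. Thus both ends of the exact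
   sequence are the same M, while I' carries a nontrivial character, and its cohomology vanishes in
   every degree, including 0. Hence H^m(M) = 0 as soon as H^m(I) = 0 and H^(m-2)(M) = 0. From an odd
   degree this descends to degree 1, where the vanishing of the invariants of I' suffices, and never
   meets degree 0, where k has invariants. Working inside the dual of A makes every map of the
   sequence a precomposition, with explicit splittings. *)
Require Import Defs.
From HB Require Import structures.
From mathcomp Require Import all_boot all_order all_algebra all_field ring zify.

Set Implicit Arguments.
Unset Strict Implicit.
Unset Printing Implicit Defensive.

Import GRing.Theory.
Local Open Scope ring_scope.

(** * Linear combinations in modules *)

Section ModuleExpr.
Variables (k : fieldType) (W : lmodType k).

(** Reflection: both sides of an identity between linear combinations are reified over a common list
    of atoms, and their coefficients are compared in [k]. *)
Inductive mexpr :=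
  | MAtom of nat | MZero | MAdd of mexpr & mexpr | MOpp of mexpr | MScale of k & mexpr.

Fixpoint meval (env : seq W) e : W :=
  match e with
  | MAtom i => env`_i
  | MZero => 0
  | MAdd e1 e2 => meval env e1 + meval env e2
  | MOpp e1 => - meval env e1
  | MScale c e1 => c *: meval env e1
  end.

Fixpoint mcoef e (i : nat) : k :=
  match e with
  | MAtom j => (i == j)%:R
  | MZero => 0
  | MAdd e1 e2 => mcoef e1 i + mcoef e2 i
  | MOpp e1 => - mcoef e1 i
  | MScale c e1 => c * mcoef e1 i
  end.

Lemma mevalE env e : meval env e = \sum_(i < size env) mcoef e i *: env`_i.
Proof.
elim: e => [j||e1 IH1 e2 IH2|e1 IH1|c e1 IH1] /=.
- case: (ltnP j (size env)) => hj; last first.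
    rewrite nth_default // big1 // => i _.
    by rewrite (ltn_eqF (leq_trans (ltn_ord i) hj)) scale0r.
  rewrite (bigD1 (Ordinal hj)) //= eqxx scale1r big1 ?addr0 // => i ne.
  by rewrite (_ : (i == j :> nat) = false) ?scale0r //; apply: negbTE.
- by rewrite big1 // => i _; rewrite scale0r.
- by rewrite IH1 IH2 -big_split; apply: eq_bigr => i _; rewrite scalerDl.
- by rewrite IH1 -sumrN; apply: eq_bigr => i _; rewrite scaleNr.
- by rewrite IH1 scaler_sumr; apply: eq_bigr => i _; rewrite scalerA.
Qed.

(** An explicit conjunction, so that computation leaves one identity in [k] per atom. *)
Fixpoint mcoef_eq (n : nat) e1 e2 : Prop :=
  if n is m.+1 then mcoef e1 m = mcoef e2 m /\ mcoef_eq m e1 e2 else True.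

Lemma meval_eq env e1 e2 : mcoef_eq (size env) e1 e2 -> meval env e1 = meval env e2.
Proof.
have coefE n i : mcoef_eq n e1 e2 -> (i < n)%N -> mcoef e1 i = mcoef e2 i.
  elim: n => // n IH /= [e h]; rewrite ltnS leq_eqVlt.
  by case/predU1P => [->|]; [exact: e | exact: IH].
by rewrite !mevalE => h; apply: eq_bigr => i _; rewrite (coefE _ _ h).
Qed.

End ModuleExpr.

(* atoms are compared up to conversion, because canonical structures give several
   syntactic forms of one term *)
Ltac msame x y := lazymatch goal with _ => unify x y end.

Ltac mmem x env :=
  lazymatch env with
  | nil => constr:(false)
  | ?y :: ?env' =>
    match constr:(O) with
    | _ => let _ := msame x y in constr:(true)
    | _ => mmem x env'
    end
  end.

Ltac midx x env :=
  lazymatch env with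
  | ?y :: ?env' =>
    match constr:(O) with
    | _ => let _ := msame x y in constr:(O)
    | _ => let i := midx x env' in constr:(S i)
    end
  end.

Ltac matoms W env t :=
  lazymatch t with
  | GRing.add ?a ?b => let e := matoms W env a in matoms W e b
  | GRing.opp ?a => matoms W env a
  | GRing.scale _ ?a => matoms W env a
  | GRing.zero => env
  | ?x => lazymatch mmem x env with true => env | false => constr:(@cons W x env) end
  end.

Ltac mreify k env t :=
  lazymatch t with
  | GRing.add ?a ?b =>
    let e1 := mreify k env a in let e2 := mreify k env b in constr:(@MAdd k e1 e2)
  | GRing.opp ?a => let e := mreify k env a in constr:(@MOpp k e)
  | GRing.scale ?c ?a => let e := mreify k env a in constr:(@MScale k c e)
  | GRing.zero => constr:(@MZero k)
  | ?x => let i := midx x env in constr:(@MAtom k i)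
  end.

Ltac module_over k :=
  lazymatch goal with
  | |- @eq ?W ?l ?r =>
    let env := matoms W (@nil W) l in
    let env := matoms W env r in
    let el := mreify k env l in
    let er := mreify k env r in
    apply: (@meval_eq k _ env el er); rewrite /= /eq_op /=; repeat split
  end.
Ltac module_ring k := module_over k; ring.

(** * Insertion of cochains and the Gerstenhaber bracket *)

Section Insertion.
Variable k : fieldType.

Lemma linear_fun0 (U V : lmodType k) (f : U -> V) : linear f -> f 0 = 0.
Proof. by move=> lf; move: (lf (-1) 0 0); rewrite scaler0 addr0 scaleN1r addNr. Qed.

Lemma linear_funD (U V : lmodType k) (f : U -> V) :
  linear f -> {morph f : x y / x + y}.
Proof. by move=> lf x y; rewrite -[x]scale1r lf !scale1r. Qed.

Lemma linear_funZ (U V : lmodType k) (f : U -> V) c x :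
  linear f -> f (c *: x) = c *: f x.
Proof. by move=> lf; rewrite -[c *: x]addr0 lf linear_fun0 // addr0. Qed.

Lemma linear_funN (U V : lmodType k) (f : U -> V) x : linear f -> f (- x) = - f x.
Proof. by move=> lf; rewrite -scaleN1r linear_funZ // scaleN1r. Qed.

Lemma linear_funB (U V : lmodType k) (f : U -> V) x y :
  linear f -> f (x - y) = f x - f y.
Proof. by move=> lf; rewrite linear_funD // linear_funN. Qed.

Variable A : lmodType k.

Section OneModule.
Variable W : lmodType k.
Implicit Types (F G : seq A -> W) (g : seq A -> A) (s u v : seq A).

Definition mlin F := forall s1 s2 c (a b : A),
  F (s1 ++ (c *: a + b) :: s2) = c *: F (s1 ++ a :: s2) + F (s1 ++ b :: s2).

Lemma mlin_cons F a : mlin F -> mlin (fun u => F (a :: u)).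
Proof. by move=> mF s1 s2 c x y; rewrite -!cat_cons mF. Qed.

Lemma mlin_head F s : mlin F -> linear (fun a => F (a :: s)).
Proof. by move=> mF c x y; exact: (mF [::]). Qed.

Lemma mlinI F : (forall s, linear (fun a => F (a :: s))) ->
  (forall a, mlin (fun u => F (a :: u))) -> mlin F.
Proof. by move=> h t [|a s1] s2 c x y; [exact: h | exact: t]. Qed.

Lemma mlin0 : mlin (fun=> 0). 
Proof. by move=> *; rewrite scaler0 addr0. Qed.

Lemma mlinD F G : mlin F -> mlin G -> mlin (fun s => F s + G s).
Proof. by move=> mF mG s1 s2 c a b; rewrite mF mG scalerDr addrACA. Qed.

Lemma mlinN F : mlin F -> mlin (fun s => - F s).
Proof. by move=> mF s1 s2 c a b; rewrite mF opprD scalerN. Qed.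

Lemma mlinB F G : mlin F -> mlin G -> mlin (fun s => F s - G s).
Proof. by move=> mF mG; apply: mlinD => //; apply: mlinN. Qed.

Lemma mlinZ F c : mlin F -> mlin (fun s => c *: F s).
Proof. by move=> mF s1 s2 d a b; rewrite mF scalerDr !scalerA mulrC. Qed.

(* [\sum_i (-1)^(i * (n+1)) F (take i s ++ g (take n (drop i s)) :: drop (i + n) s)];
   the sign exponent is written n+1 rather than n-1 because n may be 0 *)
Fixpoint ins n g F s : W :=
  (if (n <= size s)%N then F (g (take n s) :: drop n s) else 0) +
  (if s is a :: s' then (-1) ^+ n.+1 *: ins n g (fun u => F (a :: u)) s' else 0).

Lemma ins_cons n g F a s : ins n g F (a :: s) =
  (if (n <= (size s).+1)%N then F (g (take n (a :: s)) :: drop n (a :: s)) else 0)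
  + (-1) ^+ n.+1 *: ins n g (fun u => F (a :: u)) s.
Proof. by []. Qed.

Lemma eq_ins n g g' F F' s :
  (forall u, size u = n -> g u = g' u) ->
  (forall u, (size u + n)%N = (size s).+1 -> F u = F' u) ->
  ins n g F s = ins n g' F' s.
Proof.
move=> eg; elim: s F F' => [|a s IH] F F' eF; rewrite [LHS]/= [RHS]/=; congr (_ + _).
- by case: n eg eF => // eg eF; rewrite eg // eF.
- case: ifP => // hn; rewrite eg ?size_takel // eF //= size_drop /=.
  by rewrite addSn subnK.
by congr (_ *: _); apply: IH => u hu; apply: eF => /=; rewrite addSn hu.
Qed.

Lemma ins_small n g F s : (size s < n)%N -> ins n g F s = 0.
Proof.
elim: s F => [|a s IH] F /= hs; first by rewrite leqNgt hs add0r.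
by rewrite leqNgt hs add0r IH ?scaler0 //; apply: ltnW.
Qed.

Lemma ins_lin n g F F' c s :
  ins n g (fun u => c *: F u + F' u) s = c *: ins n g F s + ins n g F' s.
Proof.
elim: s F F' => [|a s IH] F F' /=; first by case: ifP; rewrite ?addr0 ?scaler0 ?addr0.
rewrite IH !scalerDr !scalerA [_ * c]mulrC addrACA; congr (_ + _).
by case: ifP; rewrite ?addr0 ?scaler0 ?addr0.
Qed.

Lemma ins0 n g s : ins n g (fun=> 0) s = 0.
Proof. by elim: s => [|a s IH] /=; rewrite ?IH ?scaler0 if_same addr0. Qed.

Lemma insD n g F F' s : ins n g (fun u => F u + F' u) s = ins n g F s + ins n g F' s.
Proof.
rewrite -[ins n g F s]scale1r -ins_lin; apply: eq_ins => // u _.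
by rewrite scale1r.
Qed.

Lemma insZ n g F c s : ins n g (fun u => c *: F u) s = c *: ins n g F s.
Proof.
rewrite -[RHS]addr0 -(ins0 n g s) -ins_lin; apply: eq_ins => // u _.
by rewrite addr0.
Qed.

Lemma insN n g F s : ins n g (fun u => - F u) s = - ins n g F s.
Proof.
by rewrite -scaleN1r -insZ; apply: eq_ins => // u _; rewrite scaleN1r.
Qed.

Lemma insB n g F F' s : ins n g (fun u => F u - F' u) s = ins n g F s - ins n g F' s.
Proof. by rewrite insD insN. Qed.

End OneModule.

Lemma ins_map (W W' : lmodType k) (f : W -> W') n g F (s : seq A) : linear f ->
  f (ins n g F s) = ins n g (fun u => f (F u)) s.
Proof.
move=> lf; elim: s F => [|a s IH] F /=.
  by case: ifP => _; rewrite (linear_funD lf) !(linear_fun0 lf).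
by rewrite (linear_funD lf) (linear_funZ _ _ lf) IH; case: ifP; rewrite ?(linear_fun0 lf).
Qed.

Lemma mlin_ins_head (W : lmodType k) n g (F : seq A -> W) : mlin g -> mlin F ->
  mlin (fun s => if (n <= size s)%N then F (g (take n s) :: drop n s) else 0).
Proof.
move=> mg mF s1 s2 c a b; rewrite !size_cat /=.
case: ifP => hn; last by rewrite scaler0 addr0.
rewrite !take_cat !drop_cat; case: ltnP => h1; first by rewrite -!cat_cons mF.
case e: (n - size s1)%N => [|m] /=.
  rewrite !cats0; exact: (mF [:: _]).
rewrite (mg s1); exact: (mlin_head _ mF).
Qed.

Lemma mlin_ins (W : lmodType k) n g (F : seq A -> W) : mlin g -> mlin F ->
  mlin (ins n g F).
Proof.
move=> mg mF s1; elim: s1 F mF => [|d s1 IH] F mF s2 c a b.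
  have /(_ [::] s2 c a b) /= h := mlin_ins_head n mg mF.
  rewrite /= h scalerDr -!addrA; congr (_ + _); rewrite addrCA; congr (_ + _).
  rewrite scalerA [c * _]mulrC -scalerA -scalerDr; congr (_ *: _).
  rewrite -ins_lin; apply: eq_ins => // u _.
  exact: (mlin_head (F := F)).
have /(_ (d :: s1) s2 c a b) /= h := mlin_ins_head n mg mF.
rewrite /= h scalerDr -!addrA; congr (_ + _); rewrite addrCA; congr (_ + _).
rewrite scalerA [c * _]mulrC -scalerA -scalerDr; congr (_ *: _).
by apply: IH; apply: mlin_cons.
Qed.

(** The entries consumed by [f] lie either in the first block, which has [n + p] entries before the
    insertion, or in the rest, where passing [n] entries costs the sign. *)
Lemma ins_split (W : lmodType k) p (f : seq A -> A) n (Th : seq A -> seq A -> W) s :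
  ins p.+1 f (fun u => if (n <= size u)%N then Th (take n u) (drop n u) else 0) s =
  (if (n + p <= size s)%N
   then ins p.+1 f (fun u => Th u (drop (n + p) s)) (take (n + p) s) else 0) +
  (if (n <= size s)%N
   then ((-1) ^+ p.+2) ^+ n *: ins p.+1 f (Th (take n s)) (drop n s) else 0).
Proof.
elim: n s Th => [|n IH] s Th.
  rewrite add0n expr0 scale1r take0 drop0 [X in if _ then X else _]ins_small; last first.
    by rewrite size_take_min ltnS geq_minl.
  by rewrite if_same add0r; apply: eq_ins => // u _; rewrite take0 drop0.
case: s => [|a s]; first by rewrite /= ?addr0.
rewrite ins_cons {1}ltnS (eq_ins (g' := f) (F' := fun u =>
    if (n <= size u)%N then Th (a :: take n u) (drop n u) else 0)) //.
rewrite (IH s (fun u v => Th (a :: u) v)) /= !ltnS scalerDr.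
rewrite !addrA; congr (_ + _); last first.
  by case: ifP => _; rewrite ?scaler0 // scalerA -exprS.
rewrite size_drop -/(take n _) -/(drop n _).
rewrite take_drop.
case: (leqP (n + p) (size s)) => h; last first.
  rewrite scaler0 addr0; case: leqP => // h1; case: ifP => // h2.
  by exfalso; lia.
have hp : (p <= size s)%N by lia.
have hn : (n <= size s - p)%N by lia.
rewrite hp hn size_takel // leq_addl; congr (_ + _).
by rewrite drop_drop take_takel // leq_addl.
Qed.

End Insertion.

(** * The graded pre-Lie identity for insertions *)

Section PreLie.
Variables (k : fieldType) (A : lmodType k).
Section OneModule.
Variable W : lmodType k.
Implicit Types (F : seq A -> W) (f g : seq A -> A) (s u v : seq A).

Lemma sign_addn2 (i : nat) : (-1) ^+ i.+2 = (-1) ^+ i :> k.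
Proof. by rewrite !exprS mulrA mulrNN !mul1r. Qed.

Lemma sign_odd_eq (i j : nat) : odd i = odd j -> (-1) ^+ i = (-1) ^+ j :> k.
Proof. by move=> e; rewrite -signr_odd e signr_odd. Qed.

(* The first summand nests f inside g; in the second the insertions are disjoint,
   and these terms cancel from the graded commutator in [prelie_pos]. *)
Lemma ins_ins_cons p q f g F a s : mlin F ->
  ins p.+1 f (ins q.+1 g F) (a :: s) =
  (if (p + q <= size s)%N
   then F (ins p.+1 f g (take (p + q).+1 (a :: s)) :: drop (p + q).+1 (a :: s)) else 0)
  + ((if (p <= size s)%N then
       (-1) ^+ q *: ins q.+1 g (fun u => F (f (take p.+1 (a :: s)) :: u)) (drop p s)
     else 0) +
     (if (q <= size s)%N then
       (-1) ^+ (p * q + p) *: ins p.+1 f (fun u => F (g (take q.+1 (a :: s)) :: u)) (drop q s)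
     else 0))
  + (-1) ^+ (p + q) *: ins p.+1 f (ins q.+1 g (fun u => F (a :: u))) s.
Proof.
move=> mF.
rewrite ins_cons ltnS /= !sign_addn2.
set X := take p s; set Y := drop p s.
(* Under the outer insertion, the head [a] is either passed over by [g] or starts the block that [g]
   consumes. *)
rewrite [X in _ + _ *: X = _](eq_ins (g' := f) (F' := fun u =>
   (-1) ^+ q *: ins q.+1 g (fun v => F (a :: v)) u
   + if (q <= size u)%N then F (g (a :: take q u) :: drop q u) else 0)) //; last first.
  by move=> u _; rewrite ltnS addrC.
rewrite ins_lin (ins_split p f q (fun u v => F (g (a :: u) :: v))) !sign_addn2.
rewrite -exprM.
set Y1 := ins q.+1 g _ Y; set Y2 := ins p.+1 f _ (drop q s).
have -> : (if (p <= size s)%N then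
    (if (q < (size Y).+1)%N then F (g (f (a :: X) :: take q Y) :: drop q Y) else 0)
     + (-1) ^+ q *: Y1 else 0) =
   (if (p + q <= size s)%N then F (g (f (a :: X) :: take q Y) :: drop q Y) else 0) +
   (if (p <= size s)%N then (-1) ^+ q *: Y1 else 0).
  rewrite ltnS size_drop; case: leqP => h; last by rewrite ifF ?addr0 //; lia.
  by congr (_ + _); congr (if _ then _ else _); lia.
have -> : (if (p + q <= size s)%N then F (
    ((if (p < (size (take (p + q) s)).+1)%N then
        g (f (a :: take p (take (p + q) s)) :: drop p (take (p + q) s)) else 0) +
       (-1) ^+ p *: ins p.+1 f (fun u => g (a :: u)) (take (p + q) s))
     :: drop (p + q) s) else 0) =
  (if (p + q <= size s)%N then F (g (f (a :: X) :: take q Y) :: drop q Y) else 0) +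
  (-1) ^+ p *: (if (q + p <= size s)%N then
     ins p.+1 f (fun u => F (g (a :: u) :: drop (q + p) s)) (take (q + p) s) else 0).
  rewrite [(q + p)%N]addnC; case: (leqP (p + q) (size s)) => h; last first.
    by rewrite scaler0 addr0.
  rewrite ltnS size_takel // leq_addr take_takel ?leq_addr //.
  rewrite take_drop [(q + p)%N]addnC addrC (mlin_head (drop (p + q) s) mF).
  by rewrite addrC (ins_map _ _ _ _ (mlin_head (drop (p + q) s) mF)) drop_drop [(q + p)%N]addnC.
have -> : (if (q <= size s)%N
   then (-1) ^+ (p * q) *: Y2 else 0) = (-1) ^+ p *: (if (q <= size s)%N
   then (-1) ^+ (p * q + p) *: Y2 else 0).
  case: ifP => _; last by rewrite scaler0.
  rewrite scalerA -exprD; congr (_ *: _); apply: sign_odd_eq.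
  by rewrite !oddD; case: odd; case: odd.
rewrite [(-1) ^+ (p + q)]exprD.
have e : (-1) ^+ p * (-1) ^+ p = 1 :> k by rewrite -exprMn mulrNN mul1r expr1n.
set T1 := (if (q <= size s)%N then _ else _).
have {2}-> : T1 = ((-1) ^+ p * (-1) ^+ p) *: T1 by rewrite e scale1r.
module_ring k.
Qed.

Lemma prelie_pos p q f g F s : mlin F ->
  ins p.+1 f (ins q.+1 g F) s - (-1) ^+ (p * q) *: ins q.+1 g (ins p.+1 f F) s =
  ins (p + q).+1 (fun u => ins p.+1 f g u - (-1) ^+ (p * q) *: ins q.+1 g f u) F s.
Proof.
elim: s F => [|a s IH] F mF; first by rewrite !ins_small // scaler0 subr0.
rewrite !ins_ins_cons // ins_cons ltnS -IH; last exact: mlin_cons.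
rewrite [(q + p)%N]addnC [(q * p)%N]mulnC sign_addn2.
set T1 := (if (p <= size s)%N then _ else 0).
set T2 := (if (q <= size s)%N then _ else 0).
set T3 := (if (q <= size s)%N then _ else 0).
set T4 := (if (p <= size s)%N then _ else 0).
have sq (i : nat) : (-1) ^+ i * (-1) ^+ i = 1 :> k.
  by rewrite -exprMn mulrNN mul1r expr1n.
have -> : T2 = (-1) ^+ (p * q) *: T3.
  rewrite /T2 /T3; case: ifP => _; last by rewrite scaler0.
  by rewrite scalerA -exprD.
have -> : T4 = (-1) ^+ (p * q) *: T1.
  rewrite /T4 /T1; case: ifP => _; last by rewrite scaler0.
  by rewrite scalerA -exprD.
case: leqP => h; last first.
  have {1}-> : T1 = ((-1) ^+ (p * q) * (-1) ^+ (p * q)) *: T1 by rewrite sq scale1r.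
  module_ring k.
set e := (-1) ^+ (p * q).
rewrite (linear_funB _ _ (mlin_head _ mF)) (linear_funZ _ _ (mlin_head _ mF)).
have {1}-> : T1 = (e * e) *: T1 by rewrite sq scale1r.
module_ring k.
Qed.

Lemma ins0_cons g F a s :
  ins 0 g F (a :: s) = F (g [::] :: a :: s) - ins 0 g (fun u => F (a :: u)) s.
Proof. by rewrite /= expr1 scaleN1r. Qed.

Lemma ins0_split g n (Th : seq A -> seq A -> W) s :
  ins 0 g (fun u => if (n <= size u)%N then Th (take n u) (drop n u) else 0) s =
  (if n is n'.+1 then
     if (n' <= size s)%N then ins 0 g (fun u => Th u (drop n' s)) (take n' s) else 0
   else 0) +
  (if (n <= size s)%N then (-1) ^+ n *: ins 0 g (Th (take n s)) (drop n s) else 0).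
Proof.
elim: n s Th => [|n IH] s Th.
  by rewrite add0r expr0 scale1r take0 drop0; apply: eq_ins => // u _; rewrite take0 drop0.
case: s => [|a s]; first by case: n {IH} => [|n] /=; rewrite !addr0.
rewrite ins0_cons /=.
rewrite (eq_ins (g' := g) (F' := fun u =>
    if (n <= size u)%N then Th (a :: take n u) (drop n u) else 0)) //.
rewrite (IH s (fun u v => Th (a :: u) v)) !ltnS opprD addrA; congr (_ + _); last first.
  by case: ifP => _; rewrite ?oppr0 // exprS mulN1r scaleNr.
case: n {IH} => [|n]; first by rewrite take0 drop0 /= subr0 addr0.
by rewrite ltnS /=; case: ifP; rewrite ?subr0 // expr1 scaleN1r.
Qed.

(** Nothing can be inserted into [g] when it has degree 0, so only one nested term survives; its
    degree [p] may itself be 0. *)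
Lemma prelie_0 p f g F s : mlin F ->
  ins 0 g (ins p.+1 f F) s - (-1) ^+ p *: ins p.+1 f (ins 0 g F) s =
  ins p (ins 0 g f) F s.
Proof.
elim: s F => [|a s IH] F mF.
  rewrite [X in _ - _ *: X]ins_small // scaler0 subr0 /=.
  by case: p => [|p] /=; rewrite ?(addr0, scaler0).
rewrite ins0_cons (ins_cons p (ins 0 g f)) (ins_cons p.+1 f) -IH; last exact: mlin_cons.
rewrite !sign_addn2 !ltnS.
rewrite (eq_ins (n := 0) (g' := g) (s := s) (F' := fun u =>
   (-1) ^+ p *: ins p.+1 f (fun v => F (a :: v)) u
   + if (p <= size u)%N then F (f (a :: take p u) :: drop p u) else 0)) //; last first.
  by move=> u _; rewrite ins_cons sign_addn2 ltnS addrC.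
rewrite ins_lin (ins0_split g p (fun u v => F (f (a :: u) :: v))).
rewrite [ins p.+1 f (ins 0 g F) (a :: s)]ins_cons.
rewrite (ins_cons p.+1 f (fun u => F (g [::] :: u))) !sign_addn2.
rewrite [ins p.+1 f (fun u => ins 0 g F (a :: u)) s](eq_ins (g' := f) (F' := fun u =>
  F [:: g [::], a & u] - ins 0 g (fun v => F (a :: v)) u)) //; last first.
  by move=> u _; rewrite ins0_cons.
rewrite insB ins0_cons !ltnS exprS mulN1r.
set c := g [::]; set v := drop p.+1 (a :: s).
set b := f (take p.+1 (a :: s)).
rewrite -/(drop p.+1 (a :: s)) -/(take p.+1 (a :: s)) -/v -/b.
set V := ins 0 g (fun _ => F (b :: _)) v.
set H1 := (if (p <= size (a :: s))%N then _ else 0).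
set H2 := (if (p <= (size s).+1)%N then _ else 0).
set I1 := (match p with 0 => 0 | _ => _ end).
have -> : H1 = H2 + I1.
  rewrite /H1 /H2 /I1 /=; case: p {IH v b V H1 H2 I1} => [|p].
    by rewrite /= !(scaler0, addr0).
  rewrite ltnS; case: ifP => h; last by rewrite ?addr0.
  rewrite /= expr1 scaleN1r (linear_funB _ _ (mlin_head _ mF)).
  by rewrite (ins_map _ _ _ _ (mlin_head (drop p s) mF)) subrK.
set e := (-1) ^+ p.
case: (leqP p (size s)) => h.
  set I2 := ins p.+1 f _ s.
  set I3 := ins p.+1 f _ s.
  set I4 := ins 0 g _ s.
  module_ring k.
module_ring k.
Qed.

End OneModule.
End PreLie.

Section Bracket.
Variables (k : fieldType) (A : lmodType k).
Implicit Types (F G f g : seq A -> A) (s u v : seq A).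

(* the usual sign (-1)^((m-1)(n-1)), without truncated subtraction *)
Definition brsgn (m n : nat) : k := (-1) ^+ (m.+1 * n.+1).

Definition brk m n F G s := ins n G F s - brsgn m n *: ins m F G s.

Lemma brsgnC m n : brsgn m n = brsgn n m.
Proof. by rewrite /brsgn mulnC. Qed.

Lemma sign_sq (i : nat) : (-1) ^+ i * (-1) ^+ i = 1 :> k.
Proof. by rewrite -exprMn mulrNN mul1r expr1n. Qed.

Lemma brkC m n F G s : brk m n F G s = - (brsgn m n *: brk n m G F s).
Proof.
rewrite /brk [brsgn n m]brsgnC scalerBr scalerA sign_sq scale1r.
by rewrite opprB.
Qed.

Lemma mlin_brk m n F G : mlin F -> mlin G -> mlin (brk m n F G).
Proof. by move=> mF mG; apply: mlinB; [|apply: mlinZ]; apply: mlin_ins. Qed.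

Lemma insZg (W : lmodType k) n c g (F : seq A -> W) s : mlin F ->
  ins n (fun u => c *: g u) F s = c *: ins n g F s.
Proof.
elim: s F => [|a s IH] F mF /=.
  by case: ifP; rewrite ?(linear_funZ _ _ (mlin_head _ mF)) !addr0 ?scaler0.
rewrite IH; last exact: mlin_cons.
rewrite scalerDr !scalerA [_ * c]mulrC; congr (_ + _).
by case: ifP; rewrite ?(linear_funZ _ _ (mlin_head _ mF)) ?scaler0.
Qed.

Lemma prelie (W : lmodType k) m n f g (F : seq A -> W) s : (0 < m + n)%N -> mlin F ->
  ins n g (ins m f F) s - brsgn m n *: ins m f (ins n g F) s =
  ins (m + n).-1 (brk m n f g) F s.
Proof.
move=> mn mF.
case: m mn => [|p] mn; case: n mn => [|q] // _.
- have <- : ins q (fun u => - brsgn 0 q.+1 *: ins 0 f g u) F s =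
            ins q (brk 0 q.+1 f g) F s.
    by apply: eq_ins => // u hu; rewrite /brk [ins q.+1 _ _ _]ins_small ?hu // sub0r scaleNr.
  rewrite insZg // -prelie_0 // scalerBr !scaleNr opprK.
  have -> : brsgn 0 q.+1 = (-1) ^+ q by rewrite /brsgn mul1n sign_addn2.
  by rewrite scalerA sign_sq scale1r addrC.
- have <- : ins p (ins 0 g f) F s = ins (p.+1 + 0).-1 (brk p.+1 0 f g) F s.
    rewrite addn0; apply: eq_ins => // u hu.
    by rewrite /brk [ins p.+1 _ _ _]ins_small ?hu // scaler0 subr0.
  by rewrite -prelie_0 // /brsgn muln1 sign_addn2.
have := prelie_pos q p g f s mF.
rewrite addSn addnS /= [(q + p)%N]addnC [(q * p)%N]mulnC.
have -> : brsgn p.+1 q.+1 = (-1) ^+ (p * q).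
  by rewrite /brsgn; apply: sign_odd_eq; rewrite !oddM /= !negbK.
move=> ->; apply: eq_ins => // u _.
by rewrite /brk /brsgn; congr (_ - _ *: _); apply: sign_odd_eq; rewrite !oddM /= !negbK.
Qed.

End Bracket.

Section Derivation.
Variables (k : fieldType) (A : falgType k).
Implicit Types (F G f g : seq A -> A) (s u v : seq A).

Definition mu s : A := if s is [:: a; b] then a * b else 0.

Lemma mlin_mu : mlin mu.
Proof.
apply: mlinI => [[|b [|c s]]|a] /=.
- by move=> c x y; rewrite scaler0 addr0.
- by move=> c x y; rewrite mulrDl scalerAl.
- by move=> d x y; rewrite scaler0 addr0.
apply: mlinI => [[|b s]|b] /=.
- by move=> c x y; rewrite mulrDr scalerAr.
- by move=> d x y; rewrite scaler0 addr0.
by apply: mlinI => [s|c] /=; [move=> d x y; rewrite scaler0 addr0 | exact: mlin0].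
Qed.

Lemma brk_mu_jacobi m n F G s : (0 < n)%N -> mlin F -> mlin G ->
  brk (m + n).-1 2 (brk m n F G) mu s =
  brk m n.+1 F (brk n 2 G mu) s + (-1) ^+ n.+1 *: brk m.+1 n (brk m 2 F mu) G s.
Proof.
move=> n0 mF mG; have mM := mlin_mu.
have e1 : brsgn k (m + n).-1 2 = (-1) ^+ m.+1 * (-1) ^+ n.+1.
  rewrite /brsgn -exprD; apply: sign_odd_eq; rewrite oddM andbT.
  by case: n n0 => // n _; rewrite addnS /= !oddD /= negbK; case: odd; case: odd.
have e2 m' : brsgn k m' 2 = (-1) ^+ m'.+1.
  by rewrite /brsgn; apply: sign_odd_eq; rewrite oddM andbT.
have e3 : brsgn k m n.+1 = brsgn k m n * (-1) ^+ m.+1.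
  by rewrite /brsgn -exprD; apply: sign_odd_eq; rewrite mulnS addnC.
have e4 : brsgn k m.+1 n = brsgn k m n * (-1) ^+ n.+1.
  by rewrite /brsgn -exprD; apply: sign_odd_eq; rewrite mulSn addnC.
(* One pre-Lie identity for each choice of the outermost cochain; the six double insertions [X1] to
   [X6] that remain then cancel linearly. *)
have H1 := @prelie _ _ _ n 2 G mu F s _ mF.
have H2 := @prelie _ _ _ m 2 F mu G s _ mG.
have H3 := @prelie _ _ _ m n F G mu s _ mM.
rewrite !addn2 /= in H1 H2.
rewrite {1}/brk insB insZ -H3; last by rewrite addn_gt0 n0 orbT.
rewrite {1}/brk -H1 // [ins m F (brk n 2 G mu) s]insB insZ.
rewrite {1}/brk -H2 // [ins n G (brk m 2 F mu) s]insB insZ.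
rewrite e1 e3 e4 !e2.
set em := (-1) ^+ m.+1; set en := (-1) ^+ n.+1.
have sq : en * en = 1 by apply: sign_sq.
set e := brsgn k m n.
set X1 := ins 2 mu (ins n G F) s; set X2 := ins 2 mu (ins m F G) s.
set X3 := ins n G (ins m F mu) s; set X4 := ins m F (ins n G mu) s.
set X5 := ins n G (ins 2 mu F) s; set X6 := ins m F (ins 2 mu G) s.
have -> Y : en *: (X5 - em *: X3 - (e * en) *: Y) = en *: X5 - (en * em) *: X3 - e *: Y.
  by rewrite !scalerBr !scalerA [en * (e * en)]mulrCA sq mulr1.
module_ring k.
Qed.

End Derivation.

(** * The Hochschild complex with coefficients *)

Section BilinTheory.
Variables (k : fieldType) (U V W : lmodType k) (b : U -> V -> W).
Hypothesis bb : bilin b.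
Lemma bilin_linl v : linear (b^~ v). Proof. exact: bb.1. Qed.
Lemma bilin_linr u : linear (b u). Proof. exact: bb.2. Qed.

Lemma bilinDr u v v' : b u (v + v') = b u v + b u v'.
Proof. exact: (linear_funD (bilin_linr u)). Qed.

Lemma bilinBr u v v' : b u (v - v') = b u v - b u v'.
Proof. exact: (linear_funB _ _ (bilin_linr u)). Qed.

Lemma bilin0r u : b u 0 = 0.
Proof. exact: (linear_fun0 (bilin_linr u)). Qed.

End BilinTheory.

Section Complex.
Variables (k : fieldType) (A : falgType k).

(** Bimodules with explicit actions, so that one differential serves [A] itself, modules over the
    enveloping algebra, and left modules on which [A] acts from the right through [heps]. *)
Record biaction (V : lmodType k) := Biaction {
  lact : A -> V -> V;
  ract : A -> V -> V;
  lact_bilin : bilin lact;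
  ract_bilin : bilin ract;
  lactM : forall a b v, lact (a * b) v = lact a (lact b v);
  ractM : forall a b v, ract (a * b) v = ract b (ract a v);
  lact_ract : forall a b v, lact a (ract b v) = ract b (lact a v)
}.

Section OneModule.
Variables (V : lmodType k) (X : biaction V).
Implicit Types (F G : seq A -> V) (s u : seq A).

Definition lterm F s := if s is a :: s' then lact X a (F s') else 0.
Definition rterm F s :=
  if s is a :: s' then ract X (last a s') (F (belast a s')) else 0.
(* For [size s = m.+1] the sign is that of [hoch_d m]. *)
Definition del F s := lterm F s - ins 2 (@mu _ A) F s + (-1) ^+ size s *: rterm F s.

Lemma eq_del F G s : (forall u, (size u).+1 = size s -> F u = G u) ->
  del F s = del G s.
Proof.
case: s => [|a s] e.
  by congr (_ - _ + _).
rewrite /del /lterm /rterm (e s) // (e (belast a s)) ?size_belast //.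
by congr (_ - _ + _); apply: eq_ins => // u; rewrite /= addn2 => -[] h; apply: e; rewrite /= h.
Qed.

Lemma del_nil F : del F [::] = 0.
Proof. by rewrite /del ins_small // subr0 scaler0 addr0. Qed.

Lemma del_lin F G c s : del (fun u => c *: F u + G u) s = c *: del F s + del G s.
Proof.
rewrite /del ins_lin; case: s => [|a s].
  rewrite /lterm /rterm. module_ring k.
rewrite /lterm /rterm (bilin_linr (lact_bilin X)) (bilin_linr (ract_bilin X)).
module_ring k.
Qed.

Lemma delZ F c s : del (fun u => c *: F u) s = c *: del F s.
Proof.
rewrite /del insZ; case: s => [|a s].
  rewrite /lterm /rterm. module_ring k.
rewrite /lterm /rterm (linear_funZ _ _ (bilin_linr (lact_bilin X) _)).
rewrite (linear_funZ _ _ (bilin_linr (ract_bilin X) _)).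
module_ring k.
Qed.

Lemma delD F G s : del (fun u => F u + G u) s = del F s + del G s.
Proof.
by rewrite -[del F s]scale1r -del_lin; apply: eq_del => u _; rewrite scale1r.
Qed.

Lemma delN F s : del (fun u => - F u) s = - del F s.
Proof. by rewrite -scaleN1r -delZ; apply: eq_del => u _; rewrite scaleN1r. Qed.

Lemma delB F G s : del (fun u => F u - G u) s = del F s - del G s.
Proof. by rewrite delD delN. Qed.

Lemma del0 s : del (fun=> 0) s = 0.
Proof.
rewrite -[RHS](scale0r (del (fun=> 0) s)) -delZ.
by apply: eq_del => u _; rewrite scaler0.
Qed.

Lemma mlin_lterm F : mlin F -> mlin (lterm F).
Proof.
move=> mF; apply: mlinI => [s|a] /=; first exact: (bilin_linl (lact_bilin X)).
by move=> s1 s2 c x y; rewrite mF (bilin_linr (lact_bilin X)).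
Qed.

Lemma lterm_cons F a s : lterm F (a :: s) = lact X a (F s).
Proof. by []. Qed.

Lemma rterm_cons F a s : rterm F (a :: s) = ract X (last a s) (F (belast a s)).
Proof. by []. Qed.

Lemma rterm_rcons F s a : rterm F (rcons s a) = ract X a (F s).
Proof. by case: s => [|b s] //=; rewrite last_rcons belast_rcons. Qed.

Lemma mlin_rterm F : mlin F -> mlin (rterm F).
Proof.
move=> mF s1 s2 c x y; elim/last_ind: s2 => [|s2 z _].
  by rewrite !cats1 !rterm_rcons (bilin_linl (ract_bilin X)).
by rewrite -!rcons_cons -!rcons_cat !rterm_rcons mF (bilin_linr (ract_bilin X)).
Qed.

Lemma mlin_del F : mlin F -> mlin (del F).
Proof.
move=> mF s1 s2 c x y; rewrite /del mlin_lterm // mlin_rterm //.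
rewrite (mlin_ins _ (@mlin_mu _ A) mF) !size_cat /=.
module_ring k.
Qed.

Lemma ins_mu_cons2 (W : lmodType k) (F : seq A -> W) a b s :
  ins 2 (@mu _ A) F [:: a, b & s] =
  F (a * b :: s) - ins 2 (@mu _ A) (fun u => F (a :: u)) (b :: s).
Proof. by rewrite ins_cons sign_addn2 expr1 scaleN1r /= take0 drop0. Qed.

Lemma ins_mu1 (W : lmodType k) (F : seq A -> W) a : ins 2 (@mu _ A) F [:: a] = 0.
Proof. by rewrite ins_small. Qed.

(** The bar differential squares to zero: in the inductive step the two products of the first three
    entries cancel by associativity. *)
Lemma ins_mu_mu (W : lmodType k) (F : seq A -> W) s :
  ins 2 (@mu _ A) (ins 2 (@mu _ A) F) s = 0.
Proof.
elim: s F => [|a [|b [|c s]] IH] F; try by rewrite ins_small.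
  rewrite ins_mu_cons2 ins_mu1 sub0r ins_mu1 oppr0 //.
rewrite ins_mu_cons2 (ins_mu_cons2 F (a * b)).
rewrite [X in _ - X](eq_ins (g' := @mu _ A) (F' := fun u =>
  (if u is d :: u' then F (a * d :: u') else 0) - ins 2 (@mu _ A) (fun v => F (a :: v)) u)) //;
  last first.
  move=> [|d u] h; first by move: h => /=; lia.
  by rewrite ins_mu_cons2.
rewrite insB IH subr0 ins_mu_cons2 mulrA.
by rewrite subrr.
Qed.

Lemma lterm_ins F s : 
  lterm (lterm F) s = lterm (ins 2 (@mu _ A) F) s + ins 2 (@mu _ A) (lterm F) s.
Proof.
case: s => [|a [|b s]]; first by rewrite ins_small // addr0.
  by rewrite !lterm_cons !ins_small // addr0 (bilin0r (lact_bilin X)).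
rewrite ins_mu_cons2 !lterm_cons -lactM addrCA.
rewrite (ins_map _ _ _ _ (bilin_linr (lact_bilin X) a)).
by rewrite subrr addr0.
Qed.

Lemma lterm_rterm F s : lterm (rterm F) s = rterm (lterm F) s.
Proof.
case: s => [|a [|b s]] //=; first by rewrite (bilin0r (lact_bilin X)) (bilin0r (ract_bilin X)).
exact: lact_ract.
Qed.

(** Merging the last two entries is the one term missing under [rterm]; the right action of their
    product is the double right action. *)
Lemma rterm_ins F s : ins 2 (@mu _ A) (rterm F) s =
  rterm (ins 2 (@mu _ A) F) s + (-1) ^+ size s *: rterm (rterm F) s.
Proof.
elim: s F => [|a [|b [|c s]] IH] F.
- by rewrite ins_small //= scaler0 addr0.
- by rewrite ins_small //= !addr0 !(bilin0r (ract_bilin X)) scaler0 addr0.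
- rewrite ins_mu_cons2 ins_mu1 subr0 /= !addr0 ?scaler0 ?addr0 (bilin0r (ract_bilin X)) add0r.
  by rewrite sign_addn2 expr0 scale1r ractM.
rewrite ins_mu_cons2.
rewrite (eq_ins (g' := @mu _ A) (F' := rterm (fun u => F (a :: u)))) //; last first.
  by case=> [|d u] //=; rewrite addn2.
rewrite IH !rterm_cons [last _ _]/= [belast a _]/= [belast (a * b) _]/= [belast b _]/=.
rewrite ins_mu_cons2 (bilinBr (ract_bilin X)) opprD addrA; congr (_ - _ + _).
by rewrite [size _]/= [in RHS]exprS mulN1r scaleNr.
Qed.

Lemma del_del F s : del (del F) s = 0.
Proof.
have [N e] : exists N, N = size s by exists (size s).
(* The sign in [del] depends on the length, but the outer [del] evaluates the inner one only on
   lists of length [N.-1]; there the sign can be frozen, which makes the inner expression a linear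
   combination. *)
pose D' u := (lterm F u - ins 2 (@mu _ A) F u) + (-1) ^+ N.-1 *: rterm F u.
have -> : del (del F) s = del D' s.
  by apply: eq_del => u hu; rewrite /D' e -hu.
case: s e => [|a s] e; first by rewrite /del /= !addr0 ?scaler0 ?addr0 subrr.
have l1 : lterm D' (a :: s) = lterm (lterm F) (a :: s) -
   lterm (ins 2 (@mu _ A) F) (a :: s) + (-1) ^+ N.-1 *: lterm (rterm F) (a :: s).
  rewrite /= (bilinDr (lact_bilin X)) (bilinBr (lact_bilin X)).
  by rewrite (linear_funZ _ _ (bilin_linr (lact_bilin X) _)).
have l2 : rterm D' (a :: s) = rterm (lterm F) (a :: s) -
   rterm (ins 2 (@mu _ A) F) (a :: s) + (-1) ^+ N.-1 *: rterm (rterm F) (a :: s).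
  rewrite /= (bilinDr (ract_bilin X)) (bilinBr (ract_bilin X)).
  by rewrite (linear_funZ _ _ (bilin_linr (ract_bilin X) _)).
have l3 : ins 2 (@mu _ A) D' (a :: s) = ins 2 (@mu _ A) (lterm F) (a :: s) -
   ins 2 (@mu _ A) (ins 2 (@mu _ A) F) (a :: s) +
   (-1) ^+ N.-1 *: ins 2 (@mu _ A) (rterm F) (a :: s).
  by rewrite insD insB insZ.
rewrite /del l1 l2 l3 lterm_ins lterm_rterm ins_mu_mu rterm_ins -e.
rewrite e [(size _).-1]/= [size (a :: s)]/= exprS mulN1r.
set z := (-1) ^+ size s.
set t1 := lterm _ _; set t2 := ins _ _ _ _; set t3 := rterm _ _; set t4 := rterm _ _.
set t5 := rterm _ _.
module_ring k.
Qed.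

End OneModule.

Lemma del_map (V V' : lmodType k) (X : biaction V) (X' : biaction V') (f : V -> V') F s :
  linear f -> (forall a v, f (lact X a v) = lact X' a (f v)) ->
  (forall a v, f (ract X a v) = ract X' a (f v)) ->
  f (del X F s) = del X' (fun u => f (F u)) s.
Proof.
move=> lf fl fr; rewrite /del (linear_funD lf) (linear_funB _ _ lf) (linear_funZ _ _ lf).
rewrite (ins_map _ _ _ _ lf); congr (_ - _ + _ *: _); case: s => [|a s] /=.
- exact: linear_fun0.
- exact: fl.
- exact: linear_fun0.
exact: fr.
Qed.

Fact mul_bilin : bilin (fun a b : A => a * b).
Proof. by split=> [b c a a'|a c b b']; rewrite (mulrDl, mulrDr) -(scalerAl, scalerAr). Qed.
Fact rmul_bilin : bilin (fun a b : A => b * a).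
Proof. by split=> [b c a a'|a c b b']; rewrite (mulrDl, mulrDr) -(scalerAl, scalerAr). Qed.

Definition regular : biaction A :=
  Biaction mul_bilin rmul_bilin (fun a b c => esym (mulrA a b c))
    (fun a b c => mulrA c a b) (fun a b c => mulrA a c b).

Lemma ins_full (W : lmodType k) n g (F : seq A -> W) s :
  size s = n -> ins n g F s = F [:: g s].
Proof.
move=> <-; case: s => [|a s]; first by rewrite /= addr0.
by rewrite ins_cons leqnn take_size drop_size ins_small // scaler0 addr0.
Qed.

Lemma ins_mu_r m (F : seq A -> A) s : size s = m.+1 ->
  ins m F (@mu _ A) s = (-1) ^+ m.+1 *: lterm regular F s + rterm regular F s.
Proof.
case: s => [|a s] // [hs]; rewrite ins_cons ins_full // hs leqnSn addrC; congr (_ + _).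
rewrite rterm_cons /=; case/lastP: s hs => [<- //|s b]; rewrite size_rcons => <-.
rewrite last_rcons belast_rcons -rcons_cons -cats1.
by rewrite take_size_cat // drop_size_cat.
Qed.

Lemma del_regular m (F : seq A -> A) s : size s = m.+1 ->
  del regular F s = - brk m 2 F (@mu _ A) s.
Proof.
move=> hs; rewrite /brk ins_mu_r // /del hs.
have -> : brsgn k m 2 = (-1) ^+ m.+1.
  by rewrite /brsgn; apply: sign_odd_eq; rewrite oddM andbT.
by rewrite scalerDr scalerA sign_sq scale1r opprB addrAC.
Qed.

(* The bracket is a derivation because the differential is the bracket with [mu]. *)
Lemma del_brk m n (F G : seq A -> A) s : (0 < n)%N -> mlin F -> mlin G ->
  size s = (m + n)%N ->
  del regular (brk m n F G) s =
  brk m n.+1 F (del regular G) s + (-1) ^+ n.+1 *: brk m.+1 n (del regular F) G s.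
Proof.
move=> n0 mF mG hs.
have hs' : size s = (m + n).-1.+1 by rewrite hs prednK // addn_gt0 n0 orbT.
rewrite (del_regular _ hs') brk_mu_jacobi // opprD -scalerN; congr (_ + _ *: _).
  have : forall u, size u = n.+1 -> del regular G u = -1 *: brk n 2 G (@mu _ A) u.
    by move=> u hu; rewrite (del_regular _ hu) scaleN1r.
  move: (del regular G) (brk n 2 G _) => dG H eH; rewrite /brk.
  rewrite (eq_ins (F' := F) (g' := fun u => -1 *: H u) eH) // insZg //.
  rewrite (@eq_ins _ _ _ _ F F dG (fun u => -1 *: H u)) //.
    by rewrite insZ; module_ring k.
  move=> u; rewrite hs -addnS addnC => /addnI; exact: eH.
have : forall u, size u = m.+1 -> del regular F u = -1 *: brk m 2 F (@mu _ A) u.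
  by move=> u hu; rewrite (del_regular _ hu) scaleN1r.
move: (del regular F) (brk m 2 F _) => dF H eH; rewrite /brk.
rewrite (eq_ins (F' := G) (g' := fun u => -1 *: H u) eH) // insZg //.
rewrite (@eq_ins _ _ _ _ G G dF (fun u => -1 *: H u)) //.
  by rewrite insZ; module_ring k.
move=> u; rewrite hs -addSn => /addIn; exact: eH.
Qed.

End Complex.

(** * Lifting along surjections and restriction of scalars *)

Section Lifting.
Variables (k : fieldType) (A : vectType k).

(** This plays the part of projectivity of the bar resolution: [A] is finite-dimensional, so
    preimages are chosen on lists of basis vectors and extended multilinearly. *)
Lemma mlin_lift (V W : lmodType k) (d : V -> W) m (F : seq A -> W) :
  linear d -> mlin F -> (forall s, size s = m -> exists v, d v = F s) ->
  exists2 G : seq A -> V, mlin G & forall s, size s = m -> d (G s) = F s.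
Proof.
move=> ld; elim: m F => [|m IH] F mF lift.
  have [//|v hv] := lift [::].
  exists (fun s => if s is [::] then v else 0) => [|[|//]] //.
  by apply: mlinI => [s c a b|a]; [rewrite scaler0 addr0 | exact: mlin0].
have /fin_all_exists2[G mG dG] (i : 'I_(\dim {:A})) :
    exists2 G : seq A -> V, mlin G & forall s, size s = m -> d (G s) = F (basvec i :: s).
  by apply: IH => [|s hs]; [exact: mlin_cons | apply: lift; rewrite /= hs].
exists (fun s => if s is a :: s' then \sum_i coord (vbasis {:A}) i a *: G i s' else 0).
  apply: mlinI => [s c a b|a s1 s2 c x y].
    rewrite scaler_sumr -big_split; apply: eq_bigr => i _.
    by rewrite linearP scalerDl scalerA.
  rewrite scaler_sumr -big_split; apply: eq_bigr => i _.
  by rewrite mG scalerDr !scalerA mulrC.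
case=> // a s [hs].
pose ldm := GRing.isLinear.Build k _ _ _ d ld.
pose dl : {linear _ -> _} := HB.pack d ldm.
have lF := mlin_head s mF.
pose lFm := GRing.isLinear.Build k _ _ _ (fun x => F (x :: s)) lF.
pose Fl : {linear _ -> _} := HB.pack (fun x => F (x :: s)) lFm.
rewrite -[d]/(dl : _ -> _) -[RHS]/(Fl a) [in RHS](basvecE a) !linear_sum.
by apply: eq_bigr => i _; rewrite !linearZ; congr (_ *: _); exact: dG.
Qed.

End Lifting.

Section Truncation.
Variables (k : fieldType) (A : falgType k).

Definition trunc (V : lmodType k) m (F : seq A -> V) s := if size s == m then F s else 0.

Lemma mlin_trunc (V : lmodType k) m (F : seq A -> V) :
  multilinear_on m (fun c v => c *: v) F -> mlin (trunc m F).
Proof.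
move=> mF s1 s2 c a b; rewrite /trunc !size_cat /=.
case: eqP => h; last by rewrite scaler0 addr0.
by apply: mF; rewrite -h addnS.
Qed.

Lemma truncE (V : lmodType k) m (F : seq A -> V) s : size s = m -> trunc m F s = F s.
Proof. by move=> <-; rewrite /trunc eqxx. Qed.

End Truncation.

Section ScalarRestriction.
Variables (k : fieldType) (B : algType k) (V : lmodType B).

Definition kmod : Type := V.
HB.instance Definition _ := GRing.Zmodule.copy kmod V.

Definition kmod_scale (c : k) (v : kmod) : kmod := c%:A *: (v : V).

Fact kmod_scaleA c d v : kmod_scale c (kmod_scale d v) = kmod_scale (c * d) v.
Proof. by rewrite /kmod_scale scalerA -scalerAl mul1r scalerA. Qed.
Fact kmod_scale1 : left_id 1 kmod_scale.
Proof. by move=> v; rewrite /kmod_scale scale1r; apply: scale1r. Qed.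
Fact kmod_scaleDr : right_distributive kmod_scale +%R.
Proof. by move=> c u v; apply: scalerDr. Qed.
Fact kmod_scaleDl (v : kmod) : {morph kmod_scale^~ v : c d / c + d}.
Proof. by move=> c d; rewrite /kmod_scale scalerDl [LHS]scalerDl. Qed.

HB.instance Definition _ := GRing.Zmodule_isLmodule.Build k kmod
  kmod_scaleA kmod_scale1 kmod_scaleDr kmod_scaleDl.

Lemma kmodZ c (v : kmod) : c *: v = (c%:A : B) *: (v : V) :> V.
Proof. by []. Qed.

Lemma act_kmod_bilin : bilin (fun (b : B) (v : kmod) => (b *: (v : V) : kmod)).
Proof.
split=> [v c b b'|b c v v'].
  by rewrite -mulr_algl [LHS]scalerDl -[X in X + _]scalerA.
rewrite [LHS]scalerDr !kmodZ !scalerA; congr (_ + _).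
by rewrite mulr_algr mulr_algl.
Qed.

End ScalarRestriction.

Lemma kmod_linear (k : fieldType) (B : algType k) (V V' : lmodType B) (f : {linear V -> V'}) :
  linear (f : kmod V -> kmod V').
Proof. by move=> c u v; rewrite [LHS]linearP. Qed.

Section LeftAction.
Variables (k : fieldType) (A : hopfAlg k) (V : lmodType A).

Fact triv_ract_bilin : bilin (fun (a : A) (v : kmod V) => (heps a : k) *: v).
Proof.
split=> [v c a b|a c u v] /=; first by rewrite linearP scalerDl scalerA.
by rewrite scalerDr !scalerA mulrC.
Qed.

Fact left_actM (a b : A) (v : kmod V) :
  ((a * b) *: (v : V) : kmod V) = a *: (b *: (v : V)).
Proof. by rewrite scalerA. Qed.

Fact triv_ractM (a b : A) (v : kmod V) :
  (heps (a * b) : k) *: v = (heps b : k) *: ((heps a : k) *: v).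
Proof. by rewrite rmorphM scalerA mulrC. Qed.

Fact left_act_triv (a b : A) (v : kmod V) :
  (a *: (((heps b : k) *: v : kmod V) : V) : kmod V) =
  (heps b : k) *: ((a *: (v : V)) : kmod V).
Proof. by rewrite (linear_funZ _ _ (bilin_linr (@act_kmod_bilin k A V) a)). Qed.

(** With this right action, [del] is the differential obtained by mapping the bar resolution of k
    into [V], so it computes Ext over [A] from k to [V]. *)
Definition left_action : biaction A (kmod V) :=
  Biaction (@act_kmod_bilin k A V) triv_ract_bilin left_actM triv_ractM left_act_triv.

End LeftAction.

Section EnvAction.
Variables (k : fieldType) (A : falgType k) (V : lmodType (env_alg A)).
Local Notation B := (env_alg A).

Definition env_lact (a : A) (v : kmod V) : kmod V := (pure a 1 : B) *: (v : V).
Definition env_ract (a : A) (v : kmod V) : kmod V :=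
  (pure (1 : A) (a : opp_alg A) : B) *: (v : V).

Fact env_lact_bilin : bilin env_lact.
Proof.
have bb := @act_kmod_bilin k B V.
split=> [v c a b|a]; last exact: (bilin_linr bb).
by rewrite /env_lact pureLl (bilin_linl bb).
Qed.

Fact env_ract_bilin : bilin env_ract.
Proof.
have bb := @act_kmod_bilin k B V.
split=> [v c a b|a]; last exact: (bilin_linr bb).
by rewrite /env_ract pureLr (bilin_linl bb).
Qed.

Fact env_lactM a b v : env_lact (a * b) v = env_lact a (env_lact b v).
Proof. by rewrite /env_lact scalerA [pure a 1 * _]tmul_pure mul1r. Qed.

Fact env_ractM a b v : env_ract (a * b) v = env_ract b (env_ract a v).
Proof. by rewrite /env_ract scalerA [pure 1 (b : opp_alg A) * _]tmul_pure mul1r. Qed.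

Fact env_lact_ract a b v : env_lact a (env_ract b v) = env_ract b (env_lact a v).
Proof.
rewrite /env_lact /env_ract !scalerA.
by rewrite [pure a 1 * _]tmul_pure [pure 1 (b : opp_alg A) * _]tmul_pure !mulr1 !mul1r.
Qed.

Definition env_action : biaction A (kmod V) :=
  Biaction env_lact_bilin env_ract_bilin env_lactM env_ractM env_lact_ract.

End EnvAction.

(** * From cochains of the trivial module to Hochschild cochains *)

Section Smash.
Variables (k : fieldType) (A : hopfAlg k).

Lemma tlift_deltaM (W : lmodType k) (G : A -> A -> W) a b : bilin G ->
  tlift G (hdelta (a * b)) =
  tlift (fun a1 a2 => tlift (fun b1 b2 => G (a1 * b1) (a2 * b2)) (hdelta b)) (hdelta a).
Proof.
move=> bG; rewrite rmorphM -[hdelta a * hdelta b]/(tmul _ _) /tmul.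
rewrite (@tlift_comp _ _ _ _ _ (tlift G)); last exact: linearP.
apply: eq_tlift => a1 a2; rewrite (@tlift_comp _ _ _ _ _ (tlift G)); last exact: linearP.
by apply: eq_tlift => b1 b2; rewrite tliftE.
Qed.

(* [tilr T b F [a_1 ... a_m]] is [\sum T (b a_1'' ... a_m'') (F [a_1' ... a_m'])]
   where the coproduct of [a_i] is [\sum a_i' (x) a_i'']. *)
Fixpoint tilr (M W : lmodType k) (T : A -> M -> W) (b : A) (F : seq A -> M) s : W :=
  if s is a :: s' then
    tlift (fun a1 a2 => tilr T (b * a2) (fun u => F (a1 :: u)) s') (hdelta a)
  else T b (F [::]).

Section General.
Variables (M W : lmodType k).
Implicit Types (T : A -> M -> W) (F : seq A -> M).

Lemma tilr_cons T b F a s : tilr T b F (a :: s) =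
  tlift (fun a1 a2 => tilr T (b * a2) (fun u => F (a1 :: u)) s) (hdelta a).
Proof. by []. Qed.

Lemma eq_tilr T T' b F F' s : T =2 T' -> (forall u, size u = size s -> F u = F' u) ->
  tilr T b F s = tilr T' b F' s.
Proof.
move=> eT; elim: s b F F' => [|a s IH] b F F' eF /=; first by rewrite eF // eT.
by apply: eq_tlift => a1 a2; apply: IH => u hu; apply: eF; rewrite /= hu.
Qed.

Lemma tilr_linb T F s : bilin T -> linear (fun b => tilr T b F s).
Proof.
move=> bT; elim: s F => [|a s IH] F c b b' /=; first exact: bilin_linl.
by apply: tlift_lin => a1 a2; rewrite mulrDl -scalerAl IH.
Qed.

Lemma tilr_linF T b F F' c s : bilin T ->
  tilr T b (fun u => c *: F u + F' u) s = c *: tilr T b F s + tilr T b F' s.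
Proof.
move=> bT; elim: s b F F' => [|a s IH] b F F' /=; first exact: bilin_linr.
by apply: tlift_lin => a1 a2; rewrite IH.
Qed.

Lemma tilr_linT T T1 T2 b F c s : (forall x m, T x m = c *: T1 x m + T2 x m) ->
  tilr T b F s = c *: tilr T1 b F s + tilr T2 b F s.
Proof.
move=> eT; elim: s b F => [|a s IH] b F /=; first exact: eT.
by apply: tlift_lin => a1 a2; rewrite IH.
Qed.

Lemma tilr0 T b s : bilin T -> tilr T b (fun=> 0) s = 0.
Proof.
move=> bT; transitivity (-1 *: tilr T b (fun=> 0) s + tilr T b (fun=> 0) s).
  by rewrite -tilr_linF //; apply: eq_tilr => // u _; rewrite scaler0 addr0.
by rewrite scaleN1r addNr.
Qed.

Lemma tilrZ T b F c s : bilin T -> tilr T b (fun u => c *: F u) s = c *: tilr T b F s.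
Proof.
move=> bT; rewrite -[RHS]addr0 -(tilr0 b s bT) -tilr_linF //.
by apply: eq_tilr => // u _; rewrite addr0.
Qed.

Lemma tilrD T b F F' s : bilin T ->
  tilr T b (fun u => F u + F' u) s = tilr T b F s + tilr T b F' s.
Proof.
move=> bT; rewrite -[tilr T b F s]scale1r -tilr_linF //.
by apply: eq_tilr => // u _; rewrite scale1r.
Qed.

Lemma tilrB T b F F' s : bilin T ->
  tilr T b (fun u => F u - F' u) s = tilr T b F s - tilr T b F' s.
Proof.
move=> bT; rewrite tilrD // -scaleN1r -tilrZ //; congr (_ + _).
by apply: eq_tilr => // u _; rewrite scaleN1r.
Qed.

Lemma tlift0 (U V : vectType k) (X : tensor U V) : tlift (fun _ _ => 0 : W) X = 0.
Proof. by rewrite /tlift big1 // => i _; rewrite big1 // => j _; rewrite scaler0. Qed.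

Lemma ins_tlift (U V : vectType k) n g (G : U -> V -> seq A -> W) (X : tensor U V) s :
  ins n g (fun u => tlift (fun x y => G x y u) X) s =
  tlift (fun x y => ins n g (G x y) s) X.
Proof.
elim: s G => [|a s IH] G /=.
  by case: ifP => _; rewrite addr0 ?tlift0 //; apply: eq_tlift => x y; rewrite addr0.
rewrite IH addrC; symmetry; rewrite -[X in _ = _ + X]/(if _ then _ else _).
have -> : (if (n <= (size s).+1)%N then
    tlift (fun x y => G x y (g (take n (a :: s)) :: drop n (a :: s))) X else 0) =
  tlift (fun x y => if (n <= (size s).+1)%N then
    G x y (g (take n (a :: s)) :: drop n (a :: s)) else 0) X.
  by case: ifP; rewrite ?tlift0.
by apply: tlift_lin => x y; rewrite addrC.
Qed.

Lemma tilr_tlift (U V : vectType k) T b (G : U -> V -> seq A -> M) (X : tensor U V) s :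
  bilin T -> tilr T b (fun u => tlift (fun x y => G x y u) X) s =
  tlift (fun x y => tilr T b (G x y) s) X.
Proof.
move=> bT; elim: s b G => [|a s IH] b G /=.
  by rewrite (@tlift_comp _ _ _ _ _ (T b)) //; apply: bilin_linr.
rewrite tlift_swap; apply: eq_tlift => a1 a2; exact: IH.
Qed.

Lemma tilr_bilin T b F s : bilin T -> mlin F ->
  bilin (fun a1 a2 => tilr T (b * a2) (fun u => F (a1 :: u)) s).
Proof.
move=> bT mF; split=> [a2 c x y|a1 c x y].
  rewrite -tilr_linF //; apply: eq_tilr => // u _; exact: (mlin_head u mF).
by rewrite mulrDr -scalerAr tilr_linb.
Qed.

Lemma mlin_tilr T b F : bilin T -> mlin F -> mlin (tilr T b F).
Proof.
move=> bT mF s1; elim: s1 b F mF => [|d s1 IH] b F mF s2 c x y /=.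
  by rewrite !linearP.
by apply: tlift_lin => a1 a2; apply: IH; apply: mlin_cons.
Qed.

(** Multiplicativity of [hdelta]: the product of the second components does not change when two
    neighbours are merged. *)
Lemma ins_mu_tilr T b F s : bilin T -> mlin F ->
  ins 2 (@mu _ A) (tilr T b F) s = tilr T b (ins 2 (@mu _ A) F) s.
Proof.
move=> bT; elim: s b F => [|a [|c s] IH] b F mF.
- by rewrite ins_small //= addr0 (bilin0r bT).
- rewrite ins_small //=.
  rewrite (eq_tlift (b' := fun _ _ => 0)) => [|a1 a2]; last first.
    by rewrite addr0 scaler0 addr0 (bilin0r bT).
  by rewrite tlift0.
rewrite ins_mu_cons2.
have -> : ins 2 (@mu _ A) (fun u => tilr T b F (a :: u)) (c :: s) =
  tlift (fun a1 a2 => tilr T (b * a2) (ins 2 (@mu _ A) (fun u => F (a1 :: u))) (c :: s)) (hdelta a).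
  rewrite ins_tlift; apply: eq_tlift => a1 a2; apply: IH; exact: mlin_cons.
have -> : tilr T b F (a * c :: s) = tlift (fun a1 a2 =>
    tilr T (b * a2) (fun u => if u is c1 :: u' then F (a1 * c1 :: u') else 0) (c :: s)) (hdelta a).
  rewrite -[LHS]/(tlift _ _) tlift_deltaM; last exact: tilr_bilin.
  by apply: eq_tlift => a1 a2 /=; apply: eq_tlift => c1 c2; rewrite mulrA.
rewrite addrC -scaleN1r [RHS]tilr_cons; symmetry; apply: tlift_lin => a1 a2.
rewrite scaleN1r addrC -tilrB //; apply: eq_tilr => // -[|c1 u] // _.
by rewrite ins_mu_cons2.
Qed.

End General.

Lemma tilr_map (M W W' : lmodType k) (T : A -> M -> W) (f : W -> W') b F s : linear f ->
  f (tilr T b F s) = tilr (fun x m => f (T x m)) b F s.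
Proof.
move=> lf; elim: s b F => [|a s IH] b F //=.
by rewrite (@tlift_comp _ _ _ _ _ f) //; apply: eq_tlift => a1 a2.
Qed.

Lemma tilr_comp (M M' W : lmodType k) (T : A -> M -> W) (d : M' -> M) b F s :
  tilr T b (fun u => d (F u)) s = tilr (fun x m => T x (d m)) b F s.
Proof.
by elim: s b F => [|a s IH] b F //=; apply: eq_tlift => a1 a2.
Qed.

(** The right action applies [heps] to the first component of [x], and the counit axiom leaves [x]
    itself in the product of second components. *)
Lemma tilr_rterm (M W : lmodType k) (X : biaction A M) (T : A -> M -> W) b F s x :
  (forall a m, ract X a m = (heps a : k) *: m) -> bilin T ->
  tilr T b (rterm X F) (rcons s x) = tilr (fun y m => T (y * x) m) b F s.
Proof.
move=> eX bT; elim: s b F => [|a s IH] b F /=.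
  rewrite -[in RHS](hcounitl x).
  rewrite (@tlift_comp _ _ _ _ _ (fun z => T (b * z) (F [::]))); last first.
    by move=> c y z; rewrite mulrDr -scalerAr (bilin_linl bT).
  apply: eq_tlift => x1 x2; rewrite eX -scalerAr (linear_funZ _ _ (bilin_linr bT _)).
  by rewrite (linear_funZ _ _ (bilin_linl bT _)).
apply: eq_tlift => a1 a2; rewrite -IH; apply: eq_tilr => // -[|y u]; rewrite size_rcons //.
Qed.

(** [T c b m] stands for the element [(c (x) b) (x) m] of the induced module; the last hypothesis is
    its balancing relation over [env_delta]. *)
Lemma tilr_act (M : lmodType A) (W : lmodType k) (T : A -> A -> kmod M -> W) :
  (forall x, bilin (T x)) -> (forall y m, linear (fun x => T x y m)) ->
  (forall b (a : A) (m : M), T 1 b (a *: m : M) =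
     tlift (fun c1 c2 => T c1 (hantipode c2 * b) m) (hdelta a)) ->
  forall b a F s, tilr (T 1) b (fun u => (a *: (F u : M) : M) : kmod M) s =
    tlift (fun c1 c2 => tilr (T c1) (hantipode c2 * b) F s) (hdelta a).
Proof.
move=> bT lT bal b a F s; elim: s b F => [|e s IH] b F /=; first exact: bal.
rewrite tlift_swap; apply: eq_tlift => e1 e2; rewrite IH.
by apply: eq_tlift => c1 c2; rewrite mulrA.
Qed.

Lemma tilr_lterm (M : lmodType A) (W : lmodType k) (T : A -> A -> kmod M -> W) :
  (forall x, bilin (T x)) -> (forall y m, linear (fun x => T x y m)) ->
  (forall b (a : A) (m : M), T 1 b (a *: m : M) =
     tlift (fun c1 c2 => T c1 (hantipode c2 * b) m) (hdelta a)) ->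
  forall a F s, tilr (T 1) 1 (lterm (left_action M) F) (a :: s) = tilr (T a) 1 F s.
Proof.
move=> bT lT bal a F s /=.
transitivity (tlift (fun a1 a2 => tlift (fun c1 c2 =>
    tilr (T c1) (hantipode c2 * a2) F s) (hdelta a1)) (hdelta a)).
  by apply: eq_tlift => a1 a2; rewrite mul1r tilr_act.
have lTl y z : linear (fun x => tilr (T x) (hantipode y * z) F s).
  by move=> c x x'; apply: tilr_linT => *; apply: lT.
rewrite (hcoassocT (t := fun c1 c2 a2 => tilr (T c1) (hantipode c2 * a2) F s)) //.
- rewrite -[in RHS](hcounitr a) (@tlift_comp _ _ _ _ _ (fun z => tilr (T z) 1 F s)); last first.
    by move=> c x x'; apply: tilr_linT => *; apply: lT.
  apply: eq_tlift => c1 c'.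
  rewrite -(@tlift_comp _ _ _ _ _ (fun z => tilr (T c1) z F s)); last exact: tilr_linb.
  rewrite hantipodel (linear_funZ _ _ (tilr_linb F s (bT c1))).
  rewrite (linear_funZ (f := fun z => tilr (T z) 1 F s)) // => c x x'.
  by apply: tilr_linT => *; apply: lT.
- by move=> x z c y y'; rewrite linearP mulrDl -scalerAl tilr_linb.
by move=> x y c z z'; rewrite mulrDr -scalerAr tilr_linb.
Qed.

End Smash.

Section Induced.
Variables (k : fieldType) (A : hopfAlg k).

Lemma hantipode1 : hantipode 1 = 1 :> A.
Proof.
have := hantipodel (1 : A); rewrite !rmorph1 (_ : 1 = pure 1 1) // tliftE.
  by rewrite mulr1 scale1r.
split=> [v c a a'|u c a a']; first by rewrite linearP mulrDl -scalerAl.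
by rewrite mulrDr -scalerAr.
Qed.

Lemma env_delta_linear : linear (@env_delta k A).
Proof. by move=> c a b; rewrite /env_delta !linearP. Qed.

Lemma env_delta1 : env_delta (1 : A) = 1.
Proof.
rewrite /env_delta rmorph1 (_ : 1 = pure 1 1) // tliftE.
  by rewrite hantipode1.
split=> [v c a a'|u c a a']; first exact: pureLl.
by rewrite linearP pureLr.
Qed.

Section Balanced.
Variables (M : lmodType A) (V : lmodType (env_alg A)) (t : env_alg A -> M -> V).
Hypotheses (bt : balanced t) (ct : forall w w' m, w *: t w' m = t (w * w') m).

Definition bal_fun (c b : A) (m : kmod M) : kmod V := t (pure c (b : opp_alg A)) m.

Lemma bal_lin1 m : linear (fun w : env_alg A => (t w m : kmod V)).
Proof.
case: bt => tD _ _ c w w'; rewrite tD; congr (_ + _).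
by rewrite -[c *: (t w m : kmod V)]/((c%:A : env_alg A) *: (t w m : V)) ct mulr_algl.
Qed.

Lemma bal_lin2 w : linear (fun m : kmod M => (t w m : kmod V)).
Proof.
case: bt => tDl tD tb c m m'; rewrite tD; congr (_ + _).
rewrite -[c *: m]/((c%:A : A) *: (m : M)) -tb.
rewrite (linear_funZ _ _ env_delta_linear) env_delta1.
rewrite -scalerAr mulr1.
exact: (linear_funZ _ _ (bal_lin1 m)).
Qed.

Lemma bal_fun_bilin c : bilin (bal_fun c).
Proof.
split=> [m d b b'|b]; last exact: bal_lin2.
by rewrite /bal_fun pureLr bal_lin1.
Qed.

Lemma bal_fun_lin b m : linear (fun c => bal_fun c b m).
Proof. by move=> d c c'; rewrite /bal_fun pureLl bal_lin1. Qed.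

Lemma bal_fun_act b (a : A) (m : M) : bal_fun 1 b (a *: m : M) =
  tlift (fun c1 c2 => bal_fun c1 (hantipode c2 * b) m) (hdelta a).
Proof.
case: (bt) => _ _ tb; rewrite /bal_fun -tb.
rewrite -(@tlift_comp _ _ _ _ _ (fun w : env_alg A => (t w m : kmod V))); last exact: bal_lin1.
congr (t _ m); rewrite /env_delta.
rewrite (@tlift_comp _ _ _ _ _ (fun w : env_alg A => pure 1 (b : opp_alg A) * w)).
  by apply: eq_tlift => c1 c2; rewrite [_ * _]tmul_pure mul1r.
by move=> c x y; rewrite mulrDr -scalerAr.
Qed.

(** Each part of the differential uses one Hopf axiom: the antipode for the left action,
    multiplicativity of the coproduct for the inner products, the counit for the right action. *)
Lemma del_tilr (F : seq A -> kmod M) s : mlin F ->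
  del (env_action V) (tilr (bal_fun 1) 1 F) s =
  tilr (bal_fun 1) 1 (del (left_action M) F) s.
Proof.
move=> mF; have bT := bal_fun_bilin.
case: s => [|a s].
  by rewrite del_nil /tilr del_nil (bilin0r (bT 1)).
have -> : tilr (bal_fun 1) 1 (del (left_action M) F) (a :: s) =
   tilr (bal_fun 1) 1 (lterm (left_action M) F) (a :: s) -
   tilr (bal_fun 1) 1 (ins 2 (@mu _ A) F) (a :: s) +
   (-1) ^+ (size s).+1 *: tilr (bal_fun 1) 1 (rterm (left_action M) F) (a :: s).
  rewrite -tilrB // -tilrZ // -tilrD //; apply: eq_tilr => // u hu.
  by rewrite /del hu.
rewrite /del ins_mu_tilr //; congr (_ - _ + _ *: _).
  rewrite (tilr_lterm bT bal_fun_lin bal_fun_act) lterm_cons.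
  rewrite (@tilr_map _ _ _ _ _ _ (lact (env_action V) a)); last exact: (bilin_linr (lact_bilin _)).
  apply: eq_tilr => [b m|]; last by [].
  by rewrite /= /env_lact /bal_fun ct [pure a 1 * _]tmul_pure mulr1 mul1r.
case/lastP: s => [|s x].
  rewrite -[[:: a]]/(rcons [::] a) rterm_rcons tilr_rterm //.
  by rewrite /= /env_ract /bal_fun ct [pure 1 (a : opp_alg A) * _]tmul_pure mul1r.
rewrite -rcons_cons rterm_rcons tilr_rterm //.
rewrite (@tilr_map _ _ _ _ _ _ (ract (env_action V) x)); last exact: (bilin_linr (ract_bilin _)).
apply: eq_tilr => [b m|]; last by [].
by rewrite /= /env_ract /bal_fun ct [pure 1 (x : opp_alg A) * _]tmul_pure mul1r.
Qed.

End Balanced.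
End Induced.

(** * Comparison with Yoneda extensions *)

Section Bar.
Variables (k : fieldType) (A : falgType k).

Lemma ins_mu_sum (W : lmodType k) m (F : seq A -> W) s : size s = m.+1 ->
  \sum_(j < m) (-1) ^+ j *: F (merge_at j s) = ins 2 (@mu _ A) F s.
Proof.
elim: m s F => [|m IH] [|a [|b s]] // F hs; first by rewrite big_ord0 ins_small.
rewrite big_ord_recl expr0 scale1r ins_mu_cons2.
rewrite -(IH (b :: s) (fun u => F (a :: u))); last by case: hs => <-.
congr (_ + _); first by rewrite /merge_at /= drop0.
by rewrite -sumrN; apply: eq_bigr => j _; rewrite exprS mulN1r scaleNr.
Qed.

Lemma ins_mu_rcons (W : lmodType k) (F : seq A -> W) s a b :
  ins 2 (@mu _ A) F (rcons (rcons s a) b) =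
  ins 2 (@mu _ A) (fun u => F (rcons u b)) (rcons s a) +
  (-1) ^+ size s *: F (rcons s (a * b)).
Proof.
elim: s F => [|c s IH] F.
  rewrite -[rcons (rcons [::] a) b]/[:: a; b] -[rcons [::] a]/[:: a] ins_mu_cons2.
  by rewrite !ins_mu1 subr0 add0r expr0 scale1r.
have := IH (fun u => F (c :: u)); rewrite !rcons_cons [size _]/=.
case e: (rcons s a) => [|d t]; first by move: (size_rcons s a); rewrite e.
rewrite !rcons_cons !ins_mu_cons2 => ->.
by rewrite opprD addrA exprS mulN1r scaleNr.
Qed.

Variable V : lmodType (env_alg A).

(** A bimodule map on the bar resolution is determined by its values on [1 (x) s (x) 1]. *)
Definition inner (i : nat) (Phi : seq A -> V) : seq A -> kmod V :=
  trunc i (fun s => Phi (1 :: rcons s 1) : kmod V).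

Lemma mlin_inner i Phi : bar_hom i Phi -> mlin (inner i Phi).
Proof.
case=> mP _; apply: mlin_trunc => s1 s2 c a b hs.
rewrite !rcons_cat !rcons_cons -!cat_cons mP //.
by rewrite /= size_rcons -hs addSn addnS.
Qed.

Lemma bar_d_ins i Phi s : size s = i.+3 ->
  bar_d i Phi s = ins 2 (@mu _ A) (Phi : seq A -> kmod V) s.
Proof.
move=> hs; rewrite -(ins_mu_sum _ hs); apply: eq_bigr => j _.
rewrite kmodZ; congr (_ *: _).
by rewrite -in_algE rmorphXn rmorphN1.
Qed.

(** The two merges with the outer units produce the left and right action terms of [del]. *)
Lemma bar_d_inner i Phi s : bar_hom i Phi -> size s = i.+1 ->
  bar_d i Phi (1 :: rcons s 1) = del (env_action V) (inner i Phi) s.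
Proof.
move=> [mP eP] hs; rewrite bar_d_ins; last by rewrite /= size_rcons hs.
case/lastP: s hs => // s b; rewrite size_rcons => -[hs].
rewrite /del rterm_rcons size_rcons.
have -> : ract (env_action V) b (inner i Phi s) = Phi (1 :: rcons s b).
  by rewrite /= /env_ract /inner truncE // eP // mul1r mul1r.
have -> : ins 2 (@mu _ A) (inner i Phi) (rcons s b) =
    ins 2 (@mu _ A) (fun u => Phi (1 :: rcons u 1) : kmod V) (rcons s b).
  by apply: eq_ins => // u; rewrite size_rcons hs addn2 => -[hu]; rewrite /inner truncE.
have e : ins 2 (@mu _ A) (fun u => Phi (1 :: u) : kmod V) (rcons (rcons s b) 1) =
   ins 2 (@mu _ A) (fun u => Phi (1 :: rcons u 1) : kmod V) (rcons s b) +
   (-1) ^+ size s *: (Phi (1 :: rcons s b) : kmod V).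
  by rewrite (ins_mu_rcons (fun u => Phi (1 :: u) : kmod V)) mulr1.
rewrite exprS mulN1r scaleNr -addrA -opprD -e.
case: s hs {e} => [|a s] hs; rewrite !rcons_cons ins_mu_cons2; congr (_ - _).
  by rewrite lterm_cons /= /env_lact /inner truncE // (eP _ _ _ _ [::]) // !mulr1 mul1r.
rewrite lterm_cons /= /env_lact /inner truncE ?size_rcons // eP ?size_rcons //.
by rewrite !mulr1 mul1r.
Qed.

End Bar.

Section Trivial.
Variables (k : fieldType) (A : hopfAlg k).

Lemma trivZ (a : A) (c : triv A) : a *: c = (heps a : k) * (c : k) :> k.
Proof. by []. Qed.

Lemma heps_scalar (c : k) : heps (c%:A : A) = c :> k.
Proof. by rewrite linearZ /= rmorph1; apply: mulr1. Qed.

Lemma triv_tensorE (b : A) (c : triv A) :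
  triv_tensor (pure 1 (b : opp_alg A)) c = ((c : k) *: b : A).
Proof. by rewrite /triv_tensor [LHS]bimod_scale_pure mul1r -scalerAl mul1r. Qed.

End Trivial.

Section Comparison.
Variables (k : fieldType) (A : hopfAlg k) (p : nat).
Variables (xi : yext (triv A) (triv A) p)
  (eta : yext (bimod A : lmodType (env_alg A)) (bimod A) p).
Variable t : forall i, env_alg A -> yE xi i -> yE eta i.
Hypotheses (t_ind : forall i, (i <= p)%N -> is_induced (@t i))
  (t_yd : forall i, (i <= p)%N -> forall w x,
     yd eta i (t w x) = yterm_tensor (@t) w (yd xi i x))
  (t_incl : forall w c, yincl eta (triv_tensor w c) = t w (yincl xi c)).
Variable Phi : forall i, seq A -> yE eta i.
Hypotheses (Phi_hom : forall i, (i <= p)%N -> bar_hom i (Phi i))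
  (Phi0 : forall b0 b1 : A, yd eta 0 (Phi 0 [:: b0; b1]) = (b0 * b1 : A))
  (Phi_d : forall i, (i < p)%N -> forall s, size s = i.+3 ->
     yd eta i.+1 (Phi i.+1 s) = bar_d i (Phi i) s).

Local Notation ldel i := (del (left_action (yE xi i))).
Local Notation edel i := (del (env_action (yE eta i))).

Definition ind_tilr i (F : seq A -> kmod (yE xi i)) : seq A -> kmod (yE eta i) :=
  tilr (bal_fun (@t i) 1) 1 F.

(* Each chain map into [eta] is, up to homotopy, induced by one into [xi]; the
   boundary of the homotopy is [X]. *)
Definition compared i := exists Psi : seq A -> kmod (yE xi i),
  [/\ mlin Psi,
      forall s, size s = i.+1 -> yd xi i (ldel i Psi s) = 0 &
      exists X : seq A -> kmod (yE eta i),
      [/\ mlin X,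
          forall s, size s = i.+1 -> edel i X s = 0 &
          forall s, size s = i ->
            yd eta i (inner i (Phi i) s - ind_tilr Psi s - X s) = 0]].

Lemma compared0 : compared 0.
Proof.
have [e he] := yd_surj xi (1 : k).
exists (fun s => if s is [::] then e else 0); split.
- by apply: mlinI => [s c a b|a]; [rewrite scaler0 addr0 | exact: mlin0].
- case=> [|a [|//]] // _; rewrite /del ins_small // subr0.
  rewrite /= linearD linearZ /= expr1 scaleN1r linearN /= he.
  rewrite linearZ /= he; apply/eqP; rewrite subr_eq0; apply/eqP.
  by rewrite [LHS]trivZ [RHS]trivZ heps_scalar.
exists (fun=> 0); split; first exact: mlin0.
  by move=> s _; rewrite del0.
case=> // _; rewrite subr0 linearB /=.
rewrite /inner /trunc /= Phi0 /ind_tilr /= /bal_fun t_yd // he [yterm_tensor _ _ _]triv_tensorE.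
by rewrite scale1r mulr1 subrr.
Qed.

Lemma comparedS i : (i < p)%N -> compared i -> compared i.+1.
Proof.
move=> ip [Psi [mPsi dPsi [X [mX dX cmp]]]].
have [bi ci _] := t_ind (ltnW ip); have [bj cj _] := t_ind ip.
have lift_xi s : size s = i.+1 -> exists v, yd xi i.+1 v = ldel i Psi s.
  by move=> /dPsi /(yd_exact ip).
have [Psi' mPsi' dPsi'] :=
  mlin_lift (@kmod_linear _ _ _ _ (yd xi i.+1)) (mlin_del (left_action _) mPsi) lift_xi.
(* [cmp] says that [D] is killed by the differential of [eta], so it lifts to the next term; the
   lift [H] is the next component of the homotopy. *)
pose D s := inner i (Phi i) s - ind_tilr Psi s - X s.
have mD : mlin D.
  apply: mlinB => //; apply: mlinB; first exact: mlin_inner (Phi_hom (ltnW ip)).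
  by apply: mlin_tilr => //; apply: bal_fun_bilin.
have lift_eta s : size s = i -> exists v, yd eta i.+1 v = D s.
  by move=> /cmp /(yd_exact ip).
have [H mH dH] := mlin_lift (@kmod_linear _ _ _ _ (yd eta i.+1)) mD lift_eta.
exists Psi'; split=> // [s hs|].
  rewrite (@del_map _ _ _ _ (left_action _) (left_action _) _ _ _
    (@kmod_linear _ _ _ _ (yd xi i.+1))).
  - transitivity (ldel i (ldel i Psi) s); last by rewrite (del_del (left_action (yE xi i))).
    rewrite -[LHS]/(ldel i (fun u => yd xi i.+1 (Psi' u)) s).
    refine (@eq_del k A (kmod (yE xi i)) (left_action (yE xi i))
      (fun u => yd xi i.+1 (Psi' u)) (ldel i Psi) s _).
    by move=> u; rewrite hs => -[/dPsi'].
  - by move=> a v; rewrite /= linearZ.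
  by move=> a v; rewrite /= linearZ.
(* Applying [yd] to the new difference gives the coboundary of the first two terms of [D] minus that
   of [D], which is the coboundary of [X], hence zero. *)
exists (edel i.+1 H); split; first exact: mlin_del.
  by move=> s _; apply: del_del.
move=> s hs; rewrite !linearB.
have -> : yd eta i.+1 (inner i.+1 (Phi i.+1) s) = edel i (inner i (Phi i)) s.
  rewrite /inner truncE // Phi_d ?size_rcons /= ?size_rcons ?hs //.
  by rewrite bar_d_inner // ; apply/Phi_hom/ltnW.
have -> : yd eta i.+1 (ind_tilr Psi' s) = edel i (ind_tilr Psi) s.
  rewrite [RHS]del_tilr //.
  rewrite [LHS](@tilr_map _ _ _ _ _ _ _ _ _ _ (@kmod_linear _ _ _ _ (yd eta i.+1))).
  transitivity (tilr (fun x (m : kmod (yE xi i.+1)) =>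
    bal_fun (@t i) 1 x (yd xi i.+1 m : kmod (yE xi i))) 1 Psi' s).
    refine (@eq_tilr _ _ (kmod (yE xi i.+1)) (kmod (yE eta i)) _ _ _ _ _ _ _ _) => // x m.
    by rewrite /bal_fun t_yd.
  rewrite -(tilr_comp (bal_fun (@t i) 1)
    (fun m : kmod (yE xi i.+1) => yd xi i.+1 m : kmod (yE xi i))).
  refine (@eq_tilr _ _ (kmod (yE xi i)) (kmod (yE eta i)) _ _ _ _ _ _ _ _) => // u hu.
  by apply: dPsi'; rewrite hu.
have -> : yd eta i.+1 (edel i.+1 H s) = edel i D s.
  rewrite (@del_map _ _ _ _ (env_action _) (env_action _) _ _ _
    (@kmod_linear _ _ _ _ (yd eta i.+1))).
  - refine (@eq_del k A (kmod (yE eta i)) (env_action _) _ _ s _) => u.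
    by rewrite hs => -[/dH].
  - by move=> a v; rewrite /= /env_lact linearZ.
  by move=> a v; rewrite /= /env_ract linearZ.
by rewrite [edel i D s]delB delB dX // subr0 subrr.
Qed.

Lemma comparedP i : (i <= p)%N -> compared i.
Proof.
by elim: i => [|i IH] h; [exact: compared0 | apply: comparedS => //; apply/IH/ltnW].
Qed.

End Comparison.

Section Trivial.
Variables (k : fieldType) (A : hopfAlg k).

Fact counit_bilin : bilin (fun (a : A) (c : k^o) => (heps a : k) * c : k^o).
Proof.
split=> [v c a b|a c u v] /=.
  by rewrite linearP mulrDl; congr (_ + _); apply: (esym (mulrA c (heps a : k) v)).
by rewrite mulrDr; congr (_ + _); apply: (mulrCA (heps a : k) c u).
Qed.

Fact counitM (a b : A) (c : k^o) :
  (heps (a * b) : k) * c = (heps a : k) * ((heps b : k) * c) :> k^o.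
Proof. by rewrite rmorphM mulrA. Qed.

Fact counitMC (a b : A) (c : k^o) :
  (heps (a * b) : k) * c = (heps b : k) * ((heps a : k) * c) :> k^o.
Proof. by rewrite rmorphM mulrCA mulrA. Qed.

Fact counit_comm (a b : A) (c : k^o) :
  (heps a : k) * ((heps b : k) * c) = (heps b : k) * ((heps a : k) * c) :> k^o.
Proof. by rewrite mulrCA. Qed.

Definition counit_action : biaction A k^o :=
  Biaction counit_bilin counit_bilin counitM counitMC counit_comm.

Definition scalef (b : A) (c : k^o) : A := (c : k) *: b.

Lemma scalef_bilin : bilin scalef.
Proof.
split=> [c d b b'|b d c c']; rewrite /scalef; first by rewrite scalerDr !scalerA mulrC.
by rewrite scalerDl -scalerA.
Qed.

Definition til (phi : seq A -> k^o) : seq A -> A := tilr scalef 1 phi.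

Lemma mlin_til phi : mlin phi -> mlin (til phi).
Proof. exact/mlin_tilr/scalef_bilin. Qed.

Lemma eq_til phi psi s : (forall u, size u = size s -> phi u = psi u) -> til phi s = til psi s.
Proof. exact: eq_tilr. Qed.

Lemma triv_k_linear : linear (fun c : kmod (triv A) => c : k^o).
Proof.
move=> c u v /=; congr (_ + _); rewrite kmodZ trivZ heps_scalar //.
Qed.

Lemma bimod_linear : linear (fun b : kmod (bimod A : lmodType (env_alg A)) => b : A).
Proof.
move=> c u v /=; congr (_ + _).
rewrite -[LHS]/(bimod_scale (c%:A) u) -[c%:A]/(c *: pure 1 1).
by rewrite -(bilinZl _ _ _ (pure_bilin _ _)) bimod_scale_pure mulr1 -scalerAl mul1r.
Qed.

(** The counit axiom. Identities between embedded cochains thereby descend to the k-valued ones. *)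
Lemma heps_til phi s : mlin phi -> heps (til phi s) = phi s.
Proof.
have gen b : mlin phi -> heps (tilr scalef b phi s) = (heps b : k) * phi s :> k.
  elim: s b phi => [|a s IH] b phi mp /=; first by rewrite linearZ /= mulrC.
  rewrite (@tlift_comp _ _ _ _ _ heps); last exact: linearP.
  rewrite -[in RHS](hcounitr a).
  rewrite (@tlift_comp _ _ _ _ _ (fun x => (heps b : k) * phi (x :: s) : k^o)).
    refine (@eq_tlift _ _ _ (k^o : lmodType k) _ _ _ _) => a1 a2. rewrite IH; last exact: mlin_cons.
    by rewrite rmorphM (linear_funZ _ _ (mlin_head s mp)) -mulrA.
  move=> c x y; rewrite (mlin_head s mp) mulrDr; congr (_ + _).
  exact: (mulrCA (heps b : k) c).
by move=> mp; rewrite /til gen // rmorph1 mul1r.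
Qed.

(** The antipode axiom: [env_delta a] sends the unit of [A] to the sum of [a_1 S(a_2)], which is
    [heps a]. *)
Lemma triv_tensor_balanced : balanced (@triv_tensor k A).
Proof.
split=> [w w' m|w m m'|w a m].
- exact: scalerDl.
- by rewrite /triv_tensor [(m + m')%:A]scalerDl [LHS]scalerDr.
rewrite /triv_tensor -scalerA; congr (_ *: _).
rewrite /env_delta -[LHS]/(bimod_scale _ _).
rewrite (@tlift_comp _ _ _ _ _ (fun w : env_alg A => bimod_scale w ((m : k)%:A : A) : A));
  last exact: linearP.
transitivity (tlift (fun a1 a2 : A => (m : k) *: (a1 * hantipode a2)) (hdelta a)).
  refine (@eq_tlift _ _ _ (A : lmodType k) _ _ _ _) => a1 a2.
  by rewrite bimod_scale_pure -scalerAr mulr1 -scalerAl.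
rewrite -(@tlift_comp _ _ _ _ _ (fun b : A => (m : k) *: b)) ?hantipoder.
  by rewrite scalerA mulrC.
by move=> c x y; rewrite scalerDr !scalerA mulrC.
Qed.

Lemma tilE (phi : seq A -> kmod (triv A)) s :
  til phi s = tilr (bal_fun (@triv_tensor k A) 1) 1 phi s :> A.
Proof.
rewrite [LHS](tilr_comp scalef (fun c : kmod (triv A) => c : k^o)).
rewrite [RHS](@tilr_map _ _ _ _ _ _ (fun b : kmod (bimod A : lmodType (env_alg A)) => b : A));
  last exact: bimod_linear.
refine (@eq_tilr _ _ (kmod (triv A)) (A : lmodType k) _ _ _ _ _ _ _ _) => // b c.
by rewrite /bal_fun triv_tensorE.
Qed.

Lemma del_triv (phi : seq A -> kmod (triv A)) s :
  del (left_action (triv A)) phi s = del counit_action (phi : seq A -> k^o) s :> k.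
Proof.
apply: (@del_map _ _ _ _ (left_action (triv A)) counit_action (fun c : kmod (triv A) => c : k^o)).
- exact: triv_k_linear.
- by [].
by move=> a v; rewrite /= [LHS]kmodZ trivZ heps_scalar.
Qed.

Lemma del_bimod (F : seq A -> kmod (bimod A : lmodType (env_alg A))) s :
  del (env_action (bimod A : lmodType (env_alg A))) F s = del (regular A) (F : seq A -> A) s :> A.
Proof.
apply: (@del_map _ _ _ _ (env_action _) (regular A)
  (fun b : kmod (bimod A : lmodType (env_alg A)) => b : A)).
- exact: bimod_linear.
- by move=> a v; rewrite /= /env_lact [LHS]bimod_scale_pure mulr1.
by move=> a v; rewrite /= /env_ract [LHS]bimod_scale_pure mul1r.
Qed.

Lemma mlin_triv (phi : seq A -> k^o) : mlin phi -> mlin (phi : seq A -> kmod (triv A)).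
Proof.
move=> mp s1 s2 c a b; rewrite mp; congr (_ + _).
by rewrite [RHS]kmodZ trivZ heps_scalar.
Qed.

Lemma triv_mlin (phi : seq A -> kmod (triv A)) : mlin phi -> mlin (phi : seq A -> k^o).
Proof. by move=> mp s1 s2 c a b; rewrite mp triv_k_linear. Qed.

Lemma del_til phi s : mlin phi -> del (regular A) (til phi) s = til (del counit_action phi) s.
Proof.
move=> /mlin_triv mp; have bt := triv_tensor_balanced.
have ct : forall w w' m, w *: triv_tensor w' m = @triv_tensor k A (w * w') m.
  by move=> w w' m; rewrite /triv_tensor scalerA.
have := del_tilr bt ct s mp; rewrite del_bimod => e.
transitivity (til (del (left_action (triv A)) phi) s).
  rewrite tilE -e; apply: eq_del => u _; exact: tilE.
by apply: eq_til => u _; rewrite del_triv.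
Qed.

Section Embedding.
Variables (p : nat) (xi : yext (triv A) (triv A) p) (f : seq A -> A).

(** At the last term of the extensions, the coboundary of [Psi] comes from k and gives [phi], while
    the difference between the given chain map and the induced one lifts along [yincl] to [h]. *)
Lemma embeds_til : embeds_as xi f ->
  exists phi : seq A -> k^o, exists h : seq A -> A,
  [/\ mlin phi, mlin h, forall s, size s = p.+2 -> del counit_action phi s = 0 &
      forall s, size s = p.+1 -> f s = til phi s + del (regular A) h s].
Proof.
case=> eta [t [t_ind t_yd t_incl]] [mf [Phi [Phi_hom Phi0 Phi_d Phi_end]]].
have [Psi [mPsi dPsi [X [mX dX cmp]]]] := comparedP t_ind t_yd Phi_hom Phi0 Phi_d (leqnn p).
have [bp cp _] := t_ind _ (leqnn p).
have lift_xi s : size s = p.+1 -> exists v, yincl xi v = del (left_action (yE xi p)) Psi s.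
  by move=> /dPsi /(yincl_exact).
have [phi mphi dphi] :=
  mlin_lift (@kmod_linear _ _ _ _ (yincl xi)) (mlin_del (left_action _) mPsi) lift_xi.
pose D s := inner p (Phi p) s - ind_tilr t Psi s - X s.
have mD : mlin D.
  apply: mlinB => //; apply: mlinB; first exact: mlin_inner (Phi_hom _ (leqnn p)).
  by apply: mlin_tilr => //; apply: bal_fun_bilin.
have lift_eta s : size s = p -> exists v, yincl eta v = D s.
  by move=> /cmp /(yincl_exact).
have [h mh dh] := mlin_lift (@kmod_linear _ _ _ _ (yincl eta)) mD lift_eta.
exists phi, h; split.
- exact: triv_mlin.
- by move=> s1 s2 c a b; rewrite mh bimod_linear.
- move=> s hs; rewrite -del_triv; apply: (@yincl_inj _ _ _ _ xi); rewrite linear0.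
  rewrite (@del_map _ _ _ _ (left_action _) (left_action _) _ _ _
    (@kmod_linear _ _ _ _ (yincl xi))).
  - transitivity (del (left_action (yE xi p)) (del (left_action (yE xi p)) Psi) s).
      refine (@eq_del k A (kmod (yE xi p)) (left_action _) _ _ s _) => u.
      by rewrite hs => -[/dphi].
    by rewrite (del_del (left_action (yE xi p))).
  - by move=> a v; rewrite /= linearZ.
  by move=> a v; rewrite /= linearZ.
move=> s hs; apply: (@yincl_inj _ _ _ _ eta).
have -> : yincl eta (f s) = del (env_action (yE eta p)) (inner p (Phi p)) s.
  by rewrite -bar_d_inner // ?Phi_end // ?mul1r ?mulr1 //; apply: Phi_hom.
have -> : yincl eta (til phi s + del (regular A) h s) =
  yincl eta (til phi s) + yincl eta (del (regular A) h s) by rewrite -linearD.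
have -> : yincl eta (til phi s) = del (env_action (yE eta p)) (ind_tilr t Psi) s.
  rewrite tilE [RHS]del_tilr //.
  rewrite [LHS](@tilr_map _ _ _ _ _ _ _ _ _ _ (@kmod_linear _ _ _ _ (yincl eta))).
  transitivity (tilr (fun x (m : kmod (triv A)) =>
    bal_fun (@t p) 1 x (yincl xi m : kmod (yE xi p))) 1 phi s).
    refine (@eq_tilr _ _ (kmod (triv A)) (kmod (yE eta p)) _ _ _ _ _ _ _ _) => // x m.
    by rewrite /bal_fun t_incl.
  rewrite -(tilr_comp (bal_fun (@t p) 1) (fun m : kmod (triv A) => yincl xi m : kmod (yE xi p))).
  refine (@eq_tilr _ _ (kmod (yE xi p)) (kmod (yE eta p)) _ _ _ _ _ _ _ _) => // u hu.
  by apply: dphi; rewrite hu.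
have -> : yincl eta (del (regular A) h s) = del (env_action (yE eta p)) D s.
  rewrite -del_bimod.
  rewrite (@del_map _ _ _ _ (env_action _) (env_action _) _ _ _
    (@kmod_linear _ _ _ _ (yincl eta))).
  - refine (@eq_del k A (kmod (yE eta p)) (env_action _) _ _ s _) => u.
    by rewrite hs => -[/dh].
  - by move=> a v; rewrite /= /env_lact linearZ.
  by move=> a v; rewrite /= /env_ract linearZ.
rewrite [del _ D s]delB delB dX // subr0 addrC subrK //.
Qed.

End Embedding.
End Trivial.

(** * The bracket of embedded cochains *)

Section TilBracket.
Variables (k : fieldType) (A : hopfAlg k).
Implicit Types (phi psi : seq A -> k^o) (b d : A) (s u v : seq A).
Local Notation S := (@scalef k A).

Let Sb : bilin S := @scalef_bilin k A.

(** An embedded cochain in the first argument of [phi]. The factor [d], which is 1 in the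
    application, lets the induction accumulate the second components of the entries already read. *)
Definition headf phi psi d m s : k^o :=
  phi (tilr S d psi (take m s) :: drop m s).

Lemma headf_lin phi psi m s : mlin phi -> linear (fun d => headf phi psi d m s).
Proof. by move=> mp c x y; rewrite /headf tilr_linb // (mlin_head _ mp). Qed.

Lemma tilr_headf_lin phi psi m b s : mlin phi ->
  linear (fun d => tilr S b (headf phi psi d m) s).
Proof.
move=> mp c x y; rewrite -tilr_linF //; apply: eq_tilr => // u _; exact: headf_lin.
Qed.

Lemma headf_psi_lin phi psi psi' c d m s (f : seq A -> k^o) : mlin phi ->
  (forall u, f u = c *: psi u + psi' u) ->
  headf phi f d m s = c *: headf phi psi d m s + headf phi psi' d m s.
Proof.
move=> mp ef; rewrite /headf -(mlin_head _ mp) -tilr_linF //.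
by congr (phi (_ :: _)); apply: eq_tilr.
Qed.

Lemma tilr_headf_cons phi psi d a m b s : mlin phi ->
  tilr S b (headf phi psi d m.+1) (a :: s) =
  tlift (fun a' a3 => tlift (fun a1 a2 =>
     tilr S (b * a3) (headf phi (fun u => psi (a1 :: u)) (d * a2) m) s) (hdelta a')) (hdelta a).
Proof.
move=> mp; rewrite tilr_cons; apply: eq_tlift => a' a3.
rewrite -tilr_tlift //; apply: eq_tilr => // u _.
rewrite /headf [take _ _]/= [drop _ _]/= tilr_cons.
by rewrite (@tlift_comp _ _ _ _ _ (fun y => phi (y :: drop m u))) //; exact: mlin_head.
Qed.

(* Coassociativity, used once per entry of [u]. *)
Lemma tilr_til_cons phi psi b d u v : mlin phi -> mlin psi ->
  tilr S b phi (tilr S d psi u :: v) =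
  tlift (fun d1 d2 => tilr S (b * d2) (headf phi psi d1 (size u)) (u ++ v)) (hdelta d).
Proof.
move=> mp; elim: u psi b d => [|a u IH] psi b d ms;
  have lG : linear (fun w => tilr S b phi (w :: v)) by exact: (mlin_head v (mlin_tilr b Sb mp)).
  rewrite -[tilr S d psi [::]]/((psi [::] : k) *: d) (linear_funZ _ _ lG) tilr_cons.
  rewrite (@tlift_comp _ _ _ _ _ (fun w : A => (psi [::] : k) *: w)); last first.
    by move=> c x y; rewrite scalerDr !scalerA mulrC.
  apply: eq_tlift => d1 d2; rewrite -tilrZ //; apply: eq_tilr => // w _.
  rewrite /headf take0 drop0 -[tilr S _ _ _]/((psi [::] : k) *: d1).
  by rewrite (linear_funZ _ _ (mlin_head w mp)).
rewrite [tilr S d psi (a :: u)]tilr_cons.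
rewrite (@tlift_comp _ _ _ _ _ (fun w => tilr S b phi (w :: v))) //.
transitivity (tlift (fun d1 d2 => tlift (fun a1 a' => tlift (fun a2 a3 =>
   tilr S (b * d2 * a3) (headf phi (fun w => psi (a1 :: w)) (d1 * a2) (size u)) (u ++ v))
   (hdelta a')) (hdelta a)) (hdelta d)).
  rewrite tlift_swap; apply: eq_tlift => a1 a'; rewrite IH; last exact: mlin_cons.
  rewrite tlift_deltaM; last first.
    split=> [z c x y|z c x y]; first exact: tilr_headf_lin.
    by rewrite mulrDr -scalerAr tilr_linb.
  by apply: eq_tlift => d1 d2; apply: eq_tlift => a2 a3; rewrite mulrA.
apply: eq_tlift => d1 d2; rewrite cat_cons tilr_headf_cons //.
rewrite -(hcoassocT (t := fun a1 a2 a3 =>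
  tilr S (b * d2 * a3) (headf phi (fun w => psi (a1 :: w)) (d1 * a2) (size u)) (u ++ v))) //.
- move=> y z c x x'; rewrite -tilr_linF //; apply: eq_tilr => // w _.
  by apply: headf_psi_lin => // w'; apply: (mlin_head w' ms).
- by move=> x z c y y'; rewrite mulrDr -scalerAr tilr_headf_lin.
by move=> x y c z z'; rewrite mulrDr -scalerAr tilr_linb.
Qed.

Lemma tilr_til phi psi b u v : mlin phi -> mlin psi ->
  tilr S b phi (til psi u :: v) = tilr S b (headf phi psi 1 (size u)) (u ++ v).
Proof.
move=> mp ms; rewrite tilr_til_cons // rmorph1 (_ : 1 = pure 1 1) // tliftE ?mulr1 //.
split=> [z c x y|z c x y]; first exact: tilr_headf_lin.
by rewrite mulrDr -scalerAr tilr_linb.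
Qed.

Lemma ins_tilr n phi psi b s : mlin phi -> mlin psi ->
  ins n (til psi) (tilr S b phi) s = tilr S b (ins n (til psi) phi) s.
Proof.
move=> mp ms.
have hd b' phi' s' : mlin phi' -> (if (n <= size s')%N then
     tilr S b' phi' (til psi (take n s') :: drop n s') else 0) =
   tilr S b' (fun u => if (n <= size u)%N then phi' (til psi (take n u) :: drop n u) else 0) s'.
  move=> mp'; case: leqP => h; last first.
    rewrite -[LHS](tilr0 b' s' Sb); apply: eq_tilr => // u ->.
    by rewrite leqNgt h.
  rewrite tilr_til // cat_take_drop size_takel //; apply: eq_tilr => // u hu.
  by rewrite hu h.
elim: s b phi mp => [|a s IH] b phi mp.
  have := hd b phi [::] mp; rewrite /= !addr0 => ->; congr (S b _).
rewrite ins_cons [X in X + _](hd b phi (a :: s) mp) tilr_cons.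
have -> : ins n (til psi) (fun u => tilr S b phi (a :: u)) s =
  tlift (fun a1 a2 => tilr S (b * a2) (ins n (til psi) (fun u => phi (a1 :: u))) s) (hdelta a).
  by rewrite ins_tlift; apply: eq_tlift => a1 a2; apply: IH; apply: mlin_cons.
rewrite addrC [RHS]tilr_cons; symmetry; apply: tlift_lin => a1 a2.
rewrite -tilr_linF //; apply: eq_tilr => // u _.
by rewrite ins_cons addrC.
Qed.

End TilBracket.

(** * Vanishing of odd cohomology *)

Section Dual.
Variables (k : fieldType) (A : hopfAlg k).

Definition functional : Type := 'Hom(A, (k^o : vectType k)).
HB.instance Definition _ := Vector.on functional.

Definition dual_lact (a : A) (f : functional) : functional := (f \o amulr a)%VF.
Definition dual_ract (a : A) (f : functional) : functional := (heps a : k) *: f.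

Lemma dual_lactE a f b : dual_lact a f b = f (b * a).
Proof. by rewrite /dual_lact comp_lfunE lfunE. Qed.

Fact dual_lact_bilin : bilin dual_lact.
Proof.
split=> [f c a b|a c f g]; apply/lfunP => y.
  by rewrite add_lfunE scale_lfunE !dual_lactE mulrDr -scalerAr linearP.
by rewrite add_lfunE scale_lfunE !dual_lactE add_lfunE scale_lfunE.
Qed.

Fact dual_ract_bilin : bilin dual_ract.
Proof.
split=> [f c a b|a c f g]; rewrite /dual_ract; first by rewrite linearP scalerDl scalerA.
by rewrite scalerDr !scalerA mulrC.
Qed.

Fact dual_lactM a b f : dual_lact (a * b) f = dual_lact a (dual_lact b f).
Proof. by apply/lfunP => y; rewrite !dual_lactE mulrA. Qed.

Fact dual_ractM a b f : dual_ract (a * b) f = dual_ract b (dual_ract a f).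
Proof. by rewrite /dual_ract rmorphM scalerA mulrC. Qed.

Fact dual_lact_ract a b f : dual_lact a (dual_ract b f) = dual_ract b (dual_lact a f).
Proof. by rewrite /dual_ract (linear_funZ _ _ (bilin_linr dual_lact_bilin a)). Qed.

Definition dual_action : biaction A functional :=
  Biaction dual_lact_bilin dual_ract_bilin dual_lactM dual_ractM dual_lact_ract.

Definition precomp (u : 'End(A)) (f : functional) : functional := (f \o u)%VF.

Lemma precompE u f b : precomp u f b = f (u b).
Proof. exact: comp_lfunE. Qed.

Lemma precomp_linear u : linear (precomp u).
Proof. by move=> c f g; rewrite /precomp comp_lfunDl comp_lfunZl. Qed.

Lemma mlin_precomp u (F : seq A -> functional) : mlin F -> mlin (fun s => precomp u (F s)).
Proof. by move=> mF s1 s2 c a b; rewrite mF precomp_linear. Qed.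

(** [A] acts on functionals through right multiplication, which commutes with left multiplication by
    [u]. *)
Lemma precomp_del u (F : seq A -> functional) s :
  precomp (amull u) (del dual_action F s) =
  del dual_action (fun v => precomp (amull u) (F v)) s.
Proof.
apply: del_map; first exact: precomp_linear.
  by move=> a f; apply/lfunP => b; rewrite /= !(precompE, dual_lactE) !lfunE /= mulrA.
move=> a f; apply: linear_funZ; exact: precomp_linear.
Qed.

Definition bar_htpy (F : seq A -> functional) s : functional :=
  linfun (fun b => F (b :: s) 1 : k^o).

Lemma linfunE (h : A -> k^o) (b : A) : linear h -> linfun h b = h b.
Proof.
move=> lh; pose lm := GRing.isLinear.Build k _ _ _ h lh.
pose L : {linear A -> k^o} := HB.pack h lm.
exact: (lfunE L).
Qed.

Lemma bar_htpyE F s b : mlin F -> bar_htpy F s b = F (b :: s) 1.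
Proof.
by move=> mF; apply: linfunE => c x y; rewrite (mlin_head s mF) add_lfunE scale_lfunE.
Qed.

Lemma mlin_bar_htpy F : mlin F -> mlin (bar_htpy F).
Proof.
move=> mF s1 s2 c a b; apply/lfunP => y; rewrite add_lfunE scale_lfunE !bar_htpyE //.
by rewrite -cat_cons mF add_lfunE scale_lfunE.
Qed.

(** In the cocycle identity of [F] on [b :: s], evaluated at 1, the first term is [F s b] and the
    others form the left side evaluated at [b]. *)
Lemma del_bar_htpy F m s : mlin F ->
  (forall u, size u = m.+2 -> del dual_action F u = 0) -> size s = m.+1 ->
  del dual_action (bar_htpy F) s = F s.
Proof.
move=> mF cF hs; apply/lfunP => b.
have ev_lin y : linear (fun f : functional => f y : k^o).
  by move=> c f g; rewrite add_lfunE scale_lfunE.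
have := cF (b :: s); rewrite /= hs => /(_ erefl) /(congr1 (fun f : functional => f 1 : k^o)).
rewrite zero_lfunE.
case: s hs => // a s [hs].
rewrite /del !add_lfunE !opp_lfunE !scale_lfunE ins_mu_cons2.
rewrite !lterm_cons !dual_lactE mul1r !bar_htpyE // add_lfunE opp_lfunE.
rewrite !(ins_map _ _ _ _ (ev_lin _)) [last b _]/= [belast b _]/= [size (b :: _)]/=.
set R := ins _ _ (fun u => F (b :: u) 1) _.
have -> : ins 2 (@mu _ A) (fun u => bar_htpy F u b) (a :: s) = R.
  by apply: eq_ins => // u _; rewrite bar_htpyE.
rewrite exprS mulN1r scaleNr => /eqP; rewrite subr_eq0 => /eqP <-.
by rewrite addrC subrK.
Qed.

End Dual.

(* [D i] is a left inverse of multiplication by [x i] up to multiples of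
   [x i ^+ n.-1]: on a Taft algebra it maps [x^j g^l] to [x^(j-1) g^l] for j > 0. *)
Record taft_gens (k : fieldType) (n : nat) (omega : k) (A : hopfAlg k) (N : nat)
    (x g : nat -> A) (D E : nat -> 'End(A)) : Prop := TaftGens {
  tg_gn : forall i, (i < N)%N -> g i ^+ n = 1;
  tg_xn : forall i, (i < N)%N -> x i ^+ n = 0;
  tg_gx : forall i, (i < N)%N -> g i * x i = omega *: (x i * g i);
  tg_ggC : forall i j, (i < N)%N -> (j < N)%N -> g i * g j = g j * g i;
  tg_gxC : forall i j, (i < N)%N -> (j < N)%N -> i != j -> g i * x j = x j * g i;
  tg_xxC : forall i j, (i < N)%N -> (j < N)%N -> x i * x j = x j * x i;
  tg_Dx : forall i b, (i < N)%N -> D i (x i * b) = b - x i ^+ n.-1 * E i b;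
  tg_Dg : forall i b, (i < N)%N -> D i (g i * b) = omega *: (g i * D i b);
  tg_DgC : forall i j b, (i < N)%N -> (j < N)%N -> i != j -> D i (g j * b) = g j * D i b;
  tg_DxC : forall i j b, (i < N)%N -> (j < N)%N -> i != j -> D i (x j * b) = x j * D i b;
  tg_eps_g : forall i, (i < N)%N -> heps (g i) = 1 :> k;
  tg_eps_x : forall i, (i < N)%N -> heps (x i) = 0 :> k;
  tg_gen : forall f : A -> k^o, linear f ->
    (forall i b, (i < N)%N -> f (g i * b) = f b) ->
    (forall i b, (i < N)%N -> f (x i * b) = 0) ->
    forall b, f b = heps b * f 1
}.

(** * Dimension shifting for submodules of the dual of [A] *)

Section Vanishing.
Variables (k : fieldType) (n : nat) (omega : k) (A : hopfAlg k) (N : nat).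
Variables (x g : nat -> A) (D E : nat -> 'End(A)).
Hypotheses (n_gt1 : (1 < n)%N) (omP : n.-primitive_root omega) (n_neq0 : n%:R != 0 :> k).
Hypothesis TG : taft_gens n omega N x g D E.
Local Notation functional := (functional A).
Local Notation ddel := (del (dual_action A)).

Let om_n : omega ^+ n = 1. Proof. exact: prim_expr_order. Qed.
Let om_neq0 : omega != 0. Proof. by rewrite (prim_root_eq0 omP) -lt0n ltnW. Qed.
Let om_neq1 : omega != 1.
Proof.
apply/eqP => e; have := prim_order_dvd omP 1; rewrite expr1 e eqxx.
by rewrite dvdn1; case: n n_gt1 => [|[]].
Qed.
Let om_pred : omega ^+ n.-1 = omega^-1.
Proof. by apply: (mulfI om_neq0); rewrite -exprS prednK ?om_n ?divff // ltnW. Qed.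

(** A boolean suffices: [x i] leads from the trivial character of [g i] to [omega^-1], and
    [x i ^+ n.-1] leads back because [omega ^+ n = 1]. *)
Definition chi (b : bool) : k := if b then omega^-1 else 1.

Lemma chi_n b : chi b ^+ n = 1.
Proof. by case: b; rewrite /= ?expr1n // exprVn om_n invr1. Qed.

Lemma chi_neq0 b : chi b != 0.
Proof. by case: b; rewrite /= ?oner_eq0 // invr_eq0. Qed.

Definition gcond (c : nat -> bool) i (f : functional) := forall b, f (g i * b) = chi (c i) * f b.
Definition xcond i (f : functional) := forall b, f (x i * b) = 0.

(* The coefficient modules: [c] records the characters of the [g i], and [x i]
   acts by 0 for [i >= j]. *)
Definition inM (c : nat -> bool) j (f : functional) :=
  (forall i, (i < N)%N -> gcond c i f) /\
  (forall i, (j <= i)%N -> (i < N)%N -> xcond i f).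

Lemma gcond_lin c i a f h : gcond c i f -> gcond c i h -> gcond c i (a *: f + h).
Proof.
move=> hf hh b; rewrite !add_lfunE !scale_lfunE hf hh mulrDr; congr (_ + _).
exact: mulrCA.
Qed.

Lemma inM_lin c j a f h : inM c j f -> inM c j h -> inM c j (a *: f + h).
Proof.
move=> [gf xf] [gh xh]; split=> [i iN|i ji iN]; first exact: gcond_lin (gf i iN) (gh i iN).
by move=> b; rewrite add_lfunE scale_lfunE xf // xh // addr0; apply: mulr0.
Qed.

Lemma inM0 c j : inM c j 0.
Proof. by split=> [i iN b|i ji iN b]; rewrite !zero_lfunE ?mulr0. Qed.

Lemma inMD c j f h : inM c j f -> inM c j h -> inM c j (f + h).
Proof. by move=> hf hh; rewrite -[f]scale1r; apply: inM_lin. Qed.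

Lemma inMZ c j a f : inM c j f -> inM c j (a *: f).
Proof. by move=> hf; rewrite -[_ *: _]addr0; apply: inM_lin => //; apply: inM0. Qed.

Lemma inMB c j f h : inM c j f -> inM c j h -> inM c j (f - h).
Proof. by move=> hf hh; rewrite -scaleN1r addrC; apply: inM_lin. Qed.

Lemma inM_lact c j a f : inM c j f -> inM c j (dual_lact a f).
Proof.
move=> [gf xf]; split=> [i iN b|i ji iN b]; rewrite !dual_lactE -mulrA; first exact: gf.
exact: xf.
Qed.

Lemma inM_ins c j m h (F : seq A -> functional) s :
  (forall u, inM c j (F u)) -> inM c j (ins m h F s).
Proof.
elim: s F => [|a s IH] F hF /=; apply: inMD; try exact: inM0.
- by case: ifP => _ //; apply: inM0.
- by case: ifP => _ //; apply: inM0.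
by apply: inMZ; apply: IH.
Qed.

Lemma inM_del c j (F : seq A -> functional) s : (forall u, inM c j (F u)) -> inM c j (ddel F s).
Proof.
move=> hF; rewrite /del; apply: inMD; [apply: inMB|apply: inMZ].
- by case: s => [|a s]; [exact: inM0 | exact: inM_lact].
- exact: inM_ins.
by case: s => [|a s]; [exact: inM0 | exact: inMZ].
Qed.

Definition vanishes c j m := forall F : seq A -> functional, mlin F ->
  (forall s, inM c j (F s)) -> (forall s, size s = m.+1 -> ddel F s = 0) ->
  exists G, [/\ mlin G, forall s, inM c j (G s) & forall s, size s = m -> ddel G s = F s].

(** The cocycle condition makes the functional a multiple of [heps], hence invariant under [g i];
    the prescribed character [omega^-1] differs from 1, so it is zero. *)
Lemma vanishes0 (c : nat -> bool) j i : (i < N)%N -> c i -> vanishes c j 0.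
Proof.
move=> iN ci F mF hF cF; exists (fun=> 0); split; [exact: mlin0 | by move=> s; apply: inM0 |].
move=> s /size0nil ->; rewrite del_nil; apply/lfunP => b; rewrite zero_lfunE.
have ef y z : F [::] (y * z) = (heps z : k) * F [::] y :> k.
  have /(congr1 (fun f : functional => f y : k)) := cF [:: z] erefl.
  rewrite /del ins_small // subr0 lterm_cons rterm_cons /= /dual_ract expr1 scaleN1r.
  rewrite add_lfunE opp_lfunE scale_lfunE dual_lactE zero_lfunE => /eqP.
  by rewrite subr_eq0 => /eqP.
have [gF _] := hF [::]; have := gF i iN 1; rewrite /chi ci mulr1 -[g i]mul1r ef.
rewrite (tg_eps_g TG iN) mul1r => /eqP; rewrite -subr_eq0 -[X in X - _]mul1r -mulrBl mulf_eq0.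
rewrite subr_eq0 eq_sym invr_eq1 (negPf om_neq1) /= => /eqP F1.
by rewrite -[b]mul1r ef F1 mulr0.
Qed.

(** The projection onto the functionals on which [g i] has character [chi b]. *)
Definition chiavg b i (f : functional) : functional :=
  n%:R^-1 *: \sum_(l < n) chi b ^- l *: precomp (amull (g i ^+ l)) f.

Lemma chiavg_linear b i : linear (chiavg b i).
Proof.
move=> a f h; rewrite /chiavg scalerA mulrC -scalerA -scalerDr; congr (_ *: _).
rewrite scaler_sumr -big_split; apply: eq_bigr => l _.
by rewrite precomp_linear scalerDr !scalerA mulrC.
Qed.

Lemma gcond_exp c i f l : gcond c i f -> forall b, f (g i ^+ l * b) = chi (c i) ^+ l * f b :> k.
Proof.
move=> gf b; elim: l => [|l IH]; first by rewrite !expr0 !mul1r.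
by rewrite !exprS -mulrA gf IH mulrA.
Qed.

Lemma chiavgE b i f y :
  chiavg b i f y = n%:R^-1 * \sum_(l < n) chi b ^- l * f (g i ^+ l * y) :> k.
Proof.
rewrite /chiavg scale_lfunE sum_lfunE; congr (_ * _); apply: eq_bigr => l _.
by rewrite scale_lfunE precompE lfunE.
Qed.

Lemma chiavg_id c i f : gcond c i f -> chiavg (c i) i f = f.
Proof.
move=> gf; apply/lfunP => y; rewrite chiavgE.
under eq_bigr => l _ do rewrite (gcond_exp _ gf) mulrA mulVf ?expf_neq0 ?chi_neq0 // mul1r.
by rewrite sumr_const card_ord mulrnAr -mulrnAl -mulr_natl mulfV // mul1r.
Qed.

Lemma chiavg_gcond c i f : (i < N)%N -> gcond c i (chiavg (c i) i f).
Proof.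
move=> iN y; rewrite !chiavgE mulrCA; congr (_ * _).
rewrite mulr_sumr.
pose u l : k := chi (c i) ^- l * f (g i ^+ l * y).
have -> : \sum_(l < n) chi (c i) ^- l * f (g i ^+ l * (g i * y)) =
          \sum_(l < n) chi (c i) * u l.+1.
  apply: eq_bigr => l _; rewrite /u [g i ^+ l.+1]exprSr -[g i ^+ l * g i * y]mulrA.
  rewrite [RHS]mulrA; congr (_ * _).
  by rewrite exprSr invfM mulrCA mulfV ?chi_neq0 ?mulr1.
rewrite -!mulr_sumr; congr (_ * _).
have un : u n = u 0 by rewrite /u chi_n (tg_gn TG iN) !expr0.
case: n n_gt1 un => // m _ un; rewrite big_ord_recr big_ord_recl /= addrC.
by congr (_ + _).
Qed.

Lemma chiavg_gcondC c i j b f : (i < N)%N -> (j < N)%N -> gcond c j f -> gcond c j (chiavg b i f).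
Proof.
move=> iN jN gf y; rewrite !chiavgE mulrCA; congr (_ * _).
rewrite mulr_sumr; apply: eq_bigr => l _; rewrite mulrCA; congr (_ * _).
rewrite -gf !mulrA; congr (f (_ * _)).
by apply/esym/commrX; apply: (tg_ggC TG jN iN).
Qed.

Lemma chiavg_del b i (F : seq A -> functional) s :
  chiavg b i (ddel F s) = ddel (fun u => chiavg b i (F u)) s.
Proof.
apply: del_map; first exact: chiavg_linear.
  move=> a f; apply/lfunP => y; rewrite /= dual_lactE !chiavgE; congr (_ * _).
  by apply: eq_bigr => l _; rewrite dual_lactE mulrA.
move=> a f; rewrite /= /dual_ract; apply: linear_funZ; exact: chiavg_linear.
Qed.

(** The primitive [bar_htpy F] takes values in the whole dual; averaging commutes with [del] and
    fixes [F], so it brings the primitive back into the submodule. *)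
Lemma vanishes_inj c m : vanishes c N m.+1.
Proof.
move=> F mF hF cF.
suff [G [mG gG dG]] : exists G, [/\ mlin G,
    forall i s, (i < N)%N -> gcond c i (G s) & forall s, size s = m.+1 -> ddel G s = F s].
  exists G; split=> // s; split=> [i iN|i Ni iN]; first exact: gG.
  by move: (leq_ltn_trans Ni iN); rewrite ltnn.
(* The conditions are imposed one [g i] at a time; since the [g i] commute, a new average preserves
   those already obtained. *)
have : forall M, (M <= N)%N -> exists G, [/\ mlin G,
    forall i s, (i < M)%N -> gcond c i (G s) & forall s, size s = m.+1 -> ddel G s = F s].
  elim=> [|M IH] MN.
    exists (bar_htpy F); split=> //; first exact: mlin_bar_htpy.
    by move=> s; apply: del_bar_htpy.
  have [G [mG gG dG]] := IH (ltnW MN).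
  exists (fun s => chiavg (c M) M (G s)); split.
  - by move=> s1 s2 a y z; rewrite mG chiavg_linear.
  - move=> i s; rewrite ltnS leq_eqVlt => /predU1P [->|iM]; first exact: chiavg_gcond.
    by apply: chiavg_gcondC => //; [exact: ltn_trans iM MN | exact: gG].
  move=> s hs; rewrite -chiavg_del dG //; apply: chiavg_id.
  by have [gF _] := hF s; apply: gF.
by move/(_ N (leqnn N)).
Qed.

Section Step.
Variables (c : nat -> bool) (j : nat).
Hypotheses (jN : (j < N)%N) (cj : c j = false).
Let c' i := (i == j) || c i.
Let c'j : c' j. Proof. by rewrite /c' eqxx. Qed.
Let c'i i : i != j -> c' i = c i. Proof. by rewrite /c' => /negPf ->. Qed.

Lemma inM_x f : inM c j.+1 f -> inM c' j.+1 (precomp (amull (x j)) f).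
Proof.
move=> [gf xf]; split=> [i iN b|i ji iN b]; rewrite !precompE !lfunE /=.
  case: (eqVneq i j) => [->|ij].
    rewrite /chi c'j mulrA; apply: (mulfI om_neq0); rewrite mulrA divff // mul1r.
    have := gf j jN (x j * b); rewrite /chi cj mul1r mulrA (tg_gx TG jN) -scalerAl linearZ.
    by [].
  by rewrite c'i // mulrA -(tg_gxC TG iN jN ij) -mulrA gf.
by rewrite mulrA (tg_xxC TG jN iN) -mulrA xf.
Qed.

Lemma gx_exp m : g j * x j ^+ m = omega ^+ m *: (x j ^+ m * g j).
Proof.
elim: m => [|m IH]; first by rewrite !expr0 mulr1 mul1r scale1r.
rewrite exprS mulrA (tg_gx TG jN) -scalerAl -[x j * g j * _]mulrA IH -scalerAr scalerA -exprS.
by rewrite mulrA -!exprS.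
Qed.

Lemma inM_xn f : inM c' j.+1 f -> inM c j (precomp (amull (x j ^+ n.-1)) f).
Proof.
move=> [gf xf]; split=> [i iN b|i ji iN b]; rewrite !precompE !lfunE /=.
  case: (eqVneq i j) => [->|ij].
    rewrite /chi cj mul1r mulrA.
    have := gf j jN (x j ^+ n.-1 * b); rewrite /chi c'j mulrA gx_exp -scalerAl linearZ om_pred.
    by move/(mulfI _); apply; rewrite invr_eq0.
  rewrite -(c'i ij) -(gf i iN) !mulrA; congr (f (_ * _)).
  by apply/esym/commrX; apply: (tg_gxC TG iN jN ij).
rewrite mulrA; case: (eqVneq i j) => [->|ij].
  by rewrite -exprSr prednK ?(tg_xn TG jN) ?mul0r ?linear0 // ltnW.
have -> : x j ^+ n.-1 * x i = x i * x j ^+ n.-1.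
  by apply/esym/commrX; apply: (tg_xxC TG iN jN).
by rewrite -mulrA xf // ltn_neqAle eq_sym ij.
Qed.

(* [inM_D] and [inM_Dn] split the two maps of the exact sequence of [vanishes_step]. *)
Lemma inM_D f : inM c' j.+1 f -> inM c j.+1 (precomp (D j) f).
Proof.
move=> [gf xf]; split=> [i iN b|i ji iN b]; rewrite !precompE.
  case: (eqVneq i j) => [->|ij].
    rewrite (tg_Dg TG _ jN) linearZ /= (gf j jN) /chi c'j cj.
    by rewrite -[LHS]/(omega * (omega^-1 * _)) mulrA divff.
  by rewrite (tg_DgC TG) // 1?eq_sym // (gf i iN) c'i.
by rewrite (tg_DxC TG) ?xf // neq_ltn ji.
Qed.

Fixpoint Diter m : 'End(A) := if m is m'.+1 then (D j \o Diter m')%VF else \1%VF.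

Lemma DiterS m b : Diter m.+1 b = D j (Diter m b).
Proof. exact: comp_lfunE. Qed.

Lemma DiterSr m b : Diter m.+1 b = Diter m (D j b).
Proof.
elim: m => [|m IH]; first by rewrite DiterS /= !id_lfunE.
by rewrite DiterS IH -DiterS.
Qed.

Lemma Diter_g m b : Diter m (g j * b) = omega ^+ m *: (g j * Diter m b).
Proof.
elim: m => [|m IH]; first by rewrite /= !id_lfunE expr0 scale1r.
by rewrite !DiterS IH linearZ /= (tg_Dg TG _ jN) scalerA mulrC -exprS.
Qed.

Lemma Diter_gC m i b : (i < N)%N -> i != j -> Diter m (g i * b) = g i * Diter m b.
Proof.
move=> iN ij; elim: m => [|m IH]; first by rewrite /= !id_lfunE.
by rewrite !DiterS IH (tg_DgC TG) // eq_sym.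
Qed.

Lemma Diter_xC m i b : (i < N)%N -> i != j -> Diter m (x i * b) = x i * Diter m b.
Proof.
move=> iN ij; elim: m => [|m IH]; first by rewrite /= !id_lfunE.
by rewrite !DiterS IH (tg_DxC TG) // eq_sym.
Qed.

(** The error in [x j * r] is harmless, since the functionals of M vanish on it. *)
Lemma Diter_x m b : (m < n)%N -> exists r, Diter m (x j ^+ m * b) = b + x j * r.
Proof.
elim: m b => [|m IH] b mn.
  by exists 0; rewrite /= id_lfunE expr0 mul1r mulr0 addr0.
rewrite DiterSr exprS -mulrA (tg_Dx TG _ jN).
(* The error made by one [D j] is divisible by [x j ^+ m], so it is absorbed into [b]; the remaining
   power [n.-1 - m] is positive, so the change of [b] is a multiple of [x j]. *)
have [r hr] := IH (b - x j ^+ (n.-1 - m) * E j (x j ^+ m * b)) (ltnW mn).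
have -> : x j ^+ m * b - x j ^+ n.-1 * E j (x j ^+ m * b) =
   x j ^+ m * (b - x j ^+ (n.-1 - m) * E j (x j ^+ m * b)).
  by rewrite mulrBr mulrA -exprD subnKC // -ltnS prednK // (leq_trans _ mn).
rewrite hr; have : (0 < n.-1 - m)%N by rewrite subn_gt0 -ltnS prednK // (leq_trans _ mn).
case: (n.-1 - m)%N => // d _; exists (r - x j ^+ d * E j (x j ^+ m * b)).
by rewrite exprS -mulrA mulrBr addrAC addrA.
Qed.

Lemma inM_Dn f : inM c j f -> inM c' j.+1 (precomp (Diter n.-1) f).
Proof.
move=> [gf xf]; split=> [i iN b|i ji iN b]; rewrite !precompE.
  case: (eqVneq i j) => [->|ij].
    by rewrite Diter_g linearZ /= (gf j jN) /chi c'j cj mul1r om_pred.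
  by rewrite Diter_gC // (gf i iN) c'i.
by rewrite Diter_xC ?xf // ?(ltnW ji) // neq_ltn ji orbT.
Qed.

(** Surjectivity of I' -> M. *)
Lemma xn_Dn f : inM c j f -> precomp (amull (x j ^+ n.-1)) (precomp (Diter n.-1) f) = f.
Proof.
move=> [gf xf]; apply/lfunP => b; rewrite !precompE lfunE /=.
have [|r ->] := @Diter_x n.-1 b; first by rewrite prednK // ltnW.
by rewrite linearD /= (xf j (leqnn j) jN) addr0.
Qed.

(** Exactness at I': [D j] provides the preimage in I. *)
Lemma x_D f : precomp (amull (x j ^+ n.-1)) f = 0 -> precomp (amull (x j)) (precomp (D j) f) = f.
Proof.
move=> f0; apply/lfunP => b; rewrite !precompE lfunE /= (tg_Dx TG _ jN) linearB /=.
have /lfunP/(_ (E j b)) := f0; rewrite precompE lfunE zero_lfunE /= => ->.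
by rewrite subr0.
Qed.

Lemma x_ker f : inM c j.+1 f -> precomp (amull (x j)) f = 0 -> inM c j f.
Proof.
move=> [gf xf] f0; split=> // i; rewrite leq_eqVlt => /predU1P [<-|ji] iN; last exact: xf.
by move=> b; have /lfunP/(_ b) := f0; rewrite precompE lfunE zero_lfunE.
Qed.

Lemma xn_x f : precomp (amull (x j ^+ n.-1)) (precomp (amull (x j)) f) = 0.
Proof.
have xx : x j * x j ^+ n.-1 = 0 by rewrite -exprS prednK ?(tg_xn TG jN) // ltnW.
by apply/lfunP => b; rewrite [RHS]zero_lfunE !precompE !lfunE /= mulrA xx mul0r linear0.
Qed.

Lemma inM_sub f : inM c j f -> inM c j.+1 f.
Proof. by move=> [gf xf]; split=> // i ji; apply: xf; apply: ltnW. Qed.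

(* Dimension shifting along 0 -> M -> I -> I' -> M -> 0, with I and I' the modules
   for [(c, j.+1)] and [(c', j.+1)] and maps given by [x j], [x j ^+ n.-1]. *)
Lemma vanishes_step m : vanishes c j.+1 m -> (forall m', vanishes c' j.+1 m') ->
  (forall m', m = m'.+2 -> vanishes c j m') -> vanishes c j m.
Proof.
move=> vI vI' vM F mF hF cF.
have [psi [mpsi hpsi dpsi]] := vI F mF (fun s => inM_sub (hF s)) cF.
case: m => [|m] in vI vM cF dpsi *.
  exists (fun=> 0); split; [exact: mlin0 | by move=> s; apply: inM0 |].
  by move=> s /size0nil ->; rewrite -dpsi // !del_nil.
have mX (u : A) (H : seq A -> functional) : mlin H -> mlin (fun s => precomp (amull u) (H s)).
  exact: mlin_precomp.
(* A primitive in I lies in M once [x j] kills it. This is known on lists of length [m] only, hence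
   [trunc]. *)
have conclude (G : seq A -> functional) : mlin G -> (forall s, inM c j.+1 (G s)) ->
    (forall s, size s = m -> precomp (amull (x j)) (G s) = 0) ->
    (forall s, size s = m.+1 -> ddel G s = F s) ->
    exists G, [/\ mlin G, forall s, inM c j (G s) & forall s, size s = m.+1 -> ddel G s = F s].
  move=> mG hG kG dG; exists (trunc m G); split.
  - apply: mlin_trunc => s1 s2 a y z _; exact: mG.
  - move=> s; rewrite /trunc; case: eqP => [hs|_]; last exact: inM0.
    by apply: x_ker => //; apply: kG.
  - move=> s hs; rewrite -dG //; apply: eq_del => u; rewrite hs => -[]; exact: truncE.
(* The image of [psi] in I' is a cocycle because [x j] kills [F], and I' has no cohomology. *)
have [theta [mth hth dth]] : exists th, [/\ mlin th, forall s, inM c' j.+1 (th s) &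
    forall s, size s = m -> ddel th s = precomp (amull (x j)) (psi s)].
  apply: vI' => [|s|s hs]; [exact: mX | exact: inM_x |].
  rewrite -precomp_del dpsi //; apply/lfunP => b; rewrite precompE lfunE zero_lfunE /=.
  by have [_ xF] := hF s; apply: xF.
case: m => [|m] in vI vM cF dpsi conclude dth *.
  apply: (conclude psi) => // s hs; rewrite -dth //.
  by rewrite (size0nil hs) del_nil.
(* The image of [theta] in M is a cocycle two degrees below [F]. *)
have [zeta [mze hze dze]] : exists ze, [/\ mlin ze, forall s, inM c j (ze s) &
    forall s, size s = m -> ddel ze s = precomp (amull (x j ^+ n.-1)) (theta s)].
  apply: (vM m) => // [|s|s hs]; [exact: mX | exact: inM_xn |].
  by rewrite -precomp_del dth // xn_x.
(* Subtracting the coboundary of a lift of [zeta] to I' makes the image in M vanish and leaves the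
   coboundary of [theta] unchanged. *)
pose th' s := theta s - ddel (fun u => precomp (Diter n.-1) (zeta u)) s.
have mth' : mlin th' by apply: mlinB => //; apply/mlin_del/mlin_precomp.
have hth' s : inM c' j.+1 (th' s).
  by apply: inMB => //; apply: inM_del => u; apply: inM_Dn.
have kth' s : size s = m -> precomp (amull (x j ^+ n.-1)) (th' s) = 0.
  move=> hs; rewrite /th' (linear_funB _ _ (@precomp_linear _ _ _)) precomp_del.
  rewrite -dze //; apply/eqP; rewrite subr_eq0; apply/eqP; apply: eq_del => u _.
  by rewrite xn_Dn.
(* By exactness at I', [th'] comes from [ka] in I; correcting [psi] by the coboundary of [ka] makes
   its image in I' vanish. *)
pose ka s := precomp (D j) (th' s).
have mka : mlin ka by apply: mlin_precomp.
apply: (conclude (fun s => psi s - ddel ka s)).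
- by apply: mlinB => //; apply: mlin_del.
- by move=> s; apply: inMB => //; apply: inM_del => u; apply: inM_D.
- move=> s hs; rewrite (linear_funB _ _ (@precomp_linear _ _ _)) -dth // precomp_del.
  apply/eqP; rewrite subr_eq0; apply/eqP; transitivity (ddel th' s).
    by rewrite delB del_del subr0.
  by apply: eq_del => u; rewrite hs => -[hu]; rewrite x_D ?kth'.
by move=> s hs; rewrite delB del_del subr0 dpsi.
Qed.

End Step.

(** Descending induction on [j], with a strong induction on the degree inside. The first half, in
    all degrees, supplies the acyclicity of I' required by the second. The condition on [c] ensures
    that the character flipped at step [j] is still trivial. *)
Lemma vanishesP j : (j <= N)%N -> forall c : nat -> bool, (forall i, (j <= i)%N -> c i = false) ->
  ((exists2 i, (i < N)%N & c i) -> forall m, vanishes c j m) /\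
  ((forall i, (i < N)%N -> c i = false) -> forall m, odd m -> vanishes c j m).
Proof.
move=> jN; rewrite -(subKn jN); elim: (N - j)%N (leq_subr j N) => [|d IH] dN c hc.
  rewrite subn0; split=> [[i iN ci] [|m]|_ [|m] // _]; [exact: vanishes0 ci | |];
  exact: vanishes_inj.
have dN' : (N - d.+1 < N)%N by rewrite ltn_subrL (leq_ltn_trans _ dN).
have eS : (N - d = (N - d.+1).+1)%N by rewrite subnSK.
have cj : c (N - d.+1)%N = false by apply: hc.
pose c' i := (i == (N - d.+1)%N) || c i.
have hc' i : (N - d <= i)%N -> c' i = false.
  rewrite eS => h; rewrite /c' hc ?(ltnW h) // orbF; apply/eqP => e.
  by move: h; rewrite e ltnn.
have hc1 i : (N - d <= i)%N -> c i = false by rewrite eS => /ltnW; apply: hc.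
have [vI1 vI2] := IH (ltnW dN) c hc1.
have [vI' _] := IH (ltnW dN) c' hc'.
have {vI'}: forall m, vanishes c' (N - d.+1).+1 m.
  by rewrite -eS; apply: vI'; exists (N - d.+1)%N; rewrite // /c' eqxx.
rewrite eS in vI1 vI2 => vI'; split=> [ex m | nc m om].
  elim/ltn_ind: m => m IHm; apply: vanishes_step => //; first exact: vI1.
  by move=> m' e; apply: IHm; rewrite e ltnW.
elim/ltn_ind: m om => m IHm om; apply: vanishes_step => //; first exact: vI2.
by move=> m' e; apply: IHm; [rewrite e ltnW | move: om; rewrite e /= negbK].
Qed.

(** The trivial module is realised as the multiples of [heps]; by [tg_gen] these are exactly the
    functionals with trivial characters that vanish on the left multiples of every [x i]. *)
Lemma odd_vanishing m (phi : seq A -> k^o) : odd m -> mlin phi ->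
  (forall s, size s = m.+1 -> del (counit_action A) phi s = 0) ->
  exists2 psi, mlin psi & forall s, size s = m -> del (counit_action A) psi s = phi s.
Proof.
move=> om mp cp.
pose eps : functional := linfun (heps : A -> k^o).
have epsE b : eps b = heps b by rewrite lfunE.
pose emb (a : k^o) : functional := (a : k) *: eps.
have emb_lin : linear emb by move=> a u v; rewrite /emb scalerDl scalerA.
have emb_del (F : seq A -> k^o) s : emb (del (counit_action A) F s) = ddel (fun u => emb (F u)) s.
  apply: del_map => // a v; apply/lfunP => b.
    rewrite /= dual_lactE !scale_lfunE !epsE rmorphM mulrC.
    by rewrite [RHS]mulrCA [RHS]mulrC.
  by rewrite /= /dual_ract /emb !scale_lfunE; apply/esym/mulrA.
have heM (a b : A) : heps (a * b) = (heps a : k) * heps b :> k by exact: rmorphM.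
have [_ van] := vanishesP (leq0n N) (c := fun=> false) (fun _ _ => erefl).
have hF s : inM (fun=> false) 0 (emb (phi s)).
  split=> [i iN b|i _ iN b]; rewrite /emb !scale_lfunE !epsE.
    by rewrite heM (tg_eps_g TG iN) /chi !mul1r.
  by rewrite heM (tg_eps_x TG iN) mul0r; apply: mulr0.
have mF : mlin (fun s => emb (phi s)).
  by move=> s1 s2 c a b; rewrite mp emb_lin.
have cF s : size s = m.+1 -> ddel (fun u => emb (phi u)) s = 0.
  by move=> hs; rewrite -emb_del cp // /emb scale0r.
have [G [mG hG dG]] := van (fun _ _ => erefl) m om _ mF hF cF.
exists (fun s => G s 1 : k^o).
  by move=> s1 s2 c a b; rewrite mG add_lfunE scale_lfunE.
move=> s hs; have eG u : G u = emb (G u 1).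
  have [gG xG] := hG u; apply/lfunP => b; rewrite scale_lfunE epsE.
  transitivity ((heps b : k) * G u 1 : k); last exact: mulrC.
  apply: (tg_gen TG (f := fun y => G u y : k^o)) => [|i y iN|i y iN]; first exact: linearP.
    by rewrite (gG i iN) mul1r.
  exact: (xG i (leq0n i) iN).
have := dG s hs; rewrite (eq_del _ (G := fun u => emb (G u 1))) => [|u _]; last exact: eG.
rewrite -emb_del => /(congr1 (fun f : functional => f 1 : k)).
by rewrite !scale_lfunE !epsE rmorph1 => e; rewrite -[LHS]mulr1 [RHS](esym (mulr1 _)).
Qed.

End Vanishing.

(** * Taft algebras and their tensor powers *)

Section TaftStructure.
Variables (k : fieldType) (m : nat) (omega : k) (T : hopfAlg k) (x g : T).
Local Notation n := m.+2.
Hypotheses (omP : n.-primitive_root omega) (n_neq0 : n%:R != 0 :> k).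
Hypothesis taftP : is_taft n omega x g.

(* By uniqueness in the universal property, the inclusion of the subalgebra
   generated by x and g is onto. *)
Lemma taft_generated (V : {vspace T}) : 1 \in V ->
  (forall v, v \in V -> x * v \in V) -> (forall v, v \in V -> g * v \in V) ->
  forall t, t \in V.
Proof.
move=> V1 Vx Vg t; pose U := (<[x]> + <[g]>)%VS.
pose S := agenv_aspace U.
have Sx : x \in S by apply: (subvP (sub_agenv U)); rewrite memvE addvSl.
have Sg : g \in S by apply: (subvP (sub_agenv U)); rewrite memvE addvSr.
have S1 : algid S = 1 by apply/eqP; rewrite algid_eq1 memvE sub1_agenv.
have [[gx xn gn] univ _ _ _] := taftP.
have valM (u v : subvs_of S) : vsval (u * v) = vsval u * vsval v by [].
have val1 : vsval (1 : subvs_of S) = 1 by exact: S1.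
have valX (u : subvs_of S) i : vsval (u ^+ i) = vsval u ^+ i.
  by elim: i => [|i IH]; rewrite ?expr0 // !exprS valM IH.
have relS : taft_relations n omega (vsproj S x) (vsproj S g).
  split; apply: subvs_inj.
  - by rewrite valM !vsprojK // [RHS]linearZ /= !vsprojK.
  - by rewrite valX vsprojK // xn linear0.
  - by rewrite valX vsprojK // gn.
have [phi [phix phig _]] := univ _ _ _ relS.
have [id' [_ _ uniq]] := univ T x g (And3 gx xn gn).
pose psi := fun t => vsval (phi t).
have psi_lin : linear psi by move=> c u v; rewrite /psi !linearP.
have psi_mul : monoid_morphism psi.
  by split=> [|u v]; rewrite /psi ?rmorph1 // rmorphM.
pose psiL := GRing.isLinear.Build k T T _ psi psi_lin.
pose psiM := GRing.isMonoidMorphism.Build T T psi psi_mul.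
pose Psi : {lrmorphism T -> T} := HB.pack psi psiL psiM.
have e1 : Psi =1 id' by apply: uniq; rewrite /= /psi (phix, phig) vsprojK.
have e2 : idfun =1 id' by exact: uniq.
have -> : t = psi t by rewrite -[LHS]/(idfun t) e2 -e1.
have : psi t \in S by apply: subvsP.
apply: subvP; apply: agenv_sub_modl; first by rewrite -memvE.
apply/prodvP => u v /memv_addP[u1 /vlineP[c1 ->] [u2 /vlineP[c2 ->] ->]] Vv.
by rewrite mulrDl -!scalerAl memvD ?memvZ ?Vx ?Vg.
Qed.

Lemma taft_ind (h1 h2 : T -> T) : linear h1 -> linear h2 -> h1 1 = h2 1 ->
  (forall t, h1 t = h2 t -> h1 (x * t) = h2 (x * t)) ->
  (forall t, h1 t = h2 t -> h1 (g * t) = h2 (g * t)) -> h1 =1 h2.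
Proof.
move=> l1 l2 e1 ex eg.
pose m1 := GRing.isLinear.Build k T T _ h1 l1.
pose m2 := GRing.isLinear.Build k T T _ h2 l2.
pose H1 : {linear T -> T} := HB.pack h1 m1.
pose H2 : {linear T -> T} := HB.pack h2 m2.
pose V := lker (linfun H1 - linfun H2).
have VP t : (t \in V) = (h1 t == h2 t).
  by rewrite memv_ker add_lfunE opp_lfunE !lfunE subr_eq0.
move=> t; apply/eqP; rewrite -VP; apply: taft_generated => [|v|v]; rewrite !VP.
- by rewrite e1.
- by move/eqP/ex->.
by move/eqP/eg->.
Qed.

Let om_n : omega ^+ n = 1. Proof. exact: prim_expr_order. Qed.

(* Representations on k^n, x being a shift: their first columns give the coordinates
   of an element of T on the basis x^j e_c, where e_c are the idempotents of k<g>. *)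
Definition taft_X : 'M[k]_n := \matrix_(i, j) (i == j.+1 :> nat)%:R.
Definition taft_G (c : nat) : 'M[k]_n :=
  \matrix_(i, j) (omega ^+ (c + i) *+ (i == j)).

Lemma taft_XX p : taft_X ^+ p = \matrix_(i, j) (i == (j + p)%N :> nat)%:R.
Proof.
elim: p => [|p IH]; apply/matrixP => i j.
  by rewrite expr0 !mxE addn0.
rewrite exprS IH !mxE; case: (posnP i) => [i0|i0].
  rewrite big1 ?i0 ?addnS // => l _; rewrite !mxE i0 mul0r //.
have il : (i.-1 < n)%N by rewrite (leq_ltn_trans (leq_pred i)).
rewrite (bigD1 (Ordinal il)) //= !mxE prednK // eqxx mul1r big1 ?addr0.
  by rewrite -[in RHS](prednK i0) addnS eqSS.
move=> l nl; rewrite !mxE; case: eqP => [e|_]; last by rewrite mul0r.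
by case/eqP: nl; apply: val_inj; rewrite /= e.
Qed.

Lemma taft_GX c p : taft_G c ^+ p = \matrix_(i, j) (omega ^+ ((c + i) * p) *+ (i == j)).
Proof.
elim: p => [|p IH]; apply/matrixP => i j.
  by rewrite expr0 !mxE muln0 expr0.
rewrite exprS IH !mxE (bigD1 i) //= !mxE eqxx big1 ?addr0.
  by rewrite mulr1n mulrnAr -exprD mulnS.
by move=> l nl; rewrite !mxE eq_sym (negPf nl) mul0r.
Qed.

Lemma taft_rel c : taft_relations n omega taft_X (taft_G c).
Proof.
split.
- apply/matrixP => i j; rewrite !mxE (bigD1 i) //= !mxE eqxx big1 ?addr0; last first.
    by move=> l nl; rewrite !mxE eq_sym (negPf nl) mul0r.
  rewrite (bigD1 j) //= !mxE eqxx big1 ?addr0; last first.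
    by move=> l nl; rewrite !mxE (negPf nl) mulr0.
  case: eqP => [->|_]; last by rewrite mulr0 mul0r mulr0.
  by rewrite mulr1 mul1r !mulr1n addnS exprS.
- apply/matrixP => i j; rewrite taft_XX !mxE.
  by rewrite (ltn_eqF (leq_trans (ltn_ord i) (leq_addl j n))).
apply/matrixP => i j; rewrite taft_GX !mxE mulnC exprM om_n expr1n.
by [].
Qed.

Lemma taft_rep c : exists phi : {lrmorphism T -> 'M[k]_n},
  phi x = taft_X /\ phi g = taft_G c.
Proof.
have [_ univ _ _ _] := taftP.
by have [phi [px pg _]] := univ _ _ _ (taft_rel c); exists phi.
Qed.

Lemma taft_coords : exists r : nat -> nat -> T -> k, [/\
  forall c j, linear (r c j : T -> k^o),
  forall c j, (j < n)%N -> r c j 1 = (j == 0)%:R,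
  forall c t, r c 0 (x * t) = 0,
  forall c j t, (j.+1 < n)%N -> r c j.+1 (x * t) = r c j t &
  forall c j t, (j < n)%N -> r c j (g * t) = omega ^+ (c + j) * r c j t].
Proof.
(* Only finitely many representations are chosen; other values of [c] are reduced modulo [n], which
   does not change the powers of [omega]. *)
have /fin_all_exists[phi phiP] (c : 'I_n) : exists phi : {lrmorphism T -> 'M[k]_n},
  phi x = taft_X /\ phi g = taft_G c by apply: taft_rep.
pose f (c : nat) := phi (inord (c %% n)).
have fx c : f c x = taft_X by case: (phiP (inord (c %% n))).
have fg c : f c g = taft_G (c %% n).
  by case: (phiP (inord (c %% n))) => _ ->; rewrite inordK ?ltn_pmod.
have fxM c t : f c (x * t) = taft_X *m f c t by rewrite -(fx c); exact: rmorphM.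
have fgM c t : f c (g * t) = taft_G (c %% n) *m f c t by rewrite -(fg c); exact: rmorphM.
exists (fun c j t => f c t (inord j) ord0); split.
- by move=> c j a t u; rewrite linearP !mxE.
- move=> c j jn; rewrite rmorph1 !mxE; congr (_%:R); congr nat_of_bool.
  apply/eqP/eqP => [/(congr1 (@nat_of_ord n))|->]; first by rewrite inordK.
  by apply: val_inj; rewrite /= inordK.
- move=> c t; rewrite fxM !mxE big1 // => l _; rewrite !mxE inordK // mul0r //.
- move=> c j t jn; have jn1 := ltnW jn.
  rewrite fxM !mxE (bigD1 (inord j)) //= !mxE !inordK // eqxx.
  rewrite mul1r big1 ?addr0 // => l nl; rewrite !mxE inordK //; case: eqP => [[e]|_].
    by case/eqP: nl; rewrite e inord_val.
  by rewrite mul0r.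
move=> c j t jn; rewrite fgM !mxE (bigD1 (inord j)) //= !mxE eqxx inordK // big1 ?addr0.
  by rewrite mulr1n !exprD (prim_expr_mod omP).
by move=> l nl; rewrite !mxE eq_sym (negPf nl) mul0r.
Qed.

Definition taft_e (c : nat) : T := n%:R^-1 *: \sum_(l < n) omega ^- (c * l) *: g ^+ l.

Lemma taft_ge c : g * taft_e c = omega ^+ c *: taft_e c.
Proof.
have [[_ _ gn] _ _ _ _] := taftP.
have om0 : omega != 0 by rewrite (prim_root_eq0 omP).
rewrite /taft_e -scalerAr scalerA mulrC -scalerA; congr (_ *: _).
pose u l : T := omega ^- (c * l) *: g ^+ l.
have -> : g * \sum_(l < n) omega ^- (c * l) *: g ^+ l = omega ^+ c *: \sum_(l < n) u l.+1.
  rewrite mulr_sumr scaler_sumr; apply: eq_bigr => l _.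
  rewrite /u -scalerAr -exprS scalerA mulnS exprD invfM mulrA mulfV ?mul1r //.
  by rewrite expf_neq0.
have un : u n = u 0 by rewrite /u gn muln0 !expr0 mulnC exprM om_n expr1n.
congr (_ *: _); rewrite -[RHS]/(\sum_(l < n) u l).
by rewrite big_ord_recr [RHS]big_ord_recl /= un addrC.
Qed.

Lemma taft_sum_e : \sum_(c < n) taft_e c = 1.
Proof.
have om0 : omega != 0 by rewrite (prim_root_eq0 omP).
rewrite /taft_e -scaler_sumr exchange_big big_ord_recl /= [X in _ + X]big1 => [|l _].
  under eq_bigr => c _ do rewrite muln0 expr0 invr1 scale1r.
  by rewrite addr0 expr0 sumr_const card_ord -scaler_nat scalerA mulVf // scale1r.
have qn : (bump 0 l < n)%N by rewrite /bump add1n ltnS.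
have q0 : (0 < bump 0 l)%N by rewrite /bump add1n.
move: (bump 0 l) qn q0 => q qn q0.
rewrite -scaler_suml -[RHS](scale0r (g ^+ q)); congr (_ *: _).
(* As [0 < q < n], this is an nth root of unity other than 1, so its powers sum to 0. *)
set z := omega ^- q.
have zn : z ^+ n = 1 by rewrite exprVn -exprM mulnC exprM om_n expr1n invr1.
have z1 : z != 1.
  rewrite invr_eq1 -(prim_order_dvd omP); apply/negP => /(dvdn_leq q0).
  by rewrite leqNgt qn.
have -> : \sum_(c < n) omega ^- (c * q) = \sum_(c < n) z ^+ c.
  by apply: eq_bigr => c _; rewrite exprVn -exprM mulnC.
by have /eqP := subrX1 z n; rewrite zn subrr eq_sym mulf_eq0 subr_eq0 (negPf z1) => /eqP.
Qed.

Lemma taft_gX j : g * x ^+ j = omega ^+ j *: (x ^+ j * g).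
Proof.
have [[gx _ _] _ _ _ _] := taftP.
elim: j => [|j IH]; first by rewrite !expr0 mulr1 mul1r scale1r.
rewrite exprS mulrA gx -scalerAl -[x * g * _]mulrA IH -scalerAr scalerA -exprS.
by rewrite mulrA -!exprS.
Qed.

Lemma taft_gXe j c : g * (x ^+ j * taft_e c) = omega ^+ (c + j) *: (x ^+ j * taft_e c).
Proof.
rewrite mulrA taft_gX -scalerAl -mulrA taft_ge -scalerAr scalerA.
by rewrite -exprD addnC.
Qed.

Lemma linear_sum_fun (I : Type) (s : seq I) (V W : lmodType k) (F : I -> V -> W) :
  (forall i, linear (F i)) -> linear (fun v => \sum_(i <- s) F i v).
Proof.
move=> lF c u v; rewrite scaler_sumr -big_split; apply: eq_bigr => i _.
exact: lF.
Qed.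

Lemma taft_gens1 : exists D E : 'End(T),
  taft_gens n omega 1 (fun=> x) (fun=> g) (fun=> D) (fun=> E).
Proof.
have [[gx xn gn] univ _ [ex eg] _] := taftP.
have [r [rlin r1 r0 rx rg]] := taft_coords.
have term_lin c j (w : T) : linear (fun t => r c j t *: w).
  by move=> a t u; rewrite rlin scalerDl scalerA.
(* [L] is the basis expansion, shown to be the identity in [LE]. [dd] lowers the exponent of [x] and
   drops the terms with [j = 0]; [ee] records the top coefficients, which multiplication by [x]
   loses. *)
pose L t := \sum_(c < n) \sum_(j < n) r c j t *: (x ^+ j * taft_e c).
pose dd t := \sum_(c < n) \sum_(j < m.+1) r c j.+1 t *: (x ^+ j * taft_e c).
pose ee t := \sum_(c < n) r c m.+1 t *: taft_e c.
have Llin : linear L by do 2!(apply: linear_sum_fun => ?).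
have dlin : linear dd by do 2!(apply: linear_sum_fun => ?).
have elin : linear ee by apply: linear_sum_fun.
have LE t : L t = t.
  apply: (taft_ind (h1 := L) (h2 := idfun)) => // [|u eu|u eu]; rewrite /L /=.
  - rewrite -[RHS]taft_sum_e; apply: eq_bigr => c _.
    rewrite big_ord_recl r1 // scale1r expr0 mul1r big1 ?addr0 // => j _.
    by rewrite r1 // scale0r.
  - rewrite /= in eu; rewrite -{2}eu mulr_sumr; apply: eq_bigr => c _.
    have xe : x * (x ^+ m.+1 * taft_e c) = 0 by rewrite mulrA -exprS xn mul0r.
    rewrite big_ord_recl r0 scale0r add0r [in RHS]big_ord_recr /= mulrDr.
    rewrite -[X in _ + X]scalerAr xe scaler0 addr0 mulr_sumr; apply: eq_bigr => j _.
    by rewrite -[RHS]scalerAr mulrA -exprS /bump leq0n add1n rx // ltnS.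
  rewrite /= in eu; rewrite -{2}eu mulr_sumr; apply: eq_bigr => c _.
  rewrite mulr_sumr; apply: eq_bigr => j _.
  by rewrite -[RHS]scalerAr taft_gXe rg // scalerA mulrC.
pose dm := GRing.isLinear.Build k T T _ dd dlin.
pose em := GRing.isLinear.Build k T T _ ee elin.
pose dL : {linear T -> T} := HB.pack dd dm.
pose eL : {linear T -> T} := HB.pack ee em.
have dE t : linfun dL t = dd t by rewrite lfunE.
have eE t : linfun eL t = ee t by rewrite lfunE.
have i0 i : (i < 1)%N -> i = 0%N by rewrite ltnS leqn0 => /eqP.
exists (linfun dL), (linfun eL); split=> //.
- by move=> i j /i0-> /i0->.
- move=> _ b _; rewrite dE eE; transitivity (L b - x ^+ m.+1 * ee b); last by rewrite LE.
  rewrite /L /dd /ee mulr_sumr -sumrB; apply: eq_bigr => c _.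
  rewrite [in RHS]big_ord_recr /= -[X in _ - X]scalerAr addrK.
  by apply: eq_bigr => j _; rewrite rx // ltnS.
- move=> _ b _; rewrite !dE /dd !mulr_sumr scaler_sumr; apply: eq_bigr => c _.
  rewrite mulr_sumr scaler_sumr; apply: eq_bigr => j _.
  rewrite -[X in _ = _ *: X]scalerAr taft_gXe rg; last by rewrite ltnS.
  by rewrite !scalerA; congr (_ *: _); rewrite addnS exprS; ring.
- by move=> i j b /i0-> /i0->.
- by move=> i j b /i0-> /i0->.
move=> f lf fg fx.
have epsM (a b : T) : heps (a * b) = (heps a : k) * heps b :> k by exact: rmorphM.
(* [taft_ind] compares maps into [T], so the scalars are embedded in [T] and recovered by [heps]. *)
pose h2 (t : T) : T := ((heps t : k) * f 1)%:A.
have l2 : linear h2.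
  move=> a t u; rewrite /h2 linearP mulrDl scalerDl; congr (_ + _).
  by rewrite scalerA; congr (_ *: _); apply: (esym (mulrA a _ _)).
have l1 : linear (fun t => (f t : k)%:A : T).
  by move=> a t u; rewrite lf scalerDl -scalerA.
move=> b.
have e := taft_ind l1 l2.
have /(congr1 (fun t => heps t : k)) : (f b : k)%:A = h2 b.
  apply: e => [|t et|t et]; rewrite /h2.
  - by rewrite rmorph1 mul1r.
  - by rewrite (fx 0%N) // epsM ex !mul0r.
  by rewrite (fg 0%N) // epsM eg mul1r.
by rewrite !heps_scalar.
Qed.

End TaftStructure.

(** * Adding one tensor factor to a system of Taft generators *)

Section TensorGens.
Variables (k : fieldType) (n : nat) (omega : k) (H K : hopfAlg k) (N : nat).
Local Notation HK := (tensor H K).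

Definition tens_end (u : 'End(H)) (v : 'End(K)) : 'End(HK) :=
  linfun (tlift (fun a b => pure (u a) (v b))).

Lemma tens_endE u v a b : tens_end u v (pure a b) = pure (u a) (v b).
Proof.
rewrite lfunE /= tliftE //.
by split=> [z c y y'|z c y y']; rewrite linearP (pureLl, pureLr).
Qed.

Lemma pureM (a a' : H) (b b' : K) : (pure a b : HK) * pure a' b' = pure (a * a') (b * b').
Proof. exact: tmul_pure. Qed.

Lemma pureZl c (a : H) (b : K) : pure (c *: a) b = c *: pure a b.
Proof. exact: (bilinZl _ _ _ (@pure_bilin _ _ _)). Qed.

Lemma pureZr c (a : H) (b : K) : pure a (c *: b) = c *: pure a b.
Proof. exact: (bilinZr _ _ _ (@pure_bilin _ _ _)). Qed.

Lemma pureXl (a : H) i : (pure a (1 : K) : HK) ^+ i = pure (a ^+ i) 1.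
Proof. by elim: i => [|i IH] //; rewrite !exprS IH pureM mulr1. Qed.

Lemma pureXr (b : K) i : (pure (1 : H) b : HK) ^+ i = pure 1 (b ^+ i).
Proof. by elim: i => [|i IH] //; rewrite !exprS IH pureM mulr1. Qed.

Lemma pureBl (a a' : H) (b : K) : pure (a - a') b = pure a b - pure a' b.
Proof. by rewrite -scaleN1r addrC pureLl scaleN1r addrC. Qed.

Lemma pureBr (a : H) (b b' : K) : pure a (b - b') = pure a b - pure a b'.
Proof. by rewrite -scaleN1r addrC pureLr scaleN1r addrC. Qed.

Variables (xH gH : H) (DH EH : 'End(H)) (xK gK : nat -> K) (DK EK : nat -> 'End(K)).
Hypotheses (TH : taft_gens n omega 1 (fun=> xH) (fun=> gH) (fun=> DH) (fun=> EH))
  (TK : taft_gens n omega N xK gK DK EK).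

Definition tens_x i : HK := if i is i'.+1 then pure 1 (xK i') else pure xH 1.
Definition tens_g i : HK := if i is i'.+1 then pure 1 (gK i') else pure gH 1.
Definition tens_D i := if i is i'.+1 then tens_end \1 (DK i') else tens_end DH \1.
Definition tens_E i := if i is i'.+1 then tens_end \1 (EK i') else tens_end EH \1.

Lemma mull_lin (a : HK) (f : HK -> HK) : linear f -> linear (fun w => a * f w).
Proof. by move=> lf c u v; rewrite lf mulrDr -scalerAr. Qed.

Lemma lmul_lin (a : HK) (f : HK -> HK) : linear f -> linear (fun w => f (a * w)).
Proof. by move=> lf c u v; rewrite mulrDr -scalerAr lf. Qed.

Lemma end_lin (u : 'End(HK)) : linear u.
Proof. exact: linearP. Qed.

(** On pure tensors, index 0 acts on the left slot and successors on the right one, so mixed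
    relations hold because the slots are independent. *)
Lemma tens_gens : taft_gens (A := tensor_hopf H K) n omega N.+1 tens_x tens_g tens_D tens_E.
Proof.
have h0 : (0 < 1)%N by [].
split.
- case=> [|i] iN; rewrite /tens_g ?pureXl ?pureXr ?(tg_gn TH h0) //.
  by rewrite (tg_gn TK iN).
- case=> [|i] iN; rewrite /tens_x ?pureXl ?pureXr ?(tg_xn TH h0) ?(tg_xn TK iN);
  by [rewrite -(scale0r 0) pureZl scale0r | rewrite -(scale0r 0) pureZr scale0r].
- case=> [|i] iN; rewrite /tens_g /tens_x [LHS]pureM [in RHS]pureM !mul1r.
    by rewrite (tg_gx TH h0) pureZl.
  by rewrite (tg_gx TK iN) pureZr.
- case=> [|i] [|j] iN jN; rewrite /tens_g [LHS]pureM [RHS]pureM ?mul1r ?mulr1 //.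
  by rewrite (tg_ggC TK iN jN).
- case=> [|i] [|j] iN jN ij; rewrite /tens_g /tens_x [LHS]pureM [RHS]pureM ?mul1r ?mulr1 //.
  by rewrite (tg_gxC TK iN jN ij).
- case=> [|i] [|j] iN jN; rewrite /tens_x [LHS]pureM [RHS]pureM ?mul1r ?mulr1 //.
  by rewrite (tg_xxC TK iN jN).
- case=> [|i] w iN; move: w; apply: tensor_ext => [|c u v|a b].
  - exact: lmul_lin (@end_lin _).
  - by rewrite linearP mulrDr -scalerAr; module_ring k.
  - rewrite /tens_x /tens_D /tens_E pureXl tens_endE !pureM tens_endE !id_lfunE !mul1r.
    by rewrite (tg_Dx TH _ h0) pureBl.
  - exact: lmul_lin (@end_lin _).
  - by rewrite linearP mulrDr -scalerAr; module_ring k.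
  rewrite /tens_x /tens_D /tens_E pureXr tens_endE !pureM tens_endE !id_lfunE !mul1r.
  by rewrite (tg_Dx TK _ iN) pureBr.
- case=> [|i] w iN; move: w; apply: tensor_ext => [|c u v|a b].
  - exact: lmul_lin (@end_lin _).
  - by rewrite linearP mulrDr -scalerAr; module_ring k.
  - rewrite /tens_g /tens_D tens_endE !pureM tens_endE !id_lfunE !mul1r.
    by rewrite (tg_Dg TH _ h0) pureZl.
  - exact: lmul_lin (@end_lin _).
  - by rewrite linearP mulrDr -scalerAr; module_ring k.
  rewrite /tens_g /tens_D tens_endE !pureM tens_endE !id_lfunE !mul1r.
  by rewrite (tg_Dg TK _ iN) pureZr.
- case=> [|i] [|j] w iN jN ij //; move: w; apply: tensor_ext => [||a b];
    try (by apply: lmul_lin; apply: end_lin); try (by apply: mull_lin; apply: end_lin).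
  - by rewrite /tens_g /tens_D tens_endE !pureM tens_endE !id_lfunE !mul1r.
  - by rewrite /tens_g /tens_D tens_endE !pureM tens_endE !id_lfunE !mul1r.
  rewrite /tens_g /tens_D tens_endE !pureM tens_endE !id_lfunE !mul1r.
  by rewrite (tg_DgC TK _ iN jN).
- case=> [|i] [|j] w iN jN ij //; move: w; apply: tensor_ext => [||a b];
    try (by apply: lmul_lin; apply: end_lin); try (by apply: mull_lin; apply: end_lin).
  - by rewrite /tens_x /tens_D tens_endE !pureM tens_endE !id_lfunE !mul1r.
  - by rewrite /tens_x /tens_D tens_endE !pureM tens_endE !id_lfunE !mul1r.
  rewrite /tens_x /tens_D tens_endE !pureM tens_endE !id_lfunE !mul1r.
  by rewrite (tg_DxC TK _ iN jN).
- case=> [|i] iN; rewrite [LHS]tens_eps_pure rmorph1 ?(tg_eps_g TH h0) ?(tg_eps_g TK iN) mulr1 //.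
- case=> [|i] iN; rewrite [LHS]tens_eps_pure ?(tg_eps_x TH h0) ?(tg_eps_x TK iN) ?mul0r ?mulr0 //.
(* One slot at a time: first the left with [b] fixed, then the right with 1 on the left. *)
move=> f lf fg fx; apply: tensor_ext => [//|c u v|a b].
  by rewrite linearP mulrDl; congr (_ + _); apply/esym/mulrA.
have fl b' : linear (fun a' => f (pure a' b')) by move=> c u v; rewrite pureLl lf.
have fr : linear (fun b' => f (pure (1 : H) b')) by move=> c u v; rewrite pureLr lf.
rewrite [heps _]tens_eps_pure (tg_gen TH (fl b)) => [|i a'  _|i a' _].
- rewrite (tg_gen TK fr) => [|i b' iN|i b' iN]; first exact: mulrA.
    by rewrite -(fg i.+1 (pure 1 b') iN) /tens_g pureM mul1r.
  by rewrite -(fx i.+1 (pure 1 b') iN) /tens_x pureM mul1r.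
- by rewrite -(fg 0%N (pure a' b)) // /tens_g pureM mul1r.
by rewrite -(fx 0%N (pure a' b)) // /tens_x pureM mul1r.
Qed.

End TensorGens.

Lemma hopf_power_gens (k : fieldType) (n : nat) (omega : k) (T : hopfAlg k) (x g : T) r :
  (1 < n)%N -> n.-primitive_root omega -> n%:R != 0 :> k -> is_taft n omega x g ->
  exists x' g' D E, @taft_gens k n omega (hopf_power T r) r.+1 x' g' D E.
Proof.
case: n => [|[|m]] // _ omP n0 taftP.
have [D [E TG]] := taft_gens1 omP n0 taftP.
elim: r => [|r [x' [g' [D' [E' TG']]]]].
  by exists (fun=> x), (fun=> g), (fun=> D), (fun=> E).
exists (tens_x x x'), (tens_g g g'), (tens_D D D'), (tens_E E E').
exact: tens_gens.
Qed.

(** * The theorem *)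

Section Gerstenhaber.
Variables (k : fieldType) (A : falgType k).
Implicit Types (f g F G h : seq A -> A) (s : seq A).

Lemma circle_ins m n f g s : (0 < n)%N -> (size s).+1 = (m + n)%N ->
  circle m n f g s = ins n g f s.
Proof.
move=> n0; elim: m s f => [|m IH] s f hs.
  by rewrite /circle big_ord0 ins_small //; move: hs; rewrite add0n => <-.
case: s hs => [|a s] hs; first by exfalso; move: hs n0 => /=; lia.
have hs' : (size s).+1 = (m + n)%N by case: hs.
rewrite /circle big_ord_recl ins_cons expr0 scale1r ifT; last by rewrite hs' leq_addl.
rewrite /circle_at take0 drop0 add0n; congr (_ + _).
rewrite -(IH s (fun u => f (a :: u)) hs').
rewrite scaler_sumr; apply: eq_bigr => i _; rewrite scalerA -exprD.
rewrite lift0; congr (_ *: _); apply: sign_odd_eq; rewrite mulSn !oddD /=.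
by case: n n0 {IH hs hs'} => // n' _ /=; rewrite negbK.
Qed.

Lemma gerstenhaber_brk m n f g s : (size s).+1 = (m.+1 + n.+1)%N ->
  gerstenhaber m.+1 n.+1 f g s = brk m.+1 n.+1 f g s.
Proof.
move=> hs; rewrite /gerstenhaber !circle_ins //; last by rewrite addnC.
rewrite /brk; congr (_ - _ *: _); rewrite /brsgn; apply: sign_odd_eq.
by rewrite !oddM /= !negbK.
Qed.

Lemma hoch_d_del m f s : size s = m.+1 -> hoch_d m f s = del (regular A) f s.
Proof.
move=> hs; rewrite /hoch_d /del hs -(ins_mu_sum _ hs) -sumrN.
case/lastP: s hs => // s b; rewrite size_rcons => -[hs].
congr (_ + _ + _ *: _); last first.
- by rewrite rterm_rcons /= -cats1 take_size_cat // nth_cat hs ltnn subnn.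
- by apply: eq_bigr => j _; rewrite exprS mulN1r scaleNr.
by case: s hs.
Qed.

Lemma insDg (W : lmodType k) n g g' (F : seq A -> W) s : mlin F ->
  ins n (fun u => g u + g' u) F s = ins n g F s + ins n g' F s.
Proof.
elim: s F => [|a s IH] F mF /=.
  by case: ifP; rewrite ?(linear_funD (mlin_head _ mF)) !addr0.
rewrite IH; last exact: mlin_cons.
by case: ifP => _; rewrite ?(linear_funD (mlin_head _ mF)); module_ring k.
Qed.

Lemma brkDl m n F F' G s : mlin G ->
  brk m n (fun u => F u + F' u) G s = brk m n F G s + brk m n F' G s.
Proof. by move=> mG; rewrite /brk insD insDg //; module_ring k. Qed.

Lemma eq_brk m n F F' G G' s : (size s).+1 = (m + n)%N ->
  (forall u, size u = m -> F u = F' u) -> (forall u, size u = n -> G u = G' u) ->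
  brk m n F G s = brk m n F' G' s.
Proof.
move=> hs eF eG; rewrite /brk; congr (_ - _ *: _); apply: eq_ins => // u; rewrite hs.
  by move/addIn/eF.
by rewrite addnC => /addnI/eG.
Qed.

Definition bounds m F := exists2 w, mlin w & forall s, size s = m.+1 -> F s = del (regular A) w s.

Lemma eq_bounds m F F' : (forall s, size s = m.+1 -> F s = F' s) -> bounds m F' -> bounds m F.
Proof. by move=> e [w mw dw]; exists w => // s hs; rewrite e // dw. Qed.

Lemma boundsD m F F' : bounds m F -> bounds m F' -> bounds m (fun s => F s + F' s).
Proof.
move=> [w mw dw] [w' mw' dw']; exists (fun s => w s + w' s); first exact: mlinD.
by move=> s hs; rewrite dw // dw' // delD.
Qed.

Lemma boundsZ m c F : bounds m F -> bounds m (fun s => c *: F s).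
Proof.
move=> [w mw dw]; exists (fun s => c *: w s); first exact: mlinZ.
by move=> s hs; rewrite dw // delZ.
Qed.

Lemma bounds_brkC m p q F G : bounds m (brk q p G F) -> bounds m (brk p q F G).
Proof.
move=> b; apply: eq_bounds (boundsZ (- brsgn k p q) b) => s _.
by rewrite brkC scaleNr.
Qed.

Lemma del_brk_cocycles p q F G s : mlin F -> mlin G ->
  (forall u, size u = p.+2 -> del (regular A) F u = 0) ->
  (forall u, size u = q.+2 -> del (regular A) G u = 0) ->
  size s = (p.+1 + q.+1)%N -> del (regular A) (brk p.+1 q.+1 F G) s = 0.
Proof.
move=> mF mG cF cG hs; rewrite del_brk //.
have h1 : (size s).+1 = (p.+1 + q.+2)%N by rewrite hs [in RHS]addnS.
have h2 : (size s).+1 = (p.+2 + q.+1)%N by rewrite hs [in RHS]addSn.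
rewrite (@eq_brk _ _ F F _ (fun=> 0) s h1) //.
rewrite [X in _ + _ *: X](@eq_brk _ _ _ (fun=> 0) G G s h2) //.
rewrite /brk !ins0.
have z m' (H : seq A -> A) : mlin H -> ins m' (fun=> 0) H s = 0.
  move=> mH; rewrite (eq_ins (g' := fun=> 0 *: 0) (F' := H)) //; last by rewrite scale0r.
  by rewrite insZg // scale0r.
by rewrite !z // !(scaler0, subr0, addr0).
Qed.

Lemma bounds_brk_del p q h G : mlin h -> mlin G ->
  (forall u, size u = q.+2 -> del (regular A) G u = 0) ->
  bounds (p + q) (brk p.+1 q.+1 (del (regular A) h) G).
Proof.
(* The factor cancels the sign [(-1) ^+ q.+2] in [del_brk]. *)
move=> mh mG cG; exists (fun s => (-1) ^+ q *: brk p q.+1 h G s).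
  by apply/mlinZ/mlin_brk.
move=> s hs; rewrite delZ del_brk // ?addnS //.
have h1 : (size s).+1 = (p + q.+2)%N by rewrite hs !addnS.
rewrite (@eq_brk _ _ h h _ (fun=> 0) s h1) //.
have -> : brk p q.+2 h (fun=> 0) s = 0.
  rewrite /brk ins0 scaler0 subr0.
  rewrite (eq_ins (g' := fun=> 0 *: 0) (F' := h)) //; last by rewrite scale0r.
  by rewrite insZg // scale0r.
by rewrite add0r sign_addn2 scalerA sign_sq scale1r.
Qed.

Lemma bounds_coboundary m F : bounds m F -> coboundary m F.
Proof.
move=> [w mw dw]; exists w => [s1 s2 c a b _|s hs]; first exact: mw.
by rewrite dw // hoch_d_del.
Qed.

End Gerstenhaber.

(** * The bracket of two embedded classes is a coboundary *)

Section EmbeddedBracket.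
Variables (k : fieldType) (A : hopfAlg k).
Hypothesis odd_van : forall m (phi : seq A -> k^o), odd m -> mlin phi ->
  (forall s, size s = m.+1 -> del (counit_action A) phi s = 0) ->
  exists2 psi, mlin psi & forall s, size s = m -> del (counit_action A) psi s = phi s.

Definition kcocycle m (phi : seq A -> k^o) :=
  mlin phi /\ forall s, size s = m.+1 -> del (counit_action A) phi s = 0.

Lemma del_til_cocycle m phi s : kcocycle m phi -> size s = m.+1 ->
  del (regular A) (til phi) s = 0.
Proof.
move=> [mp cp] hs; rewrite del_til // (eq_til (psi := fun=> 0)) => [|u hu].
  by rewrite /til tilr0 //; exact: scalef_bilin.
by rewrite cp // hu.
Qed.

Lemma bounds_til_odd p q phi psi : odd p.+1 -> kcocycle p.+1 phi -> kcocycle q.+1 psi ->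
  bounds (p + q) (brk p.+1 q.+1 (til phi) (til psi)).
Proof.
move=> op [mp cp] cq; have [z mz dz] := odd_van op mp cp.
have b := @bounds_brk_del _ _ p q (til z) (til psi) (mlin_til mz) (mlin_til cq.1)
  (fun u => del_til_cocycle cq).
apply: eq_bounds b => s hs; apply: eq_brk => // [|u hu]; first by rewrite hs addSn addnS.
by rewrite del_til //; apply: eq_til => v hv; rewrite dz // hv.
Qed.

Lemma bounds_til p q phi psi : kcocycle p.+1 phi -> kcocycle q.+1 psi ->
  bounds (p + q) (brk p.+1 q.+1 (til phi) (til psi)).
Proof.
move=> cp cq; case: (boolP (odd p.+1)) => op; first exact: bounds_til_odd.
case: (boolP (odd q.+1)) => oq.
  by apply: bounds_brkC; rewrite addnC; apply: bounds_til_odd.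
(* A k-valued cochain whose embedding is the bracket. Here [p] and [q] are both odd, so its degree
   [(p + q).+1] is odd. *)
pose chi s := ins q.+1 (til psi) phi s - brsgn k p.+1 q.+1 *: ins p.+1 (til phi) psi s.
have [mp _] := cp; have [mq _] := cq.
have mchi : mlin chi.
  by apply: mlinB; [|apply: mlinZ]; apply: mlin_ins => //; apply: mlin_til.
have Sb := @scalef_bilin k A.
have tchi s : til chi s = brk p.+1 q.+1 (til phi) (til psi) s.
  rewrite /brk /til !ins_tilr // -tilrZ // -tilrB //.
have [||z mz dz] := odd_van (m := (p + q).+1) _ mchi.
- by move: op oq; rewrite /= !negbK oddD => -> ->.
(* The bracket of two cocycles is a cocycle; applying [heps] carries this over to [chi]. *)
- move=> s hs; rewrite -(heps_til s); last exact: mlin_del.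
  rewrite -del_til // (eq_del _ (G := brk p.+1 q.+1 (til phi) (til psi))) => [|u _];
    last exact: tchi.
  rewrite del_brk_cocycles ?linear0 //; try exact: mlin_til.
  - by move=> u; apply: del_til_cocycle.
  - by move=> u; apply: del_til_cocycle.
  by rewrite hs addSn addnS.
exists (til z); first exact: mlin_til.
by move=> s hs; rewrite -tchi del_til //; apply: eq_til => u hu; rewrite dz // hu.
Qed.

Lemma embedded_bracket p q (alpha : yext (triv A) (triv A) p) (beta : yext (triv A) (triv A) q)
    (a b : seq A -> A) : embeds_as alpha a -> embeds_as beta b ->
  coboundary (p + q) (gerstenhaber p.+1 q.+1 a b).
Proof.
case/embeds_til => phi [h [mphi mh cphi ea]]; case/embeds_til => psi [h' [mpsi mh' cpsi eb]].
have cp : kcocycle p.+1 phi by [].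
have cq : kcocycle q.+1 psi by [].
have mtp := mlin_til mphi; have mtq := mlin_til mpsi.
(* [b] is multilinear in degree [q.+1] only; [G] agrees with it there and is multilinear in every
   degree. The same is done for [a]. *)
pose G s := til psi s + del (regular A) h' s.
have mG : mlin G by apply: mlinD => //; apply: mlin_del.
have cG u : size u = q.+2 -> del (regular A) G u = 0.
  by move=> hu; rewrite delD del_del addr0 (del_til_cocycle cq).
apply: bounds_coboundary.
apply: (@eq_bounds _ _ _ _ (fun s => brk p.+1 q.+1 (til phi) G s +
    brk p.+1 q.+1 (del (regular A) h) G s)) => [s hs|].
  have hs' : (size s).+1 = (p.+1 + q.+1)%N by rewrite hs addSn addnS.
  by rewrite gerstenhaber_brk // -brkDl //; apply: eq_brk.
apply: boundsD; last exact: bounds_brk_del.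
apply: bounds_brkC.
apply: (@eq_bounds _ _ _ _ (fun s => brk q.+1 p.+1 (til psi) (til phi) s +
    brk q.+1 p.+1 (del (regular A) h') (til phi) s)) => [s _|]; first exact: brkDl.
rewrite addnC; apply: boundsD; first exact: bounds_til.
by apply: bounds_brk_del => // u; apply: del_til_cocycle.
Qed.

End EmbeddedBracket.

Theorem theorem5p2 (k : fieldType) (n : nat) (omega : k)
    (T : hopfAlg k) (x g : T) (r p q : nat)
    (alpha : yext (triv (hopf_power T r)) (triv (hopf_power T r)) p)
    (beta : yext (triv (hopf_power T r)) (triv (hopf_power T r)) q)
    (a b : seq (hopf_power T r) -> hopf_power T r) :
  [pchar k] =i pred0 -> (2 <= n)%N -> n.-primitive_root omega ->
  is_taft n omega x g ->
  embeds_as alpha a -> embeds_as beta b ->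
  coboundary (p + q) (gerstenhaber p.+1 q.+1 a b).
Proof.
move=> k0 n2 omP taftP ea eb.
have n0 : n%:R != 0 :> k by rewrite ((pcharf0P k).1 k0) -lt0n ltnW.
have [x' [g' [D [E TG]]]] := hopf_power_gens r n2 omP n0 taftP.
apply: (embedded_bracket _ ea eb) => m phi om mphi cphi.
exact: (odd_vanishing n2 omP n0 TG om mphi cphi).
Qed.
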